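(* Let $R$ be an integral domain which is not a field and such that $R/(m)$ is finite for every $m\in R\setminus\{0\}$. Then $\mathfrak{A}(R)$ is isomorphic to the crossed product $C_0(\mathscr{R})\rtimes P_{Q(R)}$, where the $ax+b$-group $P_{Q(R)}$ acts on $\mathscr{R}$ via affine transformations.
   Context: Integral domains are commutative with unit. Write $R^\times=R\setminus\{0\}$, let $(m)$ be the ideal generated by $m$, and let $Q(R)$ be the quotient field of $R$. The algebra $\mathfrak{A}[R]$: it is the universal C*-algebra generated by isometries $\{s_m: m\in R^\times\}$ and unitaries $\{u^n: n\in R\}$ with the relations, for all $k,m\in R^\times$ and $l,n\in R$: (i) $s_ks_m=s_{km}$; (ii) $u^lu^n=u^{l+n}$; (iii) $s_mu^n=u^{mn}s_m$; (iv) $\sum_{n+(m)\in R/(m)}u^ne_mu^{-n}=1$, where $e_m=s_ms_m^*$ (the summand depends only on the coset $n+(m)$). Here $u^{-n}=(u^n)^*$. The stabilization $\mathfrak{A}(R)$: it is the C*-algebraic inductive limit of the system $\{\mathfrak{A}(R)_m;\varphi_{m,lm}\}$ indexed by $R^\times$ (ordered by divisibility), where $\mathfrak{A}(R)_m=\mathfrak{A}[R]$ for all $m\in R^\times$ and $\varphi_{m,lm}:\mathfrak{A}[R]\to\mathfrak{A}[R]$, $x\mapsto s_lxs_l^*$. The ring $\mathscr{R}$: let $\hat R=\varprojlim\{R/(m);p_{m,lm}\}$ be the profinite completion, where $m\in R^\times$ and $p_{m,lm}:R/(lm)\to R/(m)$ is the canonical projection; it is a compact topological ring containing $R$ diagonally.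 Let $\mathscr{R}=\varinjlim\{\mathscr{R}_m;\phi_{m,lm}\}$, where $\mathscr{R}_m=\hat R$ for all $m\in R^\times$ and $\phi_{m,lm}$ is multiplication by $l$. Explicitly, $\mathscr{R}$ is the quotient of $\coprod_{m\in R^\times}\mathscr{R}_m$ (with the quotient topology) by the relation that $x\in\mathscr{R}_l$ and $y\in\mathscr{R}_m$ are equivalent iff $mx=ly$. With $\iota_m:\hat R=\mathscr{R}_m\to\mathscr{R}$ the canonical map, $\mathscr{R}$ is a locally compact ring via $\iota_m(x)+\iota_l(y)=\iota_{lm}(lx+my)$ and $\iota_m(x)\iota_l(y)=\iota_{lm}(xy)$. The field $Q(R)$ is embedded in $\mathscr{R}$ by $r/m\mapsto\iota_m(r)$. The group: $P_{Q(R)}=\left\{\begin{pmatrix}a&b\\0&1\end{pmatrix}: a\in Q(R)\setminus\{0\},\ b\in Q(R)\right\}$, regarded as a discrete group, acting on $\mathscr{R}$ by $x\mapsto ax+b$. *)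

(* Defs.v *)
From HB Require Import structures.
From mathcomp Require Import all_boot all_order all_algebra.
From mathcomp Require Import ring_quotient fraction.
From mathcomp Require Import all_classical all_reals all_analysis.
From mathcomp Require Import complex ring.
Set Implicit Arguments.
Unset Strict Implicit.
Unset Printing Implicit Defensive.
Import Order.TTheory GRing.Theory Num.Theory.
Import numFieldNormedType.Exports.
Local Open Scope classical_set_scope.
Local Open Scope ring_scope.

(* A *-algebra here need not have a unit: the ring structures of ssralg are all
   unital, so the product is a separate operation [smul]. *)
HB.mixin Record Lmodule_isStarAlgebra (C : numClosedFieldType) A
    of GRing.Lmodule C A := {
  smul : A -> A -> A;
  star : A -> A;
  smulA : associative smul;
  smulDl : left_distributive smul +%R;
  smulDr : right_distributive smul +%R;
  smulZl : forall (c : C) x y, smul (c *: x) y = c *: smul x y;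
  smulZr : forall (c : C) x y, smul x (c *: y) = c *: smul x y;
  starK : involutive star;
  starD : {morph star : x y / x + y};
  starZ : forall (c : C) x, star (c *: x) = Num.conj c *: star x;
  starM : forall x y, star (smul x y) = smul (star y) (star x)
}.

#[short(type="starAlgType")]
HB.structure Definition StarAlgebra (C : numClosedFieldType) :=
  {A of GRing.Lmodule C A & Lmodule_isStarAlgebra C A}.

Notation "x ** y" := (smul x y) (at level 40, left associativity) : ring_scope.
Notation "x ^^*" := (star x) (at level 2, format "x ^^*") : ring_scope.

HB.mixin Record NormedStarAlgebra_isCStar (C : numClosedFieldType) A
    of StarAlgebra C A & CompleteNormedModule C A := {
  norm_smul : forall x y : A, `|x ** y| <= `|x| * `|y|;
  norm_cstar : forall x : A, `|x^^* ** x| = `|x| ^+ 2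
}.

#[short(type="cstarAlgType")]
HB.structure Definition CStarAlgebra (C : numClosedFieldType) :=
  {A of StarAlgebra C A & CompleteNormedModule C A
      & NormedStarAlgebra_isCStar C A}.

Section StarAlgebraTheory.
Variables (C : numClosedFieldType) (A : starAlgType C).
Implicit Types x y : A.

Lemma smul0r x : 0 ** x = 0.
Proof. by have := smulZl (0 : C) (0 : A) x; rewrite !scale0r. Qed.

Lemma smulr0 x : x ** 0 = 0.
Proof. by have := smulZr (0 : C) x (0 : A); rewrite !scale0r. Qed.

Lemma star0 : (0 : A)^^* = 0.
Proof. by have := starZ (0 : C) (0 : A); rewrite rmorph0 !scale0r. Qed.

Lemma smul_sumr (I : Type) (r : seq I) x (F : I -> A) :
  x ** (\sum_(i <- r) F i) = \sum_(i <- r) x ** F i.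
Proof. exact: (big_morph (smul x) (smulDr x) (smulr0 x)). Qed.

Lemma smul_suml (I : Type) (r : seq I) x (F : I -> A) :
  (\sum_(i <- r) F i) ** x = \sum_(i <- r) F i ** x.
Proof.
exact: (big_morph (fun y => smul y x) (fun a b => smulDl a b x) (smul0r x)).
Qed.

Lemma star_sum (I : Type) (r : seq I) (F : I -> A) :
  (\sum_(i <- r) F i)^^* = \sum_(i <- r) (F i)^^*.
Proof. exact: (big_morph star (@starD C A) star0). Qed.

End StarAlgebraTheory.

Section StarHom.
Variable C : numClosedFieldType.

(* *-homomorphisms of C*-algebras are automatically contractive, so no
   continuity is required. *)
Definition star_hom (A B : starAlgType C) (f : A -> B) : Prop :=
  [/\ {morph f : x y / x + y}, (forall (c : C) x, f (c *: x) = c *: f x),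
      {morph f : x y / x ** y} & {morph f : x / x^^*}].

Definition cstar_isomorphic (A B : cstarAlgType C) : Prop :=
  exists2 f : A -> B, star_hom f & bijective f.

Definition is_unit_elt (A : starAlgType C) (e : A) : Prop :=
  forall x, e ** x = x /\ x ** e = x.

(* [B], with [j], is the Hausdorff completion of [S] for the largest C*-seminorm,
   expressed by its universal property. *)
Definition is_enveloping_cstar (S : starAlgType C) (B : cstarAlgType C)
    (j : S -> B) : Prop :=
  star_hom j /\
  forall (D : cstarAlgType C) (f : S -> D), star_hom f ->
    exists! g : B -> D, star_hom g /\ g \o j = f.

(* [L] is the colimit, in the category of C*-algebras and (not necessarily
   unital) *-homomorphisms, of the system with connecting maps [phi h], one for
   each arrow [h] of the index category. *)
Definition is_cstar_inductive_limit (I : Type) (Hom : I -> I -> Type)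
    (A : I -> cstarAlgType C) (phi : forall i j, Hom i j -> A i -> A j)
    (L : cstarAlgType C) (psi : forall i, A i -> L) : Prop :=
  [/\ forall i, star_hom (psi i),
      forall i j (h : Hom i j), psi j \o phi i j h = psi i
    & forall (D : cstarAlgType C) (theta : forall i, A i -> D),
        (forall i, star_hom (theta i)) ->
        (forall i j (h : Hom i j), theta j \o phi i j h = theta i) ->
        exists! f : L -> D, star_hom f /\ forall i, f \o psi i = theta i].

Lemma star_hom0 (A B : starAlgType C) (f : A -> B) : star_hom f -> f 0 = 0.
Proof. by case=> _ fZ _ _; have := fZ 0 0; rewrite !scale0r. Qed.

Lemma star_hom_sum (A B : starAlgType C) (f : A -> B) (I : Type) (r : seq I)
  (F : I -> A) : star_hom f -> f (\sum_(i <- r) F i) = \sum_(i <- r) f (F i).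
Proof.
move=> fh; have f0 := star_hom0 fh; case: fh => fD _ _ _.
exact: (big_morph f fD f0).
Qed.

End StarHom.

Section ComplexComplete.
Variable K : realType.
Local Notation C := (K[i]).

Lemma Re_norm_eq (z : C) : (complex.Re `|z|)%:C%C = `|z|.
Proof. exact/RRe_real/normr_real. Qed.

Lemma norm_le_ReIm (z : C) :
  `|z| <= (`|complex.Re z| + `|complex.Im z|)%:C%C.
Proof.
rewrite normc_def lecR -[leRHS]ger0_norm ?addr_ge0// -sqrtr_sqr.
rewrite ler_wsqrtr// sqrrD !real_normK ?num_real//.
by rewrite addrAC lerDl mulrn_wge0// mulr_ge0.
Qed.

Lemma normc_ge_Im (z : C) : `|complex.Im z|%:C%C <= `|z|.
Proof.
rewrite normc_def lecR -[leLHS]ger0_norm// -sqrtr_sqr ler_wsqrtr//.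
by rewrite real_normK ?num_real// lerDr sqr_ge0.
Qed.

Lemma complex_complete (F : set_system C^o) :
  ProperFilter F -> cauchy F -> cvg F.
Proof.
move=> FF /cauchyP Fc.
have key (p : C -> K) : (forall z w, p (z - w) = p z - p w) ->
    (forall z, `|p z|%:C%C <= `|z|) -> cvg (p @ F).
  move=> pB pn; apply: R_complete; apply/cauchy_exP => e e0.
  have /Fc[z Fz] : 0 < e%:C%C by rewrite ltcR.
  exists (p z); rewrite nbhs_simpl/=; apply: filterS Fz => w.
  rewrite -!ball_normE/= -pB => zw.
  by rewrite -ltcR (le_lt_trans (pn _)).
have /cvg_ex[a cRe] : cvg (@complex.Re K @ F).
  by apply: key; [case=> ? ? [] | move=> z; exact: normc_ge_Re].
have /cvg_ex[b cIm] : cvg (@complex.Im K @ F).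
  by apply: key; [case=> ? ? [] | exact: normc_ge_Im].
apply/cvg_ex; exists (Complex a b : C^o).
apply/(@cvgrPdist_lt _ _ _ F _ id) => e e0.
have [r r0 re] : exists2 r : K, 0 < r & r%:C%C = e.
  exists (complex.Re e); first by move: e0; rewrite ltcE => /andP[].
  by apply: RRe_real; rewrite gtr0_real.
have r2 : 0 < r / 2 by rewrite divr_gt0.
move/cvgrPdist_lt : cRe => /(_ _ r2) HRe.
move/cvgrPdist_lt : cIm => /(_ _ r2) HIm.
near=> z.
rewrite -re (le_lt_trans (norm_le_ReIm _))// ltcR [ltRHS]splitr.
have hR : `|a - complex.Re z| < r / 2 by near: z.
have hI : `|b - complex.Im z| < r / 2 by near: z.
by clear -hR hI; case: z hR hI => x y /= hR hI; rewrite ltrD.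
Unshelve. all: by end_near. Qed.

HB.instance Definition _ := Uniform_isComplete.Build C^o complex_complete.

End ComplexComplete.

Section C0.
Variables (K : realType) (X : topologicalType).
Local Notation C := (K[i]).

Definition vanishes_at_infty (f : X -> C^o) : Prop :=
  forall e : C, 0 < e -> exists2 Q : set X, compact Q &
    forall x, ~ Q x -> `|f x| < e.

Definition C0_pred : {pred X -> C^o} :=
  fun f => `[< continuous f /\ vanishes_at_infty f >].

Record C0 := MkC0 { C0_fun :> X -> C^o; _ : C0_fun \in C0_pred }.

HB.instance Definition _ := [isSub for C0_fun].
HB.instance Definition _ := [Choice of C0 by <:].

Lemma C0P (f : X -> C^o) :
  reflect (continuous f /\ vanishes_at_infty f) (f \in C0_pred).
Proof. exact: asboolP. Qed.

Lemma C0_continuous (f : C0) : continuous f.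
Proof. by case: f => f /= /C0P[]. Qed.

Lemma C0_vanishes (f : C0) : vanishes_at_infty f.
Proof. by case: f => f /= /C0P[]. Qed.

Lemma C0_submod_closed : submod_closed C0_pred.
Proof.
split=> [|c f g /C0P[fc fv] /C0P[gc gv]]; apply/C0P; split.
- exact: cst_continuous.
- by move=> e e0; exists set0; [exact: compact0|move=> x _; rewrite normr0].
- move=> x; apply: (@continuousD _ C^o X (fun y => c *: f y) g); last exact: gc.
  by apply: (@continuousZl_tmp _ C^o X) => //; exact: fc.
- move=> e e0.
  have c1 : 0 < `|c| + 1 by rewrite ltr_wpDl.
  have [] := fv (e / 2 / (`|c| + 1)); first by rewrite !divr_gt0.
  move=> Q Qc Qf; have [|S Sc Sg] := gv (e / 2); first by rewrite divr_gt0.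
  exists (Q `|` S) => [|x /not_orP[/Qf fx /Sg gx]]; first exact: compactU.
  rewrite (le_lt_trans (ler_normD _ _))// [ltRHS]splitr ler_ltD//.
  rewrite normrZ; move/ltW: fx; rewrite ler_pdivlMr// => /(le_trans _); apply.
  by rewrite mulrC ler_wpM2l// lerDl.
Qed.

HB.instance Definition _ :=
  GRing.isSubmodClosed.Build C (X -> C^o) C0_pred C0_submod_closed.
HB.instance Definition _ := [SubChoice_isSubLmodule of C0 by <:].

Lemma C0_ext (f g : C0) : (forall x, f x = g x) -> f = g.
Proof. by move=> fg; apply/val_inj/funext. Qed.

Lemma C0D (f g : C0) x : (f + g) x = f x + g x. Proof. by []. Qed.
Lemma C0Z (c : C) (f : C0) x : (c *: f) x = c * f x. Proof. by []. Qed.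

Lemma C0_bounded (f : C0) : exists2 M : K, 0 <= M & forall x, `|f x| <= M%:C%C.
Proof.
have [Q Qc Qf] := C0_vanishes f (@ltr01 C).
pose g x := complex.Re `|f x|.
have gc : continuous g.
  move=> x; apply/cvgrPdist_lt => e e0.
  have eC : 0 < e%:C%C by rewrite ltcR.
  have /cvgrPdist_lt/(_ _ eC) := @C0_continuous f x.
  apply: filterS => y fxy; rewrite -ltcR (le_lt_trans _ fxy)//.
  rewrite (le_trans _ (ler_dist_dist _ _))//.
  have -> : g x - g y = complex.Re (`|f x| - `|f y|).
    by rewrite /g; case: `|f x| => ? ?; case: `|f y|.
  exact: normc_ge_Re.
have gQ : compact (g @` Q).
  by apply: continuous_compact => //; exact: continuous_subspaceT.
have [B [_ HB]] := compact_bounded gQ.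
have [M HM] : exists M : K, forall y, (g @` Q) y -> `|y| <= M.
  by exists (B + 1) => y; apply: HB; rewrite ltrDl.
exists (`|M| + 1); first by rewrite addr_ge0.
move=> x.
have [Qx|/Qf/ltW fx] := pselect (Q x); last first.
  by apply: (le_trans fx); rewrite -[1]/(1%:C%C) lecR lerDr.
rewrite -Re_norm_eq lecR (le_trans (ler_norm _))//.
rewrite (le_trans (HM _ _))//; first by exists x.
by rewrite (le_trans (ler_norm _))// lerDl.
Qed.


Definition C0_norm (f : C0) : K := sup (range (fun x => complex.Re `|f x|)).

Lemma C0_norm_ge (f : C0) x : `|f x| <= (C0_norm f)%:C%C.
Proof.
rewrite -Re_norm_eq lecR; apply: ub_le_sup; last by exists x.
have [M _ HM] := C0_bounded f.
by exists M => _ [y _ <-]; rewrite -lecR Re_norm_eq.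
Qed.

Lemma C0_norm_le (f : C0) (M : K) : 0 <= M ->
  (forall x, `|f x| <= M%:C%C) -> C0_norm f <= M.
Proof.
move=> M0 HM; rewrite /C0_norm.
have [->|ne] := eqVneq (range (fun x => complex.Re `|f x|)) set0.
  by rewrite sup0.
apply: ge_sup; first exact/set0P.
by move=> _ [y _ <-]; rewrite -lecR Re_norm_eq.
Qed.

Lemma C0_norm_ge0 (f : C0) : 0 <= C0_norm f.
Proof.
have [r0|/set0P[_ [x _ _]]] := eqVneq (range (fun x => complex.Re `|f x|)) set0.
  by rewrite /C0_norm r0 sup0.
by have := le_trans (normr_ge0 _) (C0_norm_ge f x); rewrite lecR.
Qed.

Lemma C0_norm_eq (f : C0) (M : K) : 0 <= M ->
  (forall x, `|f x| <= M%:C%C) ->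
  (forall N, 0 <= N -> (forall x, `|f x| <= N%:C%C) -> M <= N) ->
  C0_norm f = M.
Proof.
move=> M0 HM Mmin; apply/eqP; rewrite eq_le C0_norm_le//=.
by apply: Mmin; [exact: C0_norm_ge0|exact: C0_norm_ge].
Qed.

Lemma C0_ler_normD (f g : C0) :
  (C0_norm (f + g))%:C%C <= (C0_norm f)%:C%C + (C0_norm g)%:C%C :> C.
Proof.
rewrite -rmorphD lecR; apply: C0_norm_le; first by rewrite addr_ge0 ?C0_norm_ge0.
move=> x; rewrite rmorphD/= (le_trans (ler_normD _ _))// lerD//; exact: C0_norm_ge.
Qed.

Lemma C0_normZ (c : C) (f : C0) :
  (C0_norm (c *: f))%:C%C = `|c| * (C0_norm f)%:C%C.
Proof.
have [->|c0] := eqVneq c 0.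
  rewrite normr0 mul0r (_ : C0_norm _ = 0)//; apply: C0_norm_eq => //.
  by move=> x; rewrite C0Z mul0r normr0.
rewrite -[in RHS]Re_norm_eq -rmorphM; congr (_%:C%C).
have nc0 : 0 < complex.Re `|c|.
  by rewrite -ltcR Re_norm_eq normr_gt0.
apply: C0_norm_eq => [|x|N N0 HN].
- by rewrite mulr_ge0 ?C0_norm_ge0// ltW.
- by rewrite C0Z normrM rmorphM/= Re_norm_eq ler_wpM2l//; exact: C0_norm_ge.
- rewrite -ler_pdivlMl//; apply: C0_norm_le => [|x].
    by rewrite mulr_ge0// invr_ge0 ltW.
  rewrite rmorphM/= fmorphV/= Re_norm_eq ler_pdivlMl ?normr_gt0//.
  by rewrite -normrM; exact: HN.
Qed.

Lemma C0_norm0_eq0 (f : C0) : (C0_norm f)%:C%C = 0 :> C -> f = 0.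
Proof.
move=> f0; apply: C0_ext => x; apply/eqP; rewrite -normr_eq0 eq_le normr_ge0.
by rewrite andbT -f0; exact: C0_norm_ge.
Qed.

HB.instance Definition _ := @Lmodule_isNormed.Build C C0
  (fun f => (C0_norm f)%:C%C) C0_ler_normD C0_normZ C0_norm0_eq0.

Lemma C0_normE (f : C0) : `|f| = (C0_norm f)%:C%C. Proof. by []. Qed.

Lemma C0_complete (F : set_system C0) : ProperFilter F -> cauchy F -> cvg F.
Proof.
move=> FF /cauchy_ballP Fc.
have Fx x : cvg ((fun f : C0 => f x) @ F).
  apply: complex_complete; apply/cauchy_exP => e e0.
  have /cauchy_ballP/cauchyP/(_ e e0)[f Ff] := Fc.
  exists (f x); rewrite nbhs_simpl/=; apply: filterS Ff => h.
  rewrite -!ball_normE/=; apply: le_lt_trans.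
  exact: (C0_norm_ge (f - h) x).
pose g : X -> C^o := fun x => lim ((fun f : C0 => f x) @ F).
have close (e : C) : 0 < e -> F [set f : C0 | forall x, `|g x - f x| <= e].
  move=> e0; have := Fc e e0; rewrite near2E => -[[P Q]/= [FP FQ] PQ].
  near=> f => x.
  have Pf : P f by near: f.
  have /cvgrPdist_le Fgx : (fun f : C0 => f x) @ F --> g x := Fx x.
  apply/ler_addgt0Pr => d d0; near F => h.
  have Qh : Q h by near: h.
  have hg : `|g x - h x| <= d by near: h; exact: Fgx.
  rewrite (le_trans (ler_distD (h x) _ _))// addrC lerD//.
  have := PQ (f, h) (conj Pf Qh); rewrite /= -ball_normE/= => /ltW.
  by rewrite distrC; apply: le_trans; exact: (C0_norm_ge (f - h) x).
have g0 : g \in C0_pred.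
  apply/C0P; split.
    move=> x; apply/cvgrPdist_le => e e0.
    have e3 : 0 < e / 3 by rewrite divr_gt0.
    have /filter_ex[f fg] := close _ e3.
    have /cvgrPdist_le/(_ _ e3) := @C0_continuous f x.
    apply: filterS => y fxy.
    rewrite (le_trans (ler_distD (f x) _ _))//.
    have -> : e = e / 3 + (e / 3 + e / 3) by field.
    rewrite lerD// (le_trans (ler_distD (f y) _ _))// lerD//.
    by rewrite distrC.
  move=> e e0.
  have e2 : 0 < e / 2 by rewrite divr_gt0.
  have /filter_ex[f fg] := close _ e2.
  have [Q Qc Qf] := C0_vanishes f e2.
  exists Q => // x /Qf fx.
  rewrite -[g x](subrK (f x)) (le_lt_trans (ler_normD _ _))// [ltRHS]splitr.
  exact: ler_ltD.
apply/cvg_ex; exists (MkC0 g0); apply/(@cvgrPdist_le _ _ _ F _ id) => e e0.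
have := close _ e0; apply: filterS => f fg.
rewrite -[e]RRe_real ?gtr0_real// C0_normE lecR; apply: C0_norm_le => [|x].
  by rewrite -lecR RRe_real ?gtr0_real// ltW.
by rewrite RRe_real ?gtr0_real//; exact: fg.
Unshelve. all: by end_near. Qed.

HB.instance Definition _ := Uniform_isComplete.Build C0 C0_complete.


Lemma C0_mul_subproof (f g : C0) : (fun x => f x * g x : C^o) \in C0_pred.
Proof.
apply/C0P; split.
  move=> x; apply: (@continuousZ C C^o X f g x); exact: C0_continuous.
move=> e e0.
have [Q Qc Qf] := C0_vanishes f (@ltr01 C).
have [S Sc Sg] := C0_vanishes g e0.
exists (Q `|` S) => [|x /not_orP[/Qf fx /Sg gx]]; first exact: compactU.
by rewrite normrM -[e]mul1r ltr_pM.
Qed.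

Lemma C0_conj_subproof (f : C0) : (fun x => Num.conj (f x) : C^o) \in C0_pred.
Proof.
apply/C0P; split.
  move=> x; apply/cvgrPdist_lt => e e0.
  have /cvgrPdist_lt/(_ _ e0) := @C0_continuous f x.
  by apply: filterS => y; rewrite -rmorphB norm_conjC.
move=> e e0; have [Q Qc Qf] := C0_vanishes f e0.
by exists Q => // x /Qf; rewrite norm_conjC.
Qed.

Definition C0_mul (f g : C0) : C0 := MkC0 (C0_mul_subproof f g).
Definition C0_conj (f : C0) : C0 := MkC0 (C0_conj_subproof f).

Fact C0_mulA : associative C0_mul.
Proof. by move=> f g h; apply: C0_ext => x; exact: mulrA. Qed.
Fact C0_mulDl : left_distributive C0_mul +%R.
Proof. by move=> f g h; apply: C0_ext => x; exact: mulrDl. Qed.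
Fact C0_mulDr : right_distributive C0_mul +%R.
Proof. by move=> f g h; apply: C0_ext => x; exact: mulrDr. Qed.
Fact C0_mulZl (c : C) f g : C0_mul (c *: f) g = c *: C0_mul f g.
Proof. by apply: C0_ext => x; exact: esym (mulrA _ _ _). Qed.
Fact C0_mulZr (c : C) f g : C0_mul f (c *: g) = c *: C0_mul f g.
Proof. by apply: C0_ext => x; exact: mulrCA. Qed.
Fact C0_conjK : involutive C0_conj.
Proof. by move=> f; apply: C0_ext => x; exact: conjCK. Qed.
Fact C0_conjD : {morph C0_conj : f g / f + g}.
Proof. by move=> f g; apply: C0_ext => x; exact: rmorphD. Qed.
Fact C0_conjZ (c : C) f : C0_conj (c *: f) = Num.conj c *: C0_conj f.
Proof. by apply: C0_ext => x; exact: rmorphM. Qed.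
Fact C0_conjM f g : C0_conj (C0_mul f g) = C0_mul (C0_conj g) (C0_conj f).
Proof. by apply: C0_ext => x; rewrite /= rmorphM mulrC. Qed.

HB.instance Definition _ := Lmodule_isStarAlgebra.Build C C0
  C0_mulA C0_mulDl C0_mulDr C0_mulZl C0_mulZr C0_conjK C0_conjD C0_conjZ
  C0_conjM.

Fact C0_norm_mul (f g : C0) : `|f ** g| <= `|f| * `|g|.
Proof.
rewrite !C0_normE -rmorphM lecR; apply: C0_norm_le => [|x].
  by rewrite mulr_ge0// C0_norm_ge0.
by rewrite normrM rmorphM/= ler_pM//; exact: C0_norm_ge.
Qed.

Fact C0_norm_cstar (f : C0) : `|f^^* ** f| = `|f| ^+ 2.
Proof.
rewrite !C0_normE -rmorphXn; congr (_%:C%C).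
have E x : `|(f^^* ** f) x| = `|f x| ^+ 2 by rewrite normrM norm_conjC.
apply: C0_norm_eq => [|x|N N0 HN].
- by rewrite sqr_ge0.
- by rewrite E rmorphXn/= lerXn2r ?nnegrE//; [exact: le_trans (C0_norm_ge f x)|exact: C0_norm_ge].
- rewrite -[leRHS]sqr_sqrtr// lerXn2r ?nnegrE ?sqrtr_ge0 ?C0_norm_ge0//.
  apply: C0_norm_le => [|x]; first exact: sqrtr_ge0.
  rewrite -(@ler_pXn2r _ 2) ?nnegrE//; last by rewrite -[0]/(0%:C%C) lecR sqrtr_ge0.
  have -> : (Num.sqrt N)%:C%C ^+ 2 = N%:C%C :> C by rewrite -rmorphXn sqr_sqrtr.
  by rewrite -E; exact: HN.
Qed.

HB.instance Definition _ :=
  NormedStarAlgebra_isCStar.Build C C0 C0_norm_mul C0_norm_cstar.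

End C0.

Record cstar_action (G : groupType) (C : numClosedFieldType)
    (A : cstarAlgType C) := CStarAction {
  cact :> G -> A -> A;
  cact_hom : forall g, star_hom (cact g);
  cact1 : forall a, cact 1%g a = a;
  cactM : forall g h a, cact (g * h)%g a = cact g (cact h a)
}.

Section CrossedProduct.
Variables (G : groupType) (C : numClosedFieldType) (A : cstarAlgType C).
Variable al : cstar_action G A.

Definition Cc_pred : {pred G -> A} :=
  fun f => `[< finite_set [set g | f g != 0] >].

(* C_c(G, A) depends on the action, which is kept in its type, only through its
   product and involution. *)
Record Cc (beta : cstar_action G A) :=
  MkCc { Cc_fun :> G -> A; _ : Cc_fun \in Cc_pred }.

Local Notation CcG := (Cc al).

HB.instance Definition _ beta := [isSub for (@Cc_fun beta)].
HB.instance Definition _ beta := [Choice of Cc beta by <:].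

Lemma CcP (f : G -> A) :
  reflect (finite_set [set g | f g != 0]) (f \in Cc_pred).
Proof. exact: asboolP. Qed.

Lemma Cc_finite (f : CcG) : finite_set [set g | f g != 0].
Proof. by case: f => f /= /CcP. Qed.

Lemma Cc_submod_closed : submod_closed Cc_pred.
Proof.
split=> [|c f k /CcP ff /CcP fk]; apply/CcP.
  by apply: (sub_finite_set _ (@finite_set0 G)) => g /=; rewrite eqxx.
have : finite_set ([set g | f g != 0] `|` [set g | k g != 0]).
  by rewrite finite_setU.
apply: sub_finite_set => g /=; apply: contraNP => /not_orP[].
by move=> /negP/negPn/eqP + /negP/negPn/eqP; rewrite !fctE => -> ->; rewrite scaler0 addr0.
Qed.

HB.instance Definition _ :=
  GRing.isSubmodClosed.Build C (G -> A) Cc_pred Cc_submod_closed.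
HB.instance Definition _ (beta : cstar_action G A) :=
  [SubChoice_isSubLmodule of Cc beta by <:].

Lemma Cc_ext (f k : CcG) : (forall g, f g = k g) -> f = k.
Proof. by move=> fk; apply/val_inj/funext. Qed.

Lemma cactD g a b : al g (a + b) = al g a + al g b.
Proof. by case: (cact_hom al g). Qed.
Lemma cactZ g (c : C) a : al g (c *: a) = c *: al g a.
Proof. by case: (cact_hom al g). Qed.
Lemma cact_mul g a b : al g (a ** b) = al g a ** al g b.
Proof. by case: (cact_hom al g). Qed.
Lemma cact_star g a : al g (a^^*) = (al g a)^^*.
Proof. by case: (cact_hom al g). Qed.
Lemma cact0 g : al g 0 = 0.
Proof. exact: star_hom0 (cact_hom al g). Qed.

(* The product and involution of C_c(G, A) for a discrete group G, where the
   function [f] stands for the formal sum of the [f g] u_g, subject to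
   u_g a = al_g(a) u_g. The sum is finite since [f] has finite support. *)
Definition conv (f k : G -> A) : G -> A := fun g =>
  \sum_(h \in [set: G]) f h ** al h (k (h^-1 * g)%g).
Definition invol (f : G -> A) : G -> A := fun g => al g (f g^-1%g)^^*.

Lemma convE (f : CcG) (k : G -> A) (s : seq G) g : uniq s ->
  (forall h, f h != 0 -> h \in s) ->
  conv f k g = \sum_(h <- s) f h ** al h (k (h^-1 * g)%g).
Proof.
move=> us fs; rewrite /conv [RHS]fsbig_seq//.
apply/esym/fsbig_widen => // h [_ /= hs]; apply/eqP.
rewrite (_ : f h = 0) ?smul0r ?eqxx//.
by apply/eqP; apply: contra_notT hs => /fs.
Qed.

Lemma Cc_supp (f : CcG) : exists2 s : seq G, uniq s & forall h, f h != 0 -> h \in s.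
Proof.
exists (finmap.enum_fset (fset_set [set g | f g != 0])).
  exact: finmap.fset_uniq.
by move=> h fh; rewrite in_fset_set ?inE//; exact: Cc_finite.
Qed.

Lemma conv_subproof (f k : CcG) : conv f k \in Cc_pred.
Proof.
have [s us fs] := Cc_supp f; have [t ut kt] := Cc_supp k.
apply/CcP/(sub_finite_set _ (finite_seq [seq (p * q)%g | p <- s, q <- t])) => g /=.
apply: contraNT => gst; rewrite (convE _ _ us fs) big_seq big1// => h hs.
rewrite (_ : k _ = 0) ?cact0 ?smulr0//.
apply/eqP; apply: contraNT gst => /kt kh; apply/allpairsP.
by exists (h, (h^-1 * g)%g); split=> //=; rewrite mulVKg.
Qed.

Lemma invol_subproof (f : CcG) : invol f \in Cc_pred.
Proof.
have [s us fs] := Cc_supp f.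
apply/CcP/(sub_finite_set _ (finite_seq [seq g^-1%g | g <- s])) => g /=.
apply: contraNT => gs; rewrite /invol (_ : f _ = 0) ?star0 ?cact0//.
apply/eqP; apply: contraNT gs => /fs fg; apply/mapP.
by exists (g^-1)%g => //; rewrite invgK.
Qed.

Definition Cc_mul (f k : CcG) : CcG := MkCc _ (conv_subproof f k).
Definition Cc_star (f : CcG) : CcG := MkCc _ (invol_subproof f).

Fact Cc_mulDl : left_distributive Cc_mul +%R.
Proof.
move=> f k l; apply: Cc_ext => g.
have [s us fs] := Cc_supp f; have [t ut kt] := Cc_supp k.
pose u := undup (s ++ t).
have uu : uniq u := undup_uniq _.
have fu h : f h != 0 -> h \in u by rewrite mem_undup mem_cat => /fs ->.
have ku h : k h != 0 -> h \in u by rewrite mem_undup mem_cat orbC => /kt ->.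
have fku h : (f + k) h != 0 -> h \in u.
  apply: contraNT => hu; have : (f h == 0) && (k h == 0).
    by apply/andP; split; [apply: contraNT hu; exact: fu|apply: contraNT hu; exact: ku].
  by move=> /andP[/eqP fh /eqP kh]; rewrite -[_ h]/(f h + k h) fh kh addr0.
rewrite -[RHS]/(conv f l g + conv k l g) /= (convE _ _ uu fku).
rewrite (convE _ _ uu fu) (convE _ _ uu ku) -big_split/=.
by apply: eq_bigr => h _; rewrite -smulDl.
Qed.

Fact Cc_mulDr : right_distributive Cc_mul +%R.
Proof.
move=> f k l; apply: Cc_ext => g; have [s us fs] := Cc_supp f.
rewrite -[RHS]/(conv f k g + conv f l g) /= !(convE _ _ us fs) -big_split/=.
by apply: eq_bigr => h _; rewrite -smulDr -cactD.
Qed.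

Fact Cc_mulZl (c : C) f k : Cc_mul (c *: f) k = c *: Cc_mul f k.
Proof.
apply: Cc_ext => g; have [s us fs] := Cc_supp f.
have cfs h : (c *: f) h != 0 -> h \in s.
  move=> H; apply: fs; apply: contraNneq H => fh.
  by rewrite -[_ h]/(c *: f h) fh scaler0.
rewrite -[RHS]/(c *: conv f k g) /= (convE _ _ us fs) (convE _ _ us cfs).
by rewrite scaler_sumr; apply: eq_bigr => h _; rewrite -smulZl.
Qed.

Fact Cc_mulZr (c : C) f k : Cc_mul f (c *: k) = c *: Cc_mul f k.
Proof.
apply: Cc_ext => g; have [s us fs] := Cc_supp f.
rewrite -[RHS]/(c *: conv f k g) /= !(convE _ _ us fs).
by rewrite scaler_sumr; apply: eq_bigr => h _; rewrite -smulZr -cactZ.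
Qed.

Fact Cc_mulA : associative Cc_mul.
Proof.
move=> f k l; apply: Cc_ext => g.
have [s us fs] := Cc_supp f; have [t ut kt] := Cc_supp k.
pose u := undup [seq (p * q)%g | p <- s, q <- t].
have uu : uniq u := undup_uniq _.
have fku h : Cc_mul f k h != 0 -> h \in u.
  apply: contraNT; rewrite mem_undup => gst.
  rewrite /= (convE _ _ us fs) big_seq big1// => p ps.
  rewrite (_ : k _ = 0) ?cact0 ?smulr0//.
  apply/eqP; apply: contraNT gst => /kt kh; apply/allpairsP.
  by exists (p, (p^-1 * h)%g); split=> //=; rewrite mulVKg.
rewrite -[LHS]/(conv f (Cc_mul k l) g) -[RHS]/(conv (Cc_mul f k) l g).
rewrite (convE _ _ uu fku) (convE _ _ us fs).
under eq_bigr => p _ do rewrite /= (convE _ _ ut kt) (star_hom_sum _ _ (cact_hom al p)) smul_sumr.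
under [RHS]eq_bigr => h _ do rewrite /= (convE _ _ us fs) smul_suml.
rewrite [RHS]exchange_big/=.
rewrite [LHS]big_seq [RHS]big_seq; apply: eq_bigr => p ps.
transitivity (\sum_(h <- [seq (p * q)%g | q <- t])
    f p ** al p (k (p^-1 * h)%g) ** al h (l (h^-1 * g)%g)).
  rewrite big_map; apply: eq_bigr => q _.
  by rewrite mulKg cact_mul smulA cactM invgM mulgA.
rewrite fsbig_seq ?map_inj_uniq//; last exact: mulgI.
rewrite [RHS]fsbig_seq//; apply: fsbig_widen.
  move=> h /= /mapP[q qt ->]; rewrite mem_undup; apply/allpairsP.
  by exists (p, q).
move=> h [_ /=] /negP ht; rewrite (_ : k _ = 0) ?cact0 ?smulr0 ?smul0r//.
apply/eqP; apply: contraNT ht => /kt kh; apply/mapP.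
by exists (p^-1 * h)%g => //; rewrite mulVKg.
Qed.

Fact Cc_starK : involutive Cc_star.
Proof.
move=> f; apply: Cc_ext => g.
by rewrite /= /invol invgK -cact_star starK -cactM mulgV cact1.
Qed.

Fact Cc_starD : {morph Cc_star : f k / f + k}.
Proof.
move=> f k; apply: Cc_ext => g.
by rewrite -[RHS]/(invol f g + invol k g) /= /invol -cactD -starD.
Qed.

Fact Cc_starZ (c : C) f : Cc_star (c *: f) = Num.conj c *: Cc_star f.
Proof.
apply: Cc_ext => g.
by rewrite -[RHS]/(Num.conj c *: invol f g) /= /invol -cactZ -starZ.
Qed.

Fact Cc_starM f k : Cc_star (Cc_mul f k) = Cc_mul (Cc_star k) (Cc_star f).
Proof.
apply: Cc_ext => g; have [s us fs] := Cc_supp f.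
rewrite -[RHS]/(conv (invol k) (invol f) g) -[LHS]/(invol (conv f k) g).
rewrite /invol (convE _ _ us fs) star_sum (star_hom_sum _ _ (cact_hom al g)).
transitivity (\sum_(p <- [seq (g * h)%g | h <- s])
    invol k p ** al p (invol f (p^-1 * g)%g)).
  rewrite big_map; apply: eq_bigr => h _.
  rewrite starM -cact_star cact_mul -cactM /invol.
  have -> : ((g * h)^-1 * g = h^-1)%g by rewrite invgM mulgVK.
  by rewrite -(cactM al (g * h)) mulgK invgK invgM.
rewrite fsbig_seq ?map_inj_uniq//; last exact: mulgI.
apply: fsbig_widen => // p [_ /=] /negP ps.
rewrite {2}/invol (_ : f _ = 0) ?star0 ?cact0 ?smulr0//.
apply/eqP; apply: contraNT ps => /fs fp; apply/mapP.
by eexists; first exact: fp; rewrite invgM invgK mulVKg.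
Qed.

HB.instance Definition _ := Lmodule_isStarAlgebra.Build C (Cc al)
  Cc_mulA Cc_mulDl Cc_mulDr Cc_mulZl Cc_mulZr Cc_starK Cc_starD Cc_starZ
  Cc_starM.

(* The full crossed product, as the enveloping C*-algebra of C_c(G, A): a
   *-homomorphism out of C_c(G, A) is the integrated form of a covariant
   representation. *)
Definition is_crossed_product (X : cstarAlgType C) (j : Cc al -> X) : Prop :=
  is_enveloping_cstar j.

End CrossedProduct.

Section Quotients.
Variable R : idomainType.

Record nonzero := MkNonzero { nzval :> R; _ : nzval != 0 }.
HB.instance Definition _ := [isSub for nzval].
HB.instance Definition _ := [Choice of nonzero by <:].
Implicit Types m l k : nonzero.

Lemma nzP m : m != 0 :> R. Proof. by case: m. Qed.
Definition nz1 : nonzero := MkNonzero (oner_neq0 R).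
Definition nzM l m : nonzero := MkNonzero (mulf_neq0 (nzP l) (nzP m)).

Definition pideal (a : R) : {pred R} := fun x => `[< exists y, x = a * y >].

Fact pideal_zmod_closed a : zmod_closed (pideal a).
Proof.
split=> [|x y /asboolP[u ->] /asboolP[v ->]]; apply/asboolP.
  by exists 0; rewrite mulr0.
by exists (u - v); rewrite mulrBr.
Qed.

HB.instance Definition _ a :=
  GRing.isZmodClosed.Build R (pideal a) (pideal_zmod_closed a).

(* The library makes [{ideal_quot I}] a ring only for proper ideals (and a
   non-trivial ring), whereas R/(a) is also needed when [a] is a unit. *)
Definition Rmod (a : R) := {ideal_quot (pideal a)}.
HB.instance Definition _ a := GRing.Zmodule.on (Rmod a).

Definition cls (a x : R) : Rmod a := (\pi_({ideal_quot (pideal a)}) x)%qT.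

Definition rep (a : R) (c : Rmod a) : R := repr (c : {ideal_quot (pideal a)}).

Lemma repK a (c : Rmod a) : cls a (rep c) = c.
Proof. by rewrite /cls /rep reprK. Qed.

Lemma clsP a x y : reflect (exists z, x - y = a * z) (cls a x == cls a y).
Proof.
apply: (iffP idP); rewrite /cls -Quotient.idealrBE.
  by move=> /asboolP.
by move=> H; apply/asboolP.
Qed.

Lemma cls_eq a x y z : x - y = a * z -> cls a x = cls a y.
Proof. by move=> H; apply/eqP/clsP; exists z. Qed.

Lemma rep_cls a x : exists z, rep (cls a x) = x + a * z.
Proof.
have /eqP/clsP[z E] := repK (cls a x).
by exists z; rewrite -E subrKC.
Qed.

Lemma clsD a x y : cls a (x + y) = cls a x + cls a y.
Proof. by rewrite /cls raddfD. Qed.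
Lemma cls0 a : cls a 0 = 0. Proof. by rewrite /cls raddf0. Qed.
Lemma clsN a x : cls a (- x) = - cls a x. Proof. by rewrite /cls raddfN. Qed.

Definition Rmod_mul a (c d : Rmod a) : Rmod a := cls a (rep c * rep d).

Lemma cls_mul a x y : cls a (x * y) = Rmod_mul (cls a x) (cls a y).
Proof.
rewrite /Rmod_mul; have [u ->] := rep_cls a x; have [v ->] := rep_cls a y.
by apply: (@cls_eq _ _ _ (- (x * v + u * y + a * u * v))); ring.
Qed.

Fact Rmod_mulA a : associative (@Rmod_mul a).
Proof.
move=> x y z; rewrite -(repK x) -(repK y) -(repK z).
by rewrite -!cls_mul mulrA.
Qed.
Fact Rmod_mulC a : commutative (@Rmod_mul a).
Proof. by move=> x y; rewrite /Rmod_mul mulrC. Qed.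
Fact Rmod_mul1 a : left_id (cls a 1) (@Rmod_mul a).
Proof. by move=> x; rewrite -(repK x) -cls_mul mul1r. Qed.
Fact Rmod_mulDl a : left_distributive (@Rmod_mul a) +%R.
Proof.
move=> x y z; rewrite -(repK x) -(repK y) -(repK z).
by rewrite -!(cls_mul, clsD) mulrDl.
Qed.

HB.instance Definition _ a := GRing.Zmodule_isComPzRing.Build (Rmod a)
  (@Rmod_mulA a) (@Rmod_mulC a) (@Rmod_mul1 a) (@Rmod_mulDl a).

Lemma cls1 a : cls a 1 = 1. Proof. by []. Qed.
Lemma clsM a x y : cls a (x * y) = cls a x * cls a y.
Proof. exact: cls_mul. Qed.

(* The canonical projection R/(la) -> R/(a). *)
Definition proj_mod (l a : R) (c : Rmod (l * a)) : Rmod a := cls a (rep c).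

Lemma proj_cls (l a x : R) : proj_mod (cls (l * a) x) = cls a x.
Proof.
rewrite /proj_mod; have [z ->] := rep_cls (l * a) x.
by apply: (@cls_eq _ _ _ (l * z)); ring.
Qed.

Lemma proj_modD (l a : R) (c d : Rmod (l * a)) :
  proj_mod (c + d) = proj_mod c + proj_mod d.
Proof. by rewrite -(repK c) -(repK d) -clsD !proj_cls clsD. Qed.
Lemma proj_modN (l a : R) (c : Rmod (l * a)) : proj_mod (- c) = - proj_mod c.
Proof. by rewrite -(repK c) -clsN !proj_cls clsN. Qed.
Lemma proj_modM (l a : R) (c d : Rmod (l * a)) :
  proj_mod (c * d) = proj_mod c * proj_mod d.
Proof. by rewrite -(repK c) -(repK d) -clsM !proj_cls clsM. Qed.

Definition compatible (x : forall m : nonzero, Rmod m) : Prop :=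
  forall m l : nonzero, proj_mod (x (nzM l m)) = x m.

Record Rhat := MkRhat {
  Rhat_coord :> forall m : nonzero, Rmod m;
  _ : `[< compatible Rhat_coord >] }.

HB.instance Definition _ := [isSub for Rhat_coord].
HB.instance Definition _ := gen_eqMixin Rhat.
HB.instance Definition _ := gen_choiceMixin Rhat.

Lemma Rhat_compat (x : Rhat) m l : proj_mod (x (nzM l m)) = x m.
Proof. by case: x => x p; exact: (asboolW p). Qed.

Lemma Rhat_ext (x y : Rhat) : (forall m, x m = y m) -> x = y.
Proof.
case: x y => [x px] [y py] /= xy.
have E : x = y := @boolp.functional_extensionality_dep _ _ x y xy.
by move: px; rewrite E => px; rewrite (Prop_irrelevance px py).
Qed.

Fact Rhat_zero_subproof : `[< compatible (fun m => cls m 0) >].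
Proof. by apply/asboolP => m l; rewrite proj_cls. Qed.
Fact Rhat_diag_subproof (r : R) : `[< compatible (fun m => cls m r) >].
Proof. by apply/asboolP => m l; rewrite proj_cls. Qed.
Fact Rhat_add_subproof (x y : Rhat) : `[< compatible (fun m => x m + y m) >].
Proof. by apply/asboolP => m l; rewrite proj_modD !Rhat_compat. Qed.
Fact Rhat_opp_subproof (x : Rhat) : `[< compatible (fun m => - x m) >].
Proof. by apply/asboolP => m l; rewrite proj_modN !Rhat_compat. Qed.
Fact Rhat_mul_subproof (x y : Rhat) : `[< compatible (fun m => x m * y m) >].
Proof. by apply/asboolP => m l; rewrite proj_modM !Rhat_compat. Qed.

Definition diag (r : R) : Rhat := MkRhat (Rhat_diag_subproof r).
Definition Rhat_add x y : Rhat := MkRhat (Rhat_add_subproof x y).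
Definition Rhat_opp x : Rhat := MkRhat (Rhat_opp_subproof x).
Definition Rhat_mul x y : Rhat := MkRhat (Rhat_mul_subproof x y).

Fact Rhat_addA : associative Rhat_add.
Proof. by move=> x y z; apply: Rhat_ext => m /=; rewrite addrA. Qed.
Fact Rhat_addC : commutative Rhat_add.
Proof. by move=> x y; apply: Rhat_ext => m /=; rewrite addrC. Qed.
Fact Rhat_add0 : left_id (diag 0) Rhat_add.
Proof. by move=> x; apply: Rhat_ext => m /=; rewrite cls0 add0r. Qed.
Fact Rhat_addN : left_inverse (diag 0) Rhat_opp Rhat_add.
Proof. by move=> x; apply: Rhat_ext => m /=; rewrite cls0 addNr. Qed.
HB.instance Definition _ := GRing.isZmodule.Build Rhat
  Rhat_addA Rhat_addC Rhat_add0 Rhat_addN.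
Fact Rhat_mulA : associative Rhat_mul.
Proof. by move=> x y z; apply: Rhat_ext => m /=; rewrite mulrA. Qed.
Fact Rhat_mulC : commutative Rhat_mul.
Proof. by move=> x y; apply: Rhat_ext => m /=; rewrite mulrC. Qed.
Fact Rhat_mul1 : left_id (diag 1) Rhat_mul.
Proof. by move=> x; apply: Rhat_ext => m /=; rewrite cls1 mul1r. Qed.
Fact Rhat_mulDl : left_distributive Rhat_mul +%R.
Proof. by move=> x y z; apply: Rhat_ext => m /=; rewrite mulrDl. Qed.
HB.instance Definition _ := GRing.Zmodule_isComPzRing.Build Rhat
  Rhat_mulA Rhat_mulC Rhat_mul1 Rhat_mulDl.

Lemma RhatDE (x y : Rhat) m : (x + y) m = x m + y m. Proof. by []. Qed.
Lemma RhatME (x y : Rhat) m : (x * y) m = x m * y m. Proof. by []. Qed.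
Lemma diagM a b : diag (a * b) = diag a * diag b.
Proof. by apply: Rhat_ext => m; rewrite /= clsM. Qed.
Lemma diagD a b : diag (a + b) = diag a + diag b.
Proof. by apply: Rhat_ext => m; rewrite /= clsD. Qed.
Lemma diag1 : diag 1 = 1. Proof. by []. Qed.
Lemma diag0 : diag 0 = 0. Proof. by []. Qed.

Lemma diag_reg (l : nonzero) (x : Rhat) : diag l * x = 0 -> x = 0.
Proof.
move=> lx; apply: Rhat_ext => m; rewrite -(Rhat_compat x m l).
have := congr1 (fun y : Rhat => y (nzM l m)) lx; rewrite RhatME /=.
rewrite -{1}(repK (x (nzM l m))) -clsM => /eqP/clsP[z].
rewrite subr0 -mulrA => /(mulfI (nzP l)) E.
rewrite /proj_mod; apply: (@cls_eq _ _ _ z).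
by rewrite subr0.
Qed.

Lemma diag_inj (l : nonzero) : injective (fun x => diag l * x).
Proof.
move=> x y /eqP; rewrite -subr_eq0 -mulrBr => /eqP/diag_reg/eqP.
by rewrite subr_eq0 => /eqP.
Qed.

HB.instance Definition _ := Topological.copy Rhat
  (initial_topology (fun x : Rhat =>
     (x : forall m, Rmod m) :
       prod_topology (fun m : nonzero => discrete_topology (Rmod m)))).

Lemma Rhat_nbhs (x : Rhat) m : nbhs x [set y : Rhat | y m = x m].
Proof.
apply: (@initial_continuous Rhat (prod_topology
  (fun m : nonzero => discrete_topology (Rmod m))) (fun x => x : forall m, _)
  x [set y | y m = x m]).
apply: (@proj_continuous _ (fun m : nonzero => discrete_topology (Rmod m)) m
  (x : forall m, _) [set c | c = x m]).
by rewrite /nbhs/=; apply/principal_filterP.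
Qed.

Lemma Rhat_continuous (F : Rhat -> Rhat) :
  (forall m, exists m', forall x y : Rhat, y m' = x m' -> F y m = F x m) ->
  continuous F.
Proof.
move=> HF; apply: continuous_comp_initial => x.
have FF : Filter (([eta Rhat_coord] \o F) y @[y --> x]). by apply: fmap_filter; exact: nbhs_filter.
apply/cvg_sup => m U [?/= [[W oW <-]]] /= Wx WU.
have [m' Fm] := HF m.
by apply: (filterS _ (Rhat_nbhs x m')) => y /= /Fm yx; apply: WU; rewrite /= yx.
Qed.

Lemma Rhat_add_continuous (x : Rhat) : continuous (fun y : Rhat => x + y).
Proof.
by apply: Rhat_continuous => m; exists m => y z yz; rewrite !RhatDE yz.
Qed.

Lemma Rhat_mul_continuous (x : Rhat) : continuous (fun y : Rhat => x * y).
Proof.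
by apply: Rhat_continuous => m; exists m => y z yz; rewrite !RhatME yz.
Qed.

End Quotients.

Section FiniteAdeles.
Variable R : idomainType.
Local Notation Rx := (nonzero R).
Local Notation Rh := (Rhat R).
Implicit Types (k l m : nonzero R) (x y : Rhat R).
Local Open Scope quotient_scope.

(* The coproduct of the copies of [Rhat R] indexed by the nonzero [m], with the
   topology of [sigT_topology]. *)
Definition coprodR := {m : Rx & Rh}.

Definition scr_equiv (p q : coprodR) : bool :=
  diag (tag q) * tagged p == diag (tag p) * tagged q.

Fact scr_equiv_refl : reflexive scr_equiv.
Proof. by move=> p; rewrite /scr_equiv. Qed.
Fact scr_equiv_sym : symmetric scr_equiv.
Proof. by move=> p q; rewrite /scr_equiv eq_sym. Qed.
Fact scr_equiv_trans : transitive scr_equiv.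
Proof.
move=> [m y] [l x] [k z]; rewrite /scr_equiv /= => /eqP xy /eqP yz.
apply/eqP/(@diag_inj _ m) => /=.
by rewrite mulrCA xy mulrCA yz mulrCA.
Qed.

Canonical scr_equiv_rel :=
  EquivRel scr_equiv scr_equiv_refl scr_equiv_sym scr_equiv_trans.

Definition scrR := quotient_topology {eq_quot scr_equiv}.

HB.instance Definition _ := Topological.on scrR.

(* [scr_in m x] is the class of [x] in the copy indexed by [m]; it plays the role
   of x / m. *)
Definition scr_in (m : Rx) (x : Rh) : scrR :=
  \pi_{eq_quot scr_equiv} (existT (fun=> Rh) m x).

Lemma scr_inP l m x y :
  reflect (diag m * x = diag l * y) (scr_in l x == scr_in m y).
Proof.
apply: (iffP idP) => [/eqP/eqmodP/eqP//|xy].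
by apply/eqP/eqmodP; rewrite /= /scr_equiv /= xy.
Qed.

Lemma scr_in_eq l m x y : diag m * x = diag l * y -> scr_in l x = scr_in m y.
Proof. by move=> xy; apply/eqP/scr_inP. Qed.

Definition scr_idx (z : scrR) : Rx := tag (repr (z : {eq_quot scr_equiv})).
Definition scr_val (z : scrR) : Rh := tagged (repr (z : {eq_quot scr_equiv})).

Lemma scr_inK z : scr_in (scr_idx z) (scr_val z) = z.
Proof.
rewrite /scr_in /scr_idx /scr_val -[RHS](@reprK _ {eq_quot scr_equiv}).
by case: (repr _).
Qed.

Lemma scr_in_ind (P : scrR -> Prop) : (forall m x, P (scr_in m x)) -> forall z, P z.
Proof. by move=> H z; rewrite -(scr_inK z). Qed.

Lemma scr_in_repr m x :
  diag m * scr_val (scr_in m x) = diag (scr_idx (scr_in m x)) * x.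
Proof. by apply/scr_inP; rewrite scr_inK. Qed.

Definition scr_add (z w : scrR) : scrR :=
  scr_in (nzM (scr_idx z) (scr_idx w))
    (diag (scr_idx z) * scr_val w + diag (scr_idx w) * scr_val z).
Definition scr_mul (z w : scrR) : scrR :=
  scr_in (nzM (scr_idx z) (scr_idx w)) (scr_val z * scr_val w).
Definition scr_opp (z : scrR) : scrR := scr_in (scr_idx z) (- scr_val z).

Lemma scr_in_add m l x y :
  scr_add (scr_in m x) (scr_in l y) = scr_in (nzM l m) (diag l * x + diag m * y).
Proof.
have := scr_in_repr m x; have := scr_in_repr l y; rewrite /scr_add.
move: (scr_idx _) (scr_val _) => l' y' E; move: (scr_idx _) (scr_val _) => m' x' E'.
apply: scr_in_eq; rewrite /= !diagM.
transitivity (diag m * diag m' * (diag l * y') + diag l * diag l' * (diag m * x')).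
  by ring.
by rewrite E E'; ring.
Qed.

Lemma scr_in_mul m l x y :
  scr_mul (scr_in m x) (scr_in l y) = scr_in (nzM l m) (x * y).
Proof.
have := scr_in_repr m x; have := scr_in_repr l y; rewrite /scr_mul.
move: (scr_idx _) (scr_val _) => l' y' E; move: (scr_idx _) (scr_val _) => m' x' E'.
apply: scr_in_eq; rewrite /= !diagM.
transitivity ((diag l * y') * (diag m * x')); first by ring.
by rewrite E E'; ring.
Qed.

Lemma scr_in_opp m x : scr_opp (scr_in m x) = scr_in m (- x).
Proof.
by apply: scr_in_eq; rewrite !mulrN -scr_in_repr.
Qed.

Fact scr_addA : associative scr_add.
Proof.
elim/scr_in_ind=> k x; elim/scr_in_ind=> l y; elim/scr_in_ind=> m z.
by rewrite !scr_in_add; apply: scr_in_eq; rewrite /= !diagM; ring.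
Qed.
Fact scr_addC : commutative scr_add.
Proof.
elim/scr_in_ind=> k x; elim/scr_in_ind=> l y.
by rewrite !scr_in_add; apply: scr_in_eq; rewrite /= !diagM; ring.
Qed.
Fact scr_add0 : left_id (scr_in (nz1 R) 0) scr_add.
Proof.
elim/scr_in_ind=> k x.
by rewrite scr_in_add; apply: scr_in_eq; rewrite /= !diagM diag1; ring.
Qed.
Fact scr_addN : left_inverse (scr_in (nz1 R) 0) scr_opp scr_add.
Proof.
elim/scr_in_ind=> k x.
by rewrite scr_in_opp scr_in_add; apply: scr_in_eq; rewrite /= !diagM diag1; ring.
Qed.
HB.instance Definition _ := GRing.isZmodule.Build scrR
  scr_addA scr_addC scr_add0 scr_addN.
Fact scr_mulA : associative scr_mul.
Proof.
elim/scr_in_ind=> k x; elim/scr_in_ind=> l y; elim/scr_in_ind=> m z.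
by rewrite !scr_in_mul; apply: scr_in_eq; rewrite /= !diagM; ring.
Qed.
Fact scr_mulC : commutative scr_mul.
Proof.
elim/scr_in_ind=> k x; elim/scr_in_ind=> l y.
by rewrite !scr_in_mul; apply: scr_in_eq; rewrite /= !diagM; ring.
Qed.
Fact scr_mul1 : left_id (scr_in (nz1 R) 1) scr_mul.
Proof.
elim/scr_in_ind=> k x.
by rewrite scr_in_mul; apply: scr_in_eq; rewrite /= !diagM diag1; ring.
Qed.
Fact scr_mulDl : left_distributive scr_mul scr_add.
Proof.
elim/scr_in_ind=> k x; elim/scr_in_ind=> l y; elim/scr_in_ind=> m z.
by rewrite !(scr_in_mul, scr_in_add); apply: scr_in_eq; rewrite /= !diagM; ring.
Qed.
HB.instance Definition _ := GRing.Zmodule_isComPzRing.Build scrR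
  scr_mulA scr_mulC scr_mul1 scr_mulDl.

Lemma scr_inD m l x y : scr_in m x + scr_in l y = scr_in (nzM l m) (diag l * x + diag m * y).
Proof. exact: scr_in_add. Qed.
Lemma scr_inM m l x y : scr_in m x * scr_in l y = scr_in (nzM l m) (x * y).
Proof. exact: scr_in_mul. Qed.

Lemma scr_in_continuous m : continuous (scr_in m).
Proof.
have c1 : continuous (existT (fun=> Rh) m : Rh -> coprodR).
  exact: existT_continuous.
have c2 : continuous (\pi_{eq_quot scr_equiv} : coprodR -> scrR).
  exact: pi_continuous.
by move=> x; exact: (continuous_comp (c1 x) (c2 _)).
Qed.

Lemma scr_continuous (T : topologicalType) (F : scrR -> T) :
  (forall m, continuous (F \o scr_in m)) -> continuous F.
Proof.
move=> HF; apply/quotient_continuous.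
rewrite (_ : _ \o _ = unstable.sigT_fun (fun m => F \o scr_in m)).
  exact: sigT_continuous.
by apply/funext => -[m x].
Qed.

Lemma scr_add_continuous (z : scrR) : continuous (fun w : scrR => w + z).
Proof.
elim/scr_in_ind: z => l y; apply: scr_continuous => m.
rewrite (_ : _ \o _ = scr_in (nzM l m) \o (fun u => diag m * y + u) \o (fun x => diag l * x)).
  move=> x; apply: continuous_comp; first exact: Rhat_mul_continuous.
  apply: continuous_comp; first exact: Rhat_add_continuous.
  exact: scr_in_continuous.
by apply/funext => x /=; rewrite scr_inD addrC.
Qed.

Lemma scr_mul_continuous (z : scrR) : continuous (fun w : scrR => z * w).
Proof.
elim/scr_in_ind: z => l y; apply: scr_continuous => m.
rewrite (_ : _ \o _ = scr_in (nzM m l) \o (fun x => y * x)).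
  move=> x; apply: continuous_comp; first exact: Rhat_mul_continuous.
  exact: scr_in_continuous.
by apply/funext => x /=; rewrite scr_inM.
Qed.

Definition fden (q : {fraction R}) : Rx :=
  MkNonzero (denom_ratioP (repr (q : FracField.type R))).
Definition fnum (q : {fraction R}) : R := \n_(repr (q : FracField.type R)).

(* [fnum q] and [fden q] come from a chosen representative of the fraction [q];
   the result does not depend on the choice, by [scr_embedE]. *)
Definition scr_embed (q : {fraction R}) : scrR := scr_in (fden q) (diag (fnum q)).

Local Notation "x %:F" := (@FracField.tofrac _ x).

Lemma fnum_den (q : {fraction R}) : q * (fden q : R)%:F = (fnum q)%:F.
Proof.
have E : q = \pi_(FracField.type R) (repr (q : FracField.type R)) by rewrite reprK.
rewrite {1}E /fnum /fden /=; unlock FracField.tofrac.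
rewrite -[LHS]FracField.pi_mul; apply/eqmodP; rewrite /= FracField.equivfE.
rewrite /FracField.mulf !numden_Ratio ?mulf_neq0 ?oner_neq0 ?denom_ratioP//.
by rewrite !mulr1 mulrC.
Qed.

Lemma scr_embedE (q : {fraction R}) (r : R) m :
  q * (m : R)%:F = r%:F -> scr_embed q = scr_in m (diag r).
Proof.
move=> qm; apply: scr_in_eq; rewrite -!diagM; congr diag.
apply/eqP; rewrite -tofrac_eq !tofracM -fnum_den -qm.
by apply/eqP; ring.
Qed.

Lemma scr_embedD (p q : {fraction R}) :
  scr_embed (p + q) = scr_embed p + scr_embed q.
Proof.
rewrite /scr_embed scr_inD -!diagM -diagD; apply: scr_embedE.
rewrite /= tofracD !tofracM -!fnum_den; ring.
Qed.

Lemma scr_embedM (p q : {fraction R}) :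
  scr_embed (p * q) = scr_embed p * scr_embed q.
Proof.
rewrite /scr_embed scr_inM -!diagM; apply: scr_embedE.
rewrite /= !tofracM -!fnum_den; ring.
Qed.

Lemma scr_embed0 : scr_embed 0 = 0.
Proof. by apply: (@scr_embedE _ _ (nz1 R)); rewrite mul0r tofrac0. Qed.

Lemma scr_embed1 : scr_embed 1 = 1.
Proof. by apply: (@scr_embedE _ _ (nz1 R)); rewrite mul1r. Qed.

End FiniteAdeles.

Section AffineGroup.
Variable F : fieldType.

Definition affine_pred : pred 'M[F]_2 :=
  fun M => [&& M 0 0 != 0, M 1 0 == 0 & M 1 1 == 1].

(* The matrices (a, b; 0, 1) with a != 0, under matrix multiplication. *)
Record affine_group := MkAffine {
  affine_mx :> 'M[F]_2; _ : affine_pred affine_mx }.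
HB.instance Definition _ := [isSub for affine_mx].
HB.instance Definition _ := [Choice of affine_group by <:].
Implicit Types g h : affine_group.

Lemma affineP g : [/\ g 0 0 != 0, g 1 0 = 0 & g 1 1 = 1].
Proof. by case: g => M /= /and3P[? /eqP ? /eqP ?]. Qed.

Lemma mx2_mulE (M N : 'M[F]_2) i j :
  (M *m N) i j = M i 0 * N 0 j + M i 1 * N 1 j.
Proof.
rewrite mxE !big_ord_recl big_ord0 addr0.
by rewrite (_ : lift ord0 ord0 = 1)//; apply: val_inj.
Qed.

Fact affine_one_subproof : affine_pred 1%:M.
Proof. by rewrite /affine_pred !mxE /= oner_neq0 !eqxx. Qed.

Fact affine_mul_subproof g h : affine_pred (g *m h).
Proof.
have [g00 g10 g11] := affineP g; have [h00 h10 h11] := affineP h.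
rewrite /affine_pred !mx2_mulE g10 g11 h10 h11 !(mulr0, mul0r, addr0, add0r).
by rewrite mulf_neq0 // eqxx mulr1 eqxx.
Qed.

Lemma affine_unit g : (g : 'M[F]_2) \in unitmx.
Proof.
have [g00 g10 g11] := affineP g.
have trig : is_trig_mx (g^T : 'M[F]_2).
  apply/is_trig_mxP => -[[|[|//]] i] [[|[|//]] j]//= _; rewrite mxE -g10.
  by congr (affine_mx g _ _); apply: val_inj.
rewrite unitmxE -det_tr (det_trig trig) unitfE.
rewrite !big_ord_recl big_ord0 !mxE (_ : lift ord0 ord0 = 1); last exact: val_inj.
by rewrite g11 !mulr1.
Qed.

Fact affine_inv_subproof g : affine_pred (invmx g).
Proof.
have [g00 g10 g11] := affineP g.
have gV := mulmxV (affine_unit g).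
move: (invmx g) gV => N gV.
have E i j : (g *m N) i j = (i == j)%:R by rewrite gV mxE.
have := E 1 0; have := E 1 1; have := E 0 0.
rewrite !mx2_mulE g10 g11 !mul0r !add0r !mul1r /= => N00 N11 N10.
rewrite N10 mulr0 addr0 in N00; rewrite /affine_pred N10 N11 !eqxx !andbT.
by apply: contra_eq_neq N00 => ->; rewrite mulr0 eq_sym oner_neq0.
Qed.

Definition affine_one : affine_group := MkAffine affine_one_subproof.
Definition affine_mul g h : affine_group := MkAffine (affine_mul_subproof g h).
Definition affine_inv g : affine_group := MkAffine (affine_inv_subproof g).

Fact affine_mulA : associative affine_mul.
Proof. by move=> g h k; apply: val_inj => /=; rewrite mulmxA. Qed.
Fact affine_mul1 : left_id affine_one affine_mul.
Proof. by move=> g; apply: val_inj => /=; rewrite mul1mx. Qed.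
Fact affine_1mul : right_id affine_one affine_mul.
Proof. by move=> g; apply: val_inj => /=; rewrite mulmx1. Qed.
Fact affine_mulV : left_inverse affine_one affine_inv affine_mul.
Proof.
by move=> g; apply: val_inj; rewrite /= mulVmx ?affine_unit.
Qed.
Fact affine_Vmul : right_inverse affine_one affine_inv affine_mul.
Proof.
by move=> g; apply: val_inj; rewrite /= mulmxV ?affine_unit.
Qed.
HB.instance Definition _ := isGroup.Build affine_group
  affine_mulA affine_mul1 affine_1mul affine_mulV affine_Vmul.

End AffineGroup.

Record top_action (G : groupType) (X : topologicalType) := TopAction {
  tact :> G -> X -> X;
  tact_continuous : forall g, continuous (tact g);
  tact1 : forall x, tact 1%g x = x;
  tactM : forall g h x, tact (g * h)%g x = tact g (tact h x)
}.

Section ActionC0.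
Variables (K : realType) (G : groupType) (X : topologicalType).
Variable to : top_action G X.

Fact C0_translate_subproof (g : G) (f : C0 K X) :
  (fun x => f (to g^-1%g x)) \in @C0_pred K X.
Proof.
apply/C0P; split.
  move=> x; apply: continuous_comp; first exact: tact_continuous.
  exact: C0_continuous.
move=> e e0; have [Q Qc Qf] := C0_vanishes f e0.
exists (to g @` Q) => [|x Qx].
  by apply: continuous_compact => //; apply: continuous_subspaceT; exact: tact_continuous.
apply: Qf => Qgx; apply: Qx; exists (to g^-1%g x) => //.
by rewrite -tactM mulgV tact1.
Qed.

Definition C0_translate (g : G) (f : C0 K X) : C0 K X :=
  MkC0 (C0_translate_subproof g f).

Fact C0_translate_hom g : star_hom (C0_translate g).
Proof. by split=> [f h|c f|f h|f]; exact: C0_ext. Qed.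
Fact C0_translate1 f : C0_translate 1%g f = f.
Proof. by apply: C0_ext => x; rewrite /= invg1 tact1. Qed.
Fact C0_translateM g h f :
  C0_translate (g * h)%g f = C0_translate g (C0_translate h f).
Proof. by apply: C0_ext => x; rewrite /= invgM tactM. Qed.

Definition C0_action : cstar_action G (C0 K X) :=
  CStarAction C0_translate_hom C0_translate1 C0_translateM.

End ActionC0.

Section AffineAction.
Variable R : idomainType.

Definition affine_act (g : affine_group {fraction R}) (x : scrR R) : scrR R :=
  scr_embed (g 0 0) * x + scr_embed (g 0 1).

Fact affine_act_continuous g : continuous (affine_act g).
Proof.
move=> x; apply: (@continuous_comp _ _ _ (fun x => scr_embed (g 0 0) * x)
  (fun y => y + scr_embed (g 0 1))).
  exact: scr_mul_continuous.
exact: scr_add_continuous.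
Qed.
Fact affine_act1 x : affine_act 1%g x = x.
Proof. by rewrite /affine_act !mxE /= scr_embed1 scr_embed0 mul1r addr0. Qed.
Fact affine_actM g h x :
  affine_act (g * h)%g x = affine_act g (affine_act h x).
Proof.
have [h00 h10 h11] := affineP h.
rewrite /affine_act !mx2_mulE h10 h11 mulr0 addr0 mulr1.
by rewrite scr_embedD !scr_embedM; ring.
Qed.

Definition affine_action : top_action (affine_group {fraction R}) (scrR R) :=
  TopAction affine_act_continuous affine_act1 affine_actM.

End AffineAction.

Section RingAlgebra.
Variables (C : numClosedFieldType) (R : idomainType).

Definition range_proj (A : cstarAlgType C) (s : nonzero R -> A) m : A :=
  s m ** (s m)^^*.

(* In [rr_sum] the class [c] is represented by [rep c]; by [rr_u] and [rr_su] the
   summand does not depend on this choice, and the sum is the actual one whenever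
   R/(m) is finite. *)
Record ring_relations (A : cstarAlgType C) (one : A) (s : nonzero R -> A)
    (u : R -> A) : Prop := RingRelations {
  rr_unit : is_unit_elt one;
  rr_isometry : forall m, (s m)^^* ** s m = one;
  rr_unitaryl : forall n, (u n)^^* ** u n = one;
  rr_unitaryr : forall n, u n ** (u n)^^* = one;
  rr_s : forall k m, s k ** s m = s (nzM k m);
  rr_u : forall l n, u l ** u n = u (l + n);
  rr_su : forall m n, s m ** u n = u ((m : R) * n) ** s m;
  rr_sum : forall m : nonzero R,
    \sum_(c \in [set: Rmod (m : R)])
      u (rep c) ** range_proj s m ** (u (rep c))^^* = one
}.

(* Universality is among unital C*-algebras and unital *-homomorphisms; that the
   generators generate [A] is the uniqueness part. *)
Definition is_ring_algebra (A : cstarAlgType C) (one : A)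
    (s : nonzero R -> A) (u : R -> A) : Prop :=
  ring_relations one s u /\
  forall (B : cstarAlgType C) (oneB : B) (sB : nonzero R -> B) (uB : R -> B),
    ring_relations oneB sB uB ->
    exists! f : A -> B,
      [/\ star_hom f, f one = oneB, (forall m, f (s m) = sB m)
        & forall n, f (u n) = uB n].

Definition divides_arrow (m n : nonzero R) := {l : nonzero R | n = nzM l m}.

(* phi_(m, lm) : x |-> s_l x s_l^*, both algebras being [A]. *)
Definition stab_map (A : cstarAlgType C) (s : nonzero R -> A)
    (m n : nonzero R) (h : divides_arrow m n) (x : A) : A :=
  s (sval h) ** x ** (s (sval h))^^*.

Definition is_stabilization (A : cstarAlgType C) (s : nonzero R -> A)
    (L : cstarAlgType C) (psi : nonzero R -> A -> L) : Prop :=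
  is_cstar_inductive_limit (stab_map s) psi.

End RingAlgebra.

(* Main.v *)
Require Import Defs.
From HB Require Import structures.
From mathcomp Require Import all_boot all_order all_algebra.
From mathcomp Require Import fraction.
From mathcomp Require Import all_classical all_reals all_analysis.
From mathcomp Require Import complex ring lra.

(** Formally, the ring algebra [A] acts on functions on [Rhat]: [s_m] is induced by
    the multiplication by [m] and [u^n] by the translation by [n]. Its stabilization
    [L] is obtained by allowing supports in [Rhat / k] for all nonzero [k], that
    is, in the whole locally compact ring. There these maps become invertible,
    and [L] is densely spanned by the products [f U_g] of a function and the
    unitary of an affine map, which is the description of the crossed product.
    As all the algebras are given by universal properties only, the isomorphism is
    a pair of homomorphisms whose composites are identities by uniqueness.

    From [L] to the crossed product: the indicator function of [Rhat / k] is a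
    projection [p_k], and [U_g p_k] is an element of the crossed product even
    though [U_g] need not be. For each [k] the elements [U_g p_k], with [g] the
    multiplication by [l] or the translation by [b / k], satisfy the relations of
    the ring algebra with [p_k] as the unit ([copy_hom_relations]). This gives a
    compatible family of homomorphisms [copy_hom k].

    From the crossed product to [L]: the projections of the cosets of [(m)] in [A]
    add up to [1], hence are mutually orthogonal ([projections_orthogonal]). So
    each level of the system represents the locally constant functions, and the
    limit over all levels, ordered by divisibility, is a homomorphism [C0_rep] of
    the algebra of functions. It is defined on all functions since step functions
    are dense ([step_dense]) and homomorphisms are contractive ([star_hom_le]).
    The algebra [L] need not have a unit, and [U_g] is realized as an operator [umult g] on
    [L], the pointwise limit of left multiplications by explicit words; it has the
    adjoint [umult g^-1] ([umult_adj]) and satisfies the covariance relation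
    ([covariance]), so that [f U_g] is an element of [L] ([cov_elt]).

    The composites are the identity because both homomorphisms exchange [U_g p_k]
    on the two sides ([cov_elt_ind], [copy_hom_word]), and the elements of this
    form generate: the images of [A] are dense in [L] ([psi_dense]), and each
    product of an indicator function and [U_g] is a product of two elements in the
    copies of [A] ([cross_ind_factor]). *)

Set Implicit Arguments.
Unset Strict Implicit.
Unset Printing Implicit Defensive.
Import Order.TTheory GRing.Theory Num.Theory.
Import numFieldNormedType.Exports.
Local Open Scope classical_set_scope.
Local Open Scope ring_scope.

(** * Real-valued norms, limits and Lipschitz maps *)

Section RealNorm.
Variable K : realType.
Local Notation C := (K[i]).

Section Norm.
Variable V : normedModType C.
Implicit Types x y z : V.

(** Norms over [K[i]] are complex numbers; estimates are made with the real
    number [nm x]. *)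
Definition nm x : K := complex.Re `|x|.

Lemma nmE x : `|x| = (nm x)%:C%C.
Proof. by rewrite /nm RRe_real// normr_real. Qed.

Lemma nm_ge0 x : 0 <= nm x.
Proof. by rewrite -lecR -nmE normr_ge0. Qed.

Lemma nm0 : nm 0 = 0.
Proof. by rewrite /nm normr0. Qed.

Lemma nm_le0 x : nm x <= 0 -> x = 0.
Proof.
move=> x0; apply/eqP; rewrite -normr_eq0 nmE.
by rewrite (_ : nm x = 0)//; apply/eqP; rewrite eq_le x0 nm_ge0.
Qed.

Lemma nm_small x : (forall e : K, 0 < e -> nm x <= e) -> x = 0.
Proof. by move=> H; apply/nm_le0/ler_addgt0Pl => e e0; rewrite addr0 H. Qed.

Lemma nmN x : nm (- x) = nm x.
Proof. by rewrite /nm normrN. Qed.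

Lemma nmC x y : nm (x - y) = nm (y - x).
Proof. by rewrite -nmN opprB. Qed.

Lemma nmD x y : nm (x + y) <= nm x + nm y.
Proof. by rewrite -lecR rmorphD/= -!nmE ler_normD. Qed.

Lemma nmB x y : nm (x - y) <= nm x + nm y.
Proof. by rewrite -(nmN y) nmD. Qed.

Lemma nm_tri z x y : nm (x - y) <= nm (x - z) + nm (z - y).
Proof. by rewrite (le_trans _ (nmD _ _))// addrA subrK. Qed.

Lemma nm_sum (I : Type) (r : seq I) (F : I -> V) :
  nm (\sum_(i <- r) F i) <= \sum_(i <- r) nm (F i).
Proof.
elim: r => [|i r IH]; first by rewrite !big_nil nm0.
by rewrite !big_cons (le_trans (nmD _ _))// lerD2l.
Qed.

End Norm.

Definition nmc (c : C) : K := complex.Re `|c|.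

Lemma nmcE (c : C) : `|c| = (nmc c)%:C%C.
Proof. by rewrite /nmc RRe_real// normr_real. Qed.

Lemma nmc_ge0 (c : C) : 0 <= nmc c.
Proof. by rewrite -lecR -nmcE normr_ge0. Qed.

Lemma nmZ (V : normedModType C) (c : C) (x : V) : nm (c *: x) = nmc c * nm x.
Proof.
apply: (@complexI K); rewrite rmorphM/= -!nmE -nmcE; exact: normrZ.
Qed.

Lemma nmcR (r : K) : 0 <= r -> nmc (r%:C%C) = r.
Proof. by move=> r0; rewrite /nmc ger0_norm// lecR. Qed.

Section Tends.
Variables (I : Type) (F : set_system I) (FF : ProperFilter F).
Variable V : normedModType C.
Implicit Types (u v : I -> V) (x y : V).

(** Convergence with real radii; the neighbourhoods of a normed module over
    [K[i]] are indexed by complex ones. *)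
Definition tends u x := forall e : K, 0 < e -> F [set i | nm (u i - x) < e].

Lemma tends_near u x : F [set i | u i = x] -> tends u x.
Proof. by move=> ux e e0; apply: filterS ux => i /= ->; rewrite subrr nm0. Qed.

Lemma tends_cst x : tends (fun=> x) x.
Proof. by apply: tends_near; apply: filterE. Qed.

Lemma tends_uniq u x y : tends u x -> tends u y -> x = y.
Proof.
move=> ux uy; apply/eqP; rewrite -subr_eq0; apply/eqP/nm_small => e e0.
have e2 : 0 < e / 2 by rewrite divr_gt0.
have [i [/= Hx Hy]] := filter_ex (filterI (ux _ e2) (uy _ e2)).
have := nm_tri (u i) x y; rewrite (nmC x (u i)); lra.
Qed.

Lemma tendsD u v x y : tends u x -> tends v y ->
  tends (fun i => u i + v i) (x + y).
Proof.
move=> ux vy e e0; have e2 : 0 < e / 2 by rewrite divr_gt0.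
apply: filterS (filterI (ux _ e2) (vy _ e2)) => i [/= Hx Hy].
rewrite opprD addrACA; have := nmD (u i - x) (v i - y); lra.
Qed.

Lemma tends_le u x M : tends u x -> F [set i | nm (u i) <= M] -> nm x <= M.
Proof.
move=> ux uM; apply/ler_addgt0Pr => e e0.
have [i [/= Hx Hy]] := filter_ex (filterI (ux _ e0) uM).
have := nm_tri (u i) x 0; rewrite !subr0 (nmC x (u i)); lra.
Qed.

End Tends.

(** The condition says that the image filter is Cauchy. *)
Lemma nm_complete (V : completeNormedModType C) (I : Type) (F : set_system I)
    (FF : ProperFilter F) (u : I -> V) :
  (forall e : K, 0 < e -> exists x, F [set i | nm (u i - x) < e]) ->
  exists x, tends F u x.
Proof.
move=> H.
have ReC (e : C) : 0 < e -> exists2 r : K, 0 < r & r%:C%C = e.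
  move=> e0; exists (complex.Re e); first by move: e0; rewrite ltcE => /andP[].
  by apply: RRe_real; rewrite gtr0_real.
have /cvg_ex[x ux] : cvg (u @ F).
  apply: cauchy_cvg; apply/cauchy_exP => e /ReC[r r0 <-].
  have [x Fx] := H r r0; exists x; rewrite /fmap/=; apply: filterS Fx => i /=.
  by rewrite -ball_normE/= distrC nmE ltcR.
exists x => e e0; have eC : 0 < e%:C%C by rewrite ltcR.
move/cvgrPdist_lt: ux => /(_ _ eC); apply: filterS => i /=.
by rewrite nmE nmC ltcR.
Qed.

Section Lip.
Variables V W : normedModType C.

Definition lip (f : V -> W) := exists M : K,
  forall x y, nm (f x - f y) <= M * nm (x - y).

Lemma lip_tends (f : V -> W) (I : Type) (F : set_system I)
    (FF : ProperFilter F) (u : I -> V) x :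
  lip f -> tends F u x -> tends F (fun i => f (u i)) (f x).
Proof.
move=> [M fM] ux e e0; have N0 : 0 < `|M| + 1 by rewrite ltr_wpDl.
have := ux (e / (`|M| + 1)) (divr_gt0 e0 N0).
apply: filterS => i /=; rewrite ltr_pdivlMr// => H.
apply: le_lt_trans (fM _ _) (le_lt_trans _ H); rewrite mulrC ler_wpM2l ?nm_ge0//.
by rewrite (le_trans (ler_norm M))// lerDl.
Qed.

Definition dense_in (S : set V) := forall x (e : K), 0 < e ->
  exists2 y, S y & nm (x - y) < e.

Lemma lip_eq_at (f g : V -> W) x : lip f -> lip g ->
  (forall e : K, 0 < e -> exists2 y, f y = g y & nm (x - y) < e) -> f x = g x.
Proof.
move=> [M fM] [N gN] fg; apply/eqP; rewrite -subr_eq0; apply/eqP/nm_small.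
move=> e e0; have B0 : 0 < `|M| + `|N| + 1 by rewrite ltr_wpDl// addr_ge0.
have [y fgy xy] := fg (e / (`|M| + `|N| + 1)) (divr_gt0 e0 B0).
have := nm_tri (f y) (f x) (g x); rewrite {2}fgy => H.
apply: (le_trans H); apply: (le_trans (lerD (fM _ _) (gN _ _))).
rewrite (nmC y); move: xy; rewrite ltr_pdivlMr// => xy.
apply: le_trans (ltW xy); rewrite -mulrDl mulrC ler_wpM2l ?nm_ge0//.
have := ler_norm M; have := ler_norm N; lra.
Qed.

Lemma lip_eq (S : set V) (f g : V -> W) : lip f -> lip g -> dense_in S ->
  (forall x, S x -> f x = g x) -> forall x, f x = g x.
Proof.
move=> fl gl dS fg x; apply: lip_eq_at => // e e0.
by have [y Sy xy] := dS x e e0; exists y => //; exact: fg.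
Qed.

Lemma lipD (f g : V -> W) : lip f -> lip g -> lip (fun x => f x + g x).
Proof.
move=> [M fM] [N gN]; exists (M + N) => x y; rewrite opprD addrACA mulrDl.
by rewrite (le_trans (nmD _ _))// lerD.
Qed.

Lemma lip_cst y : lip (fun _ : V => y : W).
Proof. by exists 0 => *; rewrite subrr nm0 mul0r. Qed.

Lemma lipZ (c : C) (f : V -> W) : lip f -> lip (fun x => c *: f x).
Proof.
move=> [M fM]; exists (nmc c * M) => x y; rewrite -scalerBr nmZ -mulrA.
by rewrite ler_wpM2l// nmc_ge0.
Qed.

End Lip.

Lemma lip_id (V : normedModType C) : lip (fun x : V => x).
Proof. by exists 1 => x y; rewrite mul1r. Qed.

Lemma lip_comp (U V W : normedModType C) (f : V -> W) (g : U -> V) :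
  lip f -> lip g -> lip (fun x => f (g x)).
Proof.
move=> [M fM] [N gN]; exists (`|M| * N) => x y.
apply: (le_trans (fM _ _)); rewrite -mulrA.
apply: (@le_trans _ _ (`|M| * nm (g x - g y))).
  by rewrite ler_wpM2r ?nm_ge0// ler_norm.
by rewrite ler_wpM2l.
Qed.

(** Every element and operator obtained by approximation below is a limit of
    contractions that are eventually constant at each point of a dense set. *)
Lemma dense_tends (V : normedModType C) (W : completeNormedModType C)
    (I : Type) (F : set_system I) (FF : ProperFilter F)
    (T : I -> V -> W) (S : set V) :
  (forall i x y, nm (T i x - T i y) <= nm (x - y)) ->
  dense_in S ->
  (forall x, S x -> exists y, F [set i | T i x = y]) ->
  forall x, exists y, tends F (fun i => T i x) y.
Proof.
move=> contr dS TS x; apply: nm_complete => e e0.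
have [x0 Sx0 xx0] := dS x e e0.
have [y Fy] := TS x0 Sx0; exists y; apply: filterS Fy => i /= <-.
exact: le_lt_trans (contr _ _ _) _.
Qed.

End RealNorm.

(** * Consequences of the C*-identity *)

Section StarAlg.
Variables (C : numClosedFieldType) (A : starAlgType C).
Implicit Types x y z : A.

Lemma smulNr x y : x ** (- y) = - (x ** y).
Proof. by rewrite -scaleN1r smulZr scaleN1r. Qed.
Lemma smulNl x y : (- x) ** y = - (x ** y).
Proof. by rewrite -scaleN1r smulZl scaleN1r. Qed.
Lemma smulBr x y z : x ** (y - z) = x ** y - x ** z.
Proof. by rewrite smulDr smulNr. Qed.
Lemma smulBl x y z : (x - y) ** z = x ** z - y ** z.
Proof. by rewrite smulDl smulNl. Qed.
Lemma starN x : (- x)^^* = - x^^*.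
Proof. by rewrite -scaleN1r starZ rmorphN1 scaleN1r. Qed.
Lemma starB x y : (x - y)^^* = x^^* - y^^*.
Proof. by rewrite starD starN. Qed.

End StarAlg.

Section StarHomLemmas.
Variables (C : numClosedFieldType) (A B D : starAlgType C).

Lemma star_homB (f : A -> B) x y : star_hom f -> f (x - y) = f x - f y.
Proof. by case=> fD fZ _ _; rewrite fD -scaleN1r fZ scaleN1r. Qed.

Lemma star_hom_comp (f : B -> D) (g : A -> B) :
  star_hom f -> star_hom g -> star_hom (f \o g).
Proof.
move=> [fD fZ fM fS] [gD gZ gM gS].
by split=> [x y|c x|x y|x] /=; rewrite ?gD ?gZ ?gM ?gS.
Qed.

End StarHomLemmas.

Section CStar.
Variables (K : realType) (A : cstarAlgType K[i]).
Implicit Types x y z : A.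

Lemma nmM x y : nm (x ** y) <= nm x * nm y.
Proof. by rewrite -lecR rmorphM/= -!nmE norm_smul. Qed.

Lemma nm_cstar x : nm (x^^* ** x) = nm x ^+ 2.
Proof. by apply: (@complexI K); rewrite rmorphXn/= -!nmE norm_cstar. Qed.

Lemma nm_star x : nm x^^* = nm x.
Proof.
have H z : nm z <= nm z^^*.
  have [->|z0] := eqVneq (nm z) 0; first exact: nm_ge0.
  have zp : 0 < nm z by rewrite lt_def z0 nm_ge0.
  by rewrite -(ler_pM2r zp) -expr2 -nm_cstar nmM.
by apply/eqP; rewrite eq_le H andbT -{2}(starK x) H.
Qed.

(** If [x z = 0] for [z = x^*], then [x = 0] by the C*-identity. *)
Lemma smul_faithful x y : (forall z, x ** z = y ** z) -> x = y.
Proof.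
move=> xy; apply/eqP; rewrite -subr_eq0; apply/eqP/nm_le0; rewrite -nm_star.
rewrite -(@ler_pXn2r _ 2) ?nnegrE ?nm_ge0// expr0n -nm_cstar starK.
by rewrite smulBl xy subrr nm0.
Qed.

Lemma star_faithful x y : (forall z, z ** x = z ** y) -> x = y.
Proof.
move=> xy; apply: (can_inj starK); apply: smul_faithful => z.
by rewrite -[z]starK -!starM xy.
Qed.

Lemma lip_smull x : lip (fun y => x ** y).
Proof. by exists (nm x) => y z; rewrite -smulBr nmM. Qed.
Lemma lip_smulr x : lip (fun y => y ** x).
Proof. by exists (nm x) => y z; rewrite -smulBl mulrC nmM. Qed.
Lemma lip_star : lip (@star _ A).
Proof. by exists 1 => x y; rewrite -starB nm_star mul1r. Qed.

Section TendsM.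
Variables (I : Type) (F : set_system I) (FF : ProperFilter F).
Variables (u v : I -> A) (x y : A).

Lemma tendsM : tends F u x -> tends F v y ->
  tends F (fun i => u i ** v i) (x ** y).
Proof.
move=> ux vy e e0.
pose B := nm x + nm y + 1.
have B0 : 0 < B by rewrite ltr_wpDl// addr_ge0 ?nm_ge0.
have d0 : 0 < Num.min (1 : K) (e / (2 * B)) by rewrite lt_min ltr01 divr_gt0// mulr_gt0.
apply: filterS (filterI (ux _ d0) (vy _ d0)) => i [/=].
rewrite !lt_min => /andP[u1 ud] /andP[v1 vd].
rewrite (_ : _ - _ = (u i - x) ** v i + x ** (v i - y)); last first.
  by rewrite smulBl smulBr addrA subrK.
apply: (le_lt_trans (nmD _ _)); apply: (le_lt_trans (lerD (nmM _ _) (nmM _ _))).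
move: ud vd; rewrite !ltr_pdivlMr ?mulr_gt0// => ud vd.
have vB : nm (v i) <= nm y + 1.
  by have := nm_tri y (v i) 0; rewrite !subr0; lra.
have h1 := nm_ge0 (u i - x); have h2 := nm_ge0 (v i - y).
have h3 := nm_ge0 x; have h4 := nm_ge0 y; have h5 := nm_ge0 (v i).
have B1 : nm (v i) <= B by rewrite /B; lra.
have B2 : nm x <= B by rewrite /B; lra.
have := ler_wpM2l h1 B1; have := ler_wpM2r h2 B2; nra.
Qed.

End TendsM.

Section QuasiSqrt.
Variable x : A.
Hypotheses (xsa : x^^* = x) (x1 : nm x < 1).

Let step (k : A) : A := (2^-1 : K)%:C%C *: (x + k ** k).
Let it n := iter n step 0.
(* Any [r < 1] with [nm x + r ^ 2 <= 2 r] would do. *)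
Let r : K := (1 + nm x) / 2.

Let r0 : 0 <= r. Proof. by have := nm_ge0 x; rewrite /r; lra. Qed.
Let r1 : r < 1. Proof. by move: x1; rewrite /r; lra. Qed.

Let half0 : 0 <= (2^-1 : K). Proof. by rewrite invr_ge0. Qed.

Let it_le n : nm (it n) <= r.
Proof.
elim: n => [|n IH]; first by rewrite nm0.
rewrite /it iterS -/(it n) /step nmZ nmcR//.
have H : nm (x + it n ** it n) <= nm x + r * r.
  rewrite (le_trans (nmD _ _))// lerD2l (le_trans (nmM _ _))// ler_pM ?nm_ge0//.
have := nm_ge0 x; move: H x1; rewrite /r; nra.
Qed.

Let step_lip k l : nm k <= r -> nm l <= r ->
  nm (step k - step l) <= r * nm (k - l).
Proof.
move=> kr lr; rewrite /step -scalerBr nmZ nmcR// opprD addrACA subrr add0r.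
rewrite (_ : _ - _ = k ** (k - l) + (k - l) ** l); last first.
  by rewrite smulBr smulBl addrA subrK.
have H : nm (k ** (k - l) + (k - l) ** l) <= r * nm (k - l) + nm (k - l) * r.
  rewrite (le_trans (nmD _ _))// lerD// (le_trans (nmM _ _))//.
    by rewrite ler_wpM2r ?nm_ge0.
  by rewrite ler_wpM2l ?nm_ge0.
lra.
Qed.

Let it_cauchy n p : nm (it (n + p) - it n) <= r ^+ n.
Proof.
elim: n => [|n IH].
  by rewrite add0n subr0 expr0 (le_trans (it_le _))// ltW.
rewrite addSn /it !iterS -!/(it _) exprS.
by rewrite (le_trans (step_lip _ _))// ler_wpM2l.
Qed.

(** A scalar [t] with [t < 1] has [1 - t = (1 - k)^2] for [k = 1 - sqrt (1 - t)];
    the same [k] is found in the algebra as the fixed point of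
    [k |-> (x + k^2) / 2], a contraction of the ball of radius [(1 + |x|) / 2].
    Writing the equation for [k] avoids the unit. *)
Lemma quasi_sqrt : exists k : A, [/\ k^^* = k, k + k - k ** k = x,
    forall y, x ** y = y ** x -> k ** y = y ** k
  & forall y, y ** x = x -> y ** k = k].
Proof.
have Fo : ProperFilter \oo by exact: eventually_filter.
have [|k itk] := @nm_complete K A _ \oo Fo it.
  move=> e e0.
  have : (fun n => r ^+ n) @ \oo --> 0 by apply: cvg_expr; rewrite ger0_norm.
  move/cvgrPdist_lt => /(_ _ e0) [n _ /(_ n)/= Hn].
  have {}Hn : r ^+ n < e.
    by have := Hn (leqnn n); rewrite sub0r normrN ger0_norm// exprn_ge0.
  exists (it n), n => // m /= nm_; rewrite -(subnKC nm_).
  exact: le_lt_trans (it_cauchy _ _) Hn.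
exists k.
have closed (f g : A -> A) : lip f -> lip g -> (forall n, f (it n) = g (it n)) ->
    f k = g k.
  move=> fl gl fg; apply: (tends_uniq Fo (lip_tends Fo fl itk)).
  by under eq_fun do rewrite fg; exact: (lip_tends Fo gl itk).
split.
- apply: (closed (@star _ A) id); [exact: lip_star|exact: lip_id|].
  elim=> [|n IH]; first by rewrite star0.
  rewrite /it iterS -/(it n) /step starZ starD starM IH xsa.
  by rewrite geC0_conj// lecR.
- have kk : tends \oo (fun n => it n.+1) (step k).
    rewrite /step => /=; apply: (@lip_tends K A A _ _ _ Fo (fun n => x + it n ** it n)).
      by apply: lipZ; exact: lip_id.
    by apply: tendsD; [exact: tends_cst|exact: tendsM].
  have kS : tends \oo (fun n => it n.+1) k.
    by move=> e /itk [n _ Hn]; exists n => // m mn; exact: (Hn m.+1 (leqW mn)).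
  have E : k = step k by apply: (tends_uniq Fo kS kk).
  have : k + k = x + k ** k.
    rewrite [in LHS]E /step -scalerDl -rmorphD/= (_ : 2^-1 + 2^-1 = 1 :> K); last by field.
    by rewrite scale1r.
  by move=> ->; rewrite addrK.
- move=> y xy; apply: (closed (fun k => k ** y) (fun k => y ** k)).
  + exact: lip_smulr.
  + exact: lip_smull.
  elim=> [|n IH]; first by rewrite smul0r smulr0.
  rewrite /it iterS -/(it n) /step smulZl smulZr smulDl smulDr xy.
  by rewrite -smulA IH smulA IH smulA.
- move=> y yx; apply: (closed (fun k => y ** k) id).
  + exact: lip_smull.
  + exact: lip_id.
  elim=> [|n IH]; first by rewrite smulr0.
  by rewrite /it iterS -/(it n) /step smulZr smulDr yx smulA IH.
Qed.

End QuasiSqrt.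
End CStar.

(** * Contractivity of *-homomorphisms and orthogonality of projections *)

Section Contractive.
Variable K : realType.
Local Notation C := (K[i]).

Lemma mulCii : 'i * 'i = -1 :> C.
Proof. by rewrite -expr2 sqrCi. Qed.

Section OneAlgebra.
Variable A : cstarAlgType C.
Implicit Types x y a q : A.

(** The condition that [1 + q] is an isometry, written without the unit. *)
Definition quasi_isometry q := q^^* + q + q^^* ** q = 0.

(** The two sides have the same square, by expansion of
    [(y + q y)^* (y + q y)]. *)
Lemma quasi_isometryP q y : quasi_isometry q -> nm (y + q ** y) = nm y.
Proof.
move=> qq; apply/eqP; rewrite -(@eqrXn2 _ 2) ?nm_ge0// -!nm_cstar.
rewrite starD starM smulDl !smulDr !smulA -addrA [X in y^^* ** y + X](_ : _ = 0) ?addr0//.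
rewrite -(smul0r y) -(smulr0 y^^*) -qq !smulDr !smulDl !smulA addrA.
by congr (_ + _); rewrite addrC.
Qed.

(** For a self-adjoint [a] of norm below [1], [a + i sqrt (1 - a^2)] is a unitary
    with real part [a]; [q] is this unitary, divided by [i], minus the unit. *)
Lemma selfadjoint_quasi_unitary a : a^^* = a -> nm a < 1 ->
  exists q, [/\ quasi_isometry q, quasi_isometry q^^*
    & a = ('i / 2) *: (q - q^^*)].
Proof.
move=> asa a1.
have [||k [ksa kE kcomm _]] := @quasi_sqrt K A (a ** a).
- by rewrite starM asa.
- by rewrite -{1}asa nm_cstar expr_lt1// nm_ge0.
have ka : k ** a = a ** k by apply: kcomm; rewrite smulA.
pose q := - 'i *: a - k.
have qS : q^^* = 'i *: a - k.
  by rewrite /q starB starZ asa ksa rmorphN/= conjCi opprK.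
have sum : q^^* + q = - (k + k).
  by rewrite qS /q scaleNr addrACA subrr add0r opprD.
have E (c : C) : c * c = -1 ->
    (c *: a - k) ** (- c *: a - k) = a ** a + k ** k.
  move=> cc; rewrite smulBr !smulBl !smulZr !smulZl !scalerA ka mulNr cc opprK scale1r.
  by rewrite scaleNr opprK opprB addrCA addrK addrC.
have kk : a ** a + k ** k = k + k by rewrite -kE subrK.
exists q; split.
- by rewrite /quasi_isometry sum qS E ?mulCii// kk addNr.
- rewrite /quasi_isometry starK addrC (addrC q) sum qS /q.
  have := E (- 'i); rewrite mulrNN mulCii opprK => -> //.
  by rewrite kk subrr.
- rewrite qS /q opprB addrA subrK scaleNr -opprD -scalerDl scalerN scalerA -scaleNr.
  rewrite [X in X *: _](_ : _ = - ('i * 'i)); last by field.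
  by rewrite mulCii opprK scale1r.
Qed.

End OneAlgebra.

Variables A B : cstarAlgType C.

(** A *-homomorphism maps quasi-unitaries to quasi-unitaries, which act on [B] by
    isometries [y |-> y + q y]; a self-adjoint element of norm below [1] is half
    a difference of two of them up to a scalar of modulus [1]. *)
Lemma star_hom_le (f : A -> B) x : star_hom f -> nm (f x) <= nm x.
Proof.
move=> fh; have [fD fZ fM fS] := fh.
have sa1 (a : A) : a^^* = a -> nm a < 1 -> nm (f a) <= 1.
  move=> asa a1; have [q [q1 q2 aE]] := selfadjoint_quasi_unitary asa a1.
  have fq1 : quasi_isometry (f q).
    by rewrite /quasi_isometry -fS -fM -!fD q1 star_hom0.
  have fq2 : quasi_isometry (f q^^*).
    by rewrite /quasi_isometry -fS -fM -!fD q2 star_hom0.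
  have mul1 (y : B) : nm (f a ** y) <= nm y.
    rewrite {1}aE fZ star_homB// smulZl nmZ smulBl.
    have -> : nmc ('i / 2 : C) = 2^-1.
      apply: (@complexI K); rewrite -nmcE normrM normCi mul1r normfV normr_nat.
      by rewrite fmorphV/= rmorph_nat.
    have -> : f q ** y - f q^^* ** y = (y + f q ** y) - (y + f q^^* ** y).
      by rewrite opprD addrACA subrr add0r.
    have := nmB (y + f q ** y) (y + f q^^* ** y).
    by rewrite !quasi_isometryP//; lra.
  have := mul1 (f a); rewrite -{1}asa fS nm_cstar.
  by have := nm_ge0 (f a); nra.
have sa (a : A) : a^^* = a -> nm (f a) <= nm a.
  (* Rescale so that the norm is below [1]. *)
  move=> asa; apply/ler_addgt0Pr => e e0.
  have t0 : 0 < nm a + e by rewrite ltr_wpDl// nm_ge0.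
  pose b : A := ((nm a + e)^-1)%:C%C *: a.
  have ti : 0 <= (nm a + e)^-1 by rewrite invr_ge0 ltW.
  have : nm (f b) <= 1.
    apply: sa1; first by rewrite starZ asa geC0_conj// lecR.
    by rewrite nmZ nmcR// mulrC ltr_pdivrMr// mul1r ltrDl.
  by rewrite fZ nmZ nmcR// mulrC ler_pdivrMr// mul1r.
rewrite -(@ler_pXn2r _ 2) ?nnegrE ?nm_ge0// -!nm_cstar -fS -fM.
by apply: sa; rewrite starM starK.
Qed.

Lemma lip_star_hom (f : A -> B) : star_hom f -> lip f.
Proof. by move=> fh; exists 1 => x y; rewrite mul1r -star_homB// star_hom_le. Qed.

End Contractive.

Section Orthogonality.
Variables (K : realType) (A : cstarAlgType K[i]).
Implicit Types e h p x y : A.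

Definition projection p := p ** p = p /\ p^^* = p.

(** The number [t = nm p] satisfies [t = t ^ 2]. *)
Lemma projection_le1 p : projection p -> nm p <= 1.
Proof.
move=> [pp ps]; have := nm_cstar p; rewrite ps pp.
by rewrite leNgt => E; apply/negP => p1; move: E; nra.
Qed.

(** The elements [d e + (1 - d) k] and [d e - (1 - d) k] are the squares of commuting
    self-adjoint elements [a] and [b] with [a^2 + b^2 = 2 d e]. So [a + i b] has norm
    at most [sqrt (2 d)], and so does its real part [a]. *)
Lemma pos_neg_small e k (d : K) : projection e -> e ** k = k -> k ** e = k ->
  k^^* = k -> nm (e - k) <= 1 -> nm (e + k) <= 1 -> 0 < d -> d < 2^-1 ->
  nm k <= 6 * d.
Proof.
move=> ep ek ke ksa h1 h2 d0 d1; have [ee es] := ep.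
have dd : 0 <= 1 - d by lra.
pose x := (1 - d)%:C%C *: (e - k); pose y := (1 - d)%:C%C *: (e + k).
have ex : e ** x = x by rewrite /x smulZr smulBr ee ek.
have ey : e ** y = y by rewrite /y smulZr smulDr ee ek.
have cjd : Num.conj ((1 - d)%:C%C : K[i]) = (1 - d)%:C%C by rewrite geC0_conj// lecR.
have [||k1 [k1s k1E k1c k1e]] := @quasi_sqrt K A x.
- by rewrite /x starZ starB es ksa cjd.
- by rewrite /x nmZ nmcR//; have := nm_ge0 (e - k); nra.
have [||k2 [k2s k2E k2c k2e]] := @quasi_sqrt K A y.
- by rewrite /y starZ starD es ksa cjd.
- by rewrite /y nmZ nmcR//; have := nm_ge0 (e + k); nra.
have yx : y ** x = x ** y.
  rewrite /x /y !smulZl !smulZr; congr (_ *: (_ *: _)).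
  by rewrite smulDl smulBl !smulBr !smulDr ee ek ke addrA subrK opprD addrA addrK.
have c12 : k1 ** k2 = k2 ** k1 by apply: k1c; rewrite (k2c x).
have k1e' := k1e e ex; have k2e' := k2e e ey.
have k1e'' : k1 ** e = k1 by rewrite -{1}k1s -es -starM k1e' k1s.
have k2e'' : k2 ** e = k2 by rewrite -{1}k2s -es -starM k2e' k2s.
pose a := e - k1; pose b := e - k2.
have sq l z : l ** e = l -> e ** l = l -> l + l - l ** l = z ->
    (e - l) ** (e - l) = e - z.
  move=> le el <-; rewrite smulBr !smulBl ee le el !opprB opprD -addrA.
  by congr (_ + _); exact: addrCA.
have aa : a ** a = e - x by apply: sq.
have bb : b ** b = e - y by apply: sq.
have ab : a ** b = b ** a.
  rewrite /a /b !smulBr !smulBl ee k1e' k2e' k1e'' k2e'' c12 !opprB.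
  by rewrite addrACA [RHS]addrACA; congr (_ + _); exact: addrC.
have as_ : a^^* = a by rewrite /a starB es k1s.
have bs_ : b^^* = b by rewrite /b starB es k2s.
move: a b aa bb ab as_ bs_ => a b aa bb ab as_ bs_.
pose w := a + 'i *: b.
have wsE : w^^* = a - 'i *: b.
  by rewrite /w starD starZ as_ bs_ conjCi scaleNr.
have ee2 : e + e = (2 : K)%:C%C *: e by rewrite rmorph_nat scaler_nat mulr2n.
have xy : x + y = (1 - d)%:C%C *: (e + e).
  by rewrite -scalerDr addrACA addNr addr0.
have ww : w^^* ** w = (2 * d)%:C%C *: e.
  rewrite wsE /w smulDr !smulBl !smulZr !smulZl scalerA mulCii scaleN1r opprK.
  rewrite ab addrA subrK aa bb addrACA -opprD xy ee2 scalerA -scalerBl.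
  by rewrite -rmorphM -rmorphB/=; congr (_%:C%C *: _); ring.
have e1 := projection_le1 ep.
have w2 : nm w ^+ 2 <= 2 * d.
  rewrite -nm_cstar ww nmZ nmcR; last by lra.
  by rewrite ger_pMr//; lra.
have aE : a = (2^-1 : K)%:C%C *: (w + w^^*).
  rewrite wsE /w addrACA subrr addr0 -mulr2n -(scaler_nat 2 a) scalerA.
  by rewrite -(rmorph_nat (real_complex K)) -rmorphM/= mulVf ?scale1r// pnatr_eq0.
have al : nm a <= nm w.
  rewrite {1}aE nmZ nmcR ?invr_ge0//.
  by have := nmD w w^^*; rewrite nm_star; lra.
have aal : nm (a ** a) <= 2 * d.
  apply: le_trans w2; rewrite (le_trans (nmM _ _))// expr2 ler_pM ?nm_ge0//.
have kE : (1 - d)%:C%C *: k = a ** a - d%:C%C *: e.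
  have eE : (1 - d)%:C%C *: e + d%:C%C *: e = e.
    by rewrite -scalerDl -rmorphD/= subrK scale1r.
  have -> : a ** a = (1 - d)%:C%C *: k + d%:C%C *: e; last by rewrite addrK.
  by rewrite aa -[X in X - _]eE /x scalerBr opprB addrC addrA subrK.
have := nmB (a ** a) (d%:C%C *: e); rewrite -kE !nmZ !nmcR//; last by lra.
by have := nm_ge0 k; nra.
Qed.

(** For a self-adjoint [h] in the corner of [e], the bound on [T e - h] expresses
    [0 <= h <= 2 T] and the one on [T e + h] expresses [- 2 T <= h <= 0]. *)
Lemma pos_neg_eq0 e h (T : K) : projection e -> e ** h = h -> h ** e = h ->
  h^^* = h -> 0 < T -> nm (T%:C%C *: e - h) <= T -> nm (T%:C%C *: e + h) <= T ->
  h = 0.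
Proof.
move=> ep eh he hsa T0 h1 h2.
have Ti : 0 <= T^-1 by rewrite invr_ge0 ltW.
have TE : T^-1%:C%C *: (T%:C%C *: e) = e.
  by rewrite scalerA -rmorphM/= mulVf ?gt_eqF// scale1r.
pose k := T^-1%:C%C *: h.
suff k0 : k = 0.
  have -> : h = T%:C%C *: k by rewrite scalerA -rmorphM/= mulfV ?gt_eqF// scale1r.
  by rewrite k0 scaler0.
(* Chosen so that [6 d' <= d] and [d' < 1 / 2]. *)
apply: nm_small => d d0; pose d' := Num.min (d / 6) (4^-1).
apply: (@le_trans _ _ (6 * d')); last first.
  have : d' <= d / 6 by rewrite ge_min lexx.
  lra.
apply: (@pos_neg_small e) => //.
- by rewrite /k smulZr eh.
- by rewrite /k smulZl he.
- by rewrite /k starZ hsa geC0_conj// lecR.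
- by rewrite -{1}TE -scalerBr nmZ nmcR// mulrC ler_pdivrMr// mul1r.
- by rewrite -{1}TE -scalerDr nmZ nmcR// mulrC ler_pdivrMr// mul1r.
- by rewrite lt_min divr_gt0//= invr_gt0.
- by rewrite gt_min; apply/orP; right; lra.
Qed.

(** Compress to the corner of [P j]: the elements [P j ** P i ** P j], for
    [i != j], are between [0] and [P j] and add up to [0], so they vanish. *)
Lemma projections_orthogonal (I : eqType) (r : seq I) (P : I -> A) e i j :
  is_unit_elt e -> (forall i, projection (P i)) ->
  uniq r -> \sum_(i <- r) P i = e -> i \in r -> j \in r -> i != j ->
  P i ** P j = 0.
Proof.
move=> ue Pp ur sumP ir jr ij.
have [eP Pe] : (forall x, e ** x = x) /\ (forall x, x ** e = x).
  by split=> x; have [] := ue x.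
pose h l := P j ** P l ** P j.
have [Pjj Pjs] := Pp j.
have hc l : nm (P j - h l) <= 1.
  have -> : P j - h l = P j ** (e - P l) ** P j.
    by rewrite smulBr smulBl Pe Pjj.
  have el : projection (e - P l).
    have [Pll Pls] := Pp l.
    have es : e^^* = e.
      by apply: star_faithful => z; rewrite Pe -{1}[z]starK -starM eP starK.
    by split; rewrite ?starB ?es ?Pls// smulBr !smulBl !eP Pe Pll subrr subr0.
  apply: (le_trans (nmM _ _)); apply: (@le_trans _ _ (1 * 1)); last by rewrite mulr1.
  apply: ler_pM; [exact: nm_ge0|exact: nm_ge0| |exact: projection_le1].
  apply: (le_trans (nmM _ _)); rewrite -[leRHS]mulr1.
  by apply: ler_pM; [exact: nm_ge0|exact: nm_ge0|exact: projection_le1..].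
have hsum : \sum_(l <- rem j r) h l = 0.
  have : \sum_(l <- r) h l = P j.
    by rewrite -smul_suml -smul_sumr sumP Pe Pjj.
  rewrite (big_rem j)//= /h !Pjj => /eqP; rewrite -subr_eq0 addrAC subrr add0r.
  by move/eqP.
have ir' : i \in rem j r by rewrite mem_rem_uniq// !inE ij.
have hi : h i = - \sum_(l <- rem i (rem j r)) h l.
  by have /eqP := hsum; rewrite (big_rem i ir')/= addr_eq0 => /eqP.
have h0 : h i = 0.
  (* One copy of [P j] for each term of the sum in [hi], and one for the
     left-hand side. *)
  set s := rem i _ in hi; pose T : K := (size s).+1%:R.
  have TE : T%:C%C *: P j = P j + \sum_(l <- s) P j.
    by rewrite big_const_seq count_predT iter_addr_0 /T rmorph_nat scaler_nat mulrS.
  apply: (@pos_neg_eq0 (P j) _ T); rewrite ?ltr0Sn//.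
  - by rewrite /h !smulA Pjj.
  - by rewrite /h -!smulA Pjj.
  - by have [_ Pis] := Pp i; rewrite /h !starM Pis Pjs smulA.
  - rewrite TE addrAC (le_trans (nmD _ _))// (le_trans (lerD (hc _) (nm_sum _ _)))//.
    rewrite (le_trans (lerD (lexx _) (ler_sum _ (fun _ _ => projection_le1 (Pp _)))))//.
    by rewrite big_const_seq count_predT iter_addr_0 /T [leRHS]mulrS.
  - rewrite TE hi -addrA -sumrB (le_trans (nmD _ _))//.
    rewrite (le_trans (lerD (projection_le1 (Pp _)) (nm_sum _ _)))//.
    rewrite (le_trans (lerD (lexx _) (ler_sum _ (fun _ _ => hc _))))//.
    by rewrite big_const_seq count_predT iter_addr_0 /T [leRHS]mulrS.
have [Pii Pis] := Pp i.
apply/nm_le0; rewrite -(@ler_pXn2r _ 2) ?nnegrE ?nm_ge0// expr0n/= -nm_cstar.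
by rewrite starM Pis Pjs smulA -(smulA (P j)) Pii -/(h i) h0 nm0.
Qed.

End Orthogonality.

(** * Closed *-subalgebras and corners *)

Section SubCStar.
Variables (K : realType) (A : cstarAlgType K[i]).
Local Notation C := (K[i]).

Definition norm_closed (S : set A) :=
  forall x, (forall e : K, 0 < e -> exists2 y, S y & nm (x - y) < e) -> S x.

Record cstar_subalg := CStarSubalg {
  csub_set :> A -> Prop;
  csub0 : csub_set 0;
  csubD : forall x y, csub_set x -> csub_set y -> csub_set (x + y);
  csubZ : forall (c : C) x, csub_set x -> csub_set (c *: x);
  csubM : forall x y, csub_set x -> csub_set y -> csub_set (x ** y);
  csubS : forall x, csub_set x -> csub_set x^^*;
  csub_closed : norm_closed csub_set
}.

Definition csub_pred (S : cstar_subalg) : {pred A} := fun x => `[< S x >].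

Record subCstar (S : cstar_subalg) :=
  SubCstar { subval :> A; _ : subval \in csub_pred S }.

HB.instance Definition _ S := [isSub for @subval S].
HB.instance Definition _ S := [Choice of subCstar S by <:].

Section Instances.
Variable S : cstar_subalg.

Lemma subP (x : A) : reflect (S x) (x \in csub_pred S).
Proof. exact: asboolP. Qed.

Lemma subvalP (x : subCstar S) : S x.
Proof. by case: x => x /= /subP. Qed.

Definition in_sub (x : A) (Sx : S x) : subCstar S := SubCstar (introT (subP x) Sx).

Lemma csub_submod_closed : submod_closed (csub_pred S).
Proof.
split=> [|c x y /subP Sx /subP Sy]; apply/subP; first exact: csub0.
by apply: csubD => //; exact: csubZ.
Qed.

HB.instance Definition _ :=
  GRing.isSubmodClosed.Build C A (csub_pred S) csub_submod_closed.
HB.instance Definition _ := [SubChoice_isSubLmodule of subCstar S by <:].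

Lemma sub_ext (x y : subCstar S) : x = y :> A -> x = y.
Proof. exact: val_inj. Qed.

Fact sub_normD (x y : subCstar S) : `|(x + y : subCstar S) : A| <= `|x : A| + `|y : A|.
Proof. exact: ler_normD. Qed.
Fact sub_normZ (c : C) (x : subCstar S) : `|(c *: x : subCstar S) : A| = `|c| * `|x : A|.
Proof. exact: normrZ. Qed.
Fact sub_norm0 (x : subCstar S) : `|x : A| = 0 -> x = 0.
Proof. by move=> /normr0_eq0 x0; apply: sub_ext. Qed.

HB.instance Definition _ := @Lmodule_isNormed.Build C (subCstar S)
  (fun x => `|x : A|) sub_normD sub_normZ sub_norm0.

Fact sub_complete (F : set_system (subCstar S)) :
  ProperFilter F -> cauchy F -> cvg F.
Proof.
move=> FF /cauchyP Fc.
have [|x Fx] := @nm_complete K A _ F FF (@subval S).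
  move=> e e0; have eC : 0 < e%:C%C :> C by rewrite ltcR.
  have [y Fy] := Fc _ eC; exists (subval y); apply: filterS Fy => z.
  by rewrite -ball_normE/= distrC -[Num.norm _]/(`|subval z - subval y|) nmE ltcR.
have Sx : S x.
  apply: csub_closed => e e0.
  by have [y yx] := filter_ex (Fx e e0); exists y; [exact: subvalP|rewrite nmC].
apply/cvg_ex; exists (in_sub Sx).
apply/(@cvgrPdist_lt _ _ _ F _ id) => e e0.
have [r r0 <-] : exists2 r : K, 0 < r & r%:C%C = e.
  exists (complex.Re e); first by move: e0; rewrite ltcE => /andP[].
  by apply: RRe_real; rewrite gtr0_real.
apply: filterS (Fx r r0) => z /=.
by rewrite -[Num.norm _]/(`|x - subval z|) nmE ltcR nmC.
Qed.

HB.instance Definition _ := Uniform_isComplete.Build (subCstar S) sub_complete.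

Definition sub_mul (x y : subCstar S) : subCstar S :=
  in_sub (csubM (subvalP x) (subvalP y)).
Definition sub_star (x : subCstar S) : subCstar S := in_sub (csubS (subvalP x)).

Fact sub_mulA : associative sub_mul.
Proof. by move=> x y z; apply: sub_ext; exact: smulA. Qed.
Fact sub_mulDl : left_distributive sub_mul +%R.
Proof. by move=> x y z; apply: sub_ext; exact: smulDl. Qed.
Fact sub_mulDr : right_distributive sub_mul +%R.
Proof. by move=> x y z; apply: sub_ext; exact: smulDr. Qed.
Fact sub_mulZl (c : C) x y : sub_mul (c *: x) y = c *: sub_mul x y.
Proof. by apply: sub_ext; exact: smulZl. Qed.
Fact sub_mulZr (c : C) x y : sub_mul x (c *: y) = c *: sub_mul x y.
Proof. by apply: sub_ext; exact: smulZr. Qed.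
Fact sub_starK : involutive sub_star.
Proof. by move=> x; apply: sub_ext; exact: starK. Qed.
Fact sub_starD : {morph sub_star : x y / x + y}.
Proof. by move=> x y; apply: sub_ext; exact: starD. Qed.
Fact sub_starZ (c : C) x : sub_star (c *: x) = Num.conj c *: sub_star x.
Proof. by apply: sub_ext; exact: starZ. Qed.
Fact sub_starM x y : sub_star (sub_mul x y) = sub_mul (sub_star y) (sub_star x).
Proof. by apply: sub_ext; exact: starM. Qed.

HB.instance Definition _ := Lmodule_isStarAlgebra.Build C (subCstar S)
  sub_mulA sub_mulDl sub_mulDr sub_mulZl sub_mulZr sub_starK sub_starD sub_starZ
  sub_starM.

Fact sub_norm_mul (x y : subCstar S) : `|x ** y| <= `|x| * `|y|.
Proof. exact: (norm_smul (x : A) (y : A)). Qed.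
Fact sub_norm_cstar (x : subCstar S) : `|x^^* ** x| = `|x| ^+ 2.
Proof. exact: (norm_cstar (x : A)). Qed.

HB.instance Definition _ :=
  NormedStarAlgebra_isCStar.Build C (subCstar S) sub_norm_mul sub_norm_cstar.

Lemma star_hom_subval : star_hom (@subval S).
Proof. by []. Qed.

Lemma star_hom_sub (D : starAlgType C) (f : D -> A) (fS : forall x, S (f x)) :
  star_hom f -> star_hom (fun x => in_sub (fS x)).
Proof.
move=> [fD fZ fM fs].
by split=> [x y|c x|x y|x]; apply: sub_ext; rewrite /= ?fD ?fZ ?fM ?fs.
Qed.

End Instances.

Definition norm_closure (S : set A) : set A := [set x | forall e : K, 0 < e ->
  exists2 y, S y & nm (x - y) < e].

Lemma norm_closure_closed (S : set A) : norm_closed (norm_closure S).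
Proof.
move=> x Hx e e0; have e2 : 0 < e / 2 by rewrite divr_gt0.
have [y /(_ _ e2)[z Sz yz] xy] := Hx _ e2; exists z => //.
by have := nm_tri y x z; lra.
Qed.

Lemma sub_norm_closure (S : set A) x : S x -> norm_closure S x.
Proof. by move=> Sx e e0; exists x => //; rewrite subrr nm0. Qed.

(** [f] maps the closure of [S] into the closure of the closure of [S]. *)
Lemma norm_closure_lip (S : set A) (f : A -> A) : lip f ->
  (forall x, S x -> norm_closure S (f x)) ->
  forall x, norm_closure S x -> norm_closure S (f x).
Proof.
move=> [M fM] fS x Sx; apply: norm_closure_closed => e e0.
have N0 : 0 < `|M| + 1 by rewrite ltr_wpDl.
have [y Sy] := Sx (e / (`|M| + 1)) (divr_gt0 e0 N0).
rewrite ltr_pdivlMr// => H; exists (f y); first exact: fS.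
apply: le_lt_trans (fM _ _) (le_lt_trans _ H); rewrite mulrC ler_wpM2l ?nm_ge0//.
by rewrite (le_trans (ler_norm M))// lerDl.
Qed.

Lemma norm_closure_csub (S : set A) : S 0 -> (forall x y, S x -> S y -> S (x + y)) ->
  (forall (c : C) x, S x -> S (c *: x)) -> (forall x y, S x -> S y -> S (x ** y)) ->
  (forall x, S x -> S x^^*) -> exists Q : cstar_subalg, csub_set Q = norm_closure S.
Proof.
move=> S0 SD SZ SM SS.
unshelve eexists (@CStarSubalg (norm_closure S) _ _ _ _ _ (@norm_closure_closed S)) => //.
- exact: sub_norm_closure.
- move=> x y Sx Sy; apply: (norm_closure_lip (f := fun x => x + y)) Sx.
    by apply: lipD; [exact: lip_id|exact: lip_cst].
  move=> {}x Sx; apply: (norm_closure_lip (f := fun y => x + y)) Sy.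
    by apply: lipD; [exact: lip_cst|exact: lip_id].
  by move=> y' Sy; apply: sub_norm_closure; exact: SD.
- move=> c x; apply: (norm_closure_lip (f := fun x => c *: x)).
    by apply: lipZ; exact: lip_id.
  by move=> y Sy; apply: sub_norm_closure; exact: SZ.
- move=> x y Sx Sy; apply: (norm_closure_lip (lip_smulr y)) Sx => x' Sx.
  apply: (norm_closure_lip (lip_smull x')) Sy => y' Sy.
  by apply: sub_norm_closure; exact: SM.
- move=> x; apply: (norm_closure_lip (@lip_star K A)) => y Sy.
  by apply: sub_norm_closure; exact: SS.
Qed.

Section Corner.
Variable p : A.
Hypotheses (pp : p ** p = p) (ps : p^^* = p).

(** The corner [p A p], a C*-algebra with unit [p]. *)
Definition corner_set : set A := [set x | p ** x = x /\ x ** p = x].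

Lemma lip_eq_closed (f g : A -> A) : lip f -> lip g ->
  norm_closed [set x | f x = g x].
Proof.
by move=> fl gl x Hx; exact: lip_eq_at.
Qed.

Definition corner : cstar_subalg.
Proof.
refine (@CStarSubalg corner_set _ _ _ _ _ _).
- by split; rewrite ?smulr0 ?smul0r.
- by move=> x y [px xp] [py yp]; split; rewrite ?smulDr ?smulDl ?px ?py ?xp ?yp.
- by move=> c x [px xp]; split; rewrite ?smulZr ?smulZl ?px ?xp.
- by move=> x y [px xp] [py yp]; split; rewrite ?smulA ?px // -smulA yp.
- by move=> x [px xp]; split; rewrite -{1}ps -starM ?px ?xp.
- move=> x Hx; split.
  + apply: (lip_eq_closed (lip_smull p) (@lip_id K A)) => e e0.
    by have [y [py yp] yx] := Hx e e0; exists y.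
  + apply: (lip_eq_closed (lip_smulr p) (@lip_id K A)) => e e0.
    by have [y [py yp] yx] := Hx e e0; exists y.
Defined.

End Corner.

End SubCStar.

(** * *-homomorphisms on finitely supported functions *)

Section CcSingle.
Variables (G : groupType) (C : numClosedFieldType) (A : cstarAlgType C).
Variable al : cstar_action G A.
Implicit Types (a b : A) (g h : G) (f k : Cc al).

Fact single_subproof a g : (fun h => if h == g then a else 0) \in @Cc_pred G C A.
Proof.
apply/CcP; apply: (sub_finite_set _ (finite_seq [:: g])) => h /=.
by case: (eqVneq h g) => [->|_]; rewrite ?inE ?eqxx.
Qed.

Definition single a g : Cc al := MkCc al (single_subproof a g).

Lemma singleE a g h : single a g h = if h == g then a else 0.
Proof. by []. Qed.

Lemma CcDE f k g : (f + k) g = f g + k g. Proof. by []. Qed.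
Lemma CcZE (c : C) f g : (c *: f) g = c *: f g. Proof. by []. Qed.

Lemma singleD a b g : single (a + b) g = single a g + single b g.
Proof. by apply: Cc_ext => h; rewrite CcDE !singleE; case: eqP; rewrite ?addr0. Qed.

Lemma singleZ (c : C) a g : single (c *: a) g = c *: single a g.
Proof. by apply: Cc_ext => h; rewrite CcZE !singleE; case: eqP; rewrite ?scaler0. Qed.

Lemma single_mul a b g h :
  single a g ** single b h = single (a ** al g b) (g * h)%g.
Proof.
apply: Cc_ext => k; rewrite -[LHS]/(Defs.conv al (single a g) (single b h) k).
rewrite (@convE _ _ _ _ _ _ [:: g])//; last first.
  by move=> l; rewrite singleE inE; case: (eqVneq l g) => // _; rewrite eqxx.
rewrite big_seq1 !singleE eqxx.
have -> : (g^-1 * k == h)%g = (k == g * h)%g.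
  by apply/eqP/eqP => [<-|->]; rewrite ?mulVKg ?mulKg.
by case: eqP => // _; rewrite cact0 smulr0.
Qed.

Lemma single_star a g : (single a g)^^* = single (al g^-1%g a^^*) g^-1%g.
Proof.
apply: Cc_ext => k; rewrite -[LHS]/(Defs.invol al (single a g) k) /Defs.invol !singleE.
have -> : (k^-1 == g)%g = (k == g^-1)%g.
  by apply/eqP/eqP => [<-|->]; rewrite ?invgK.
by case: eqP => [->//|_]; rewrite star0 cact0.
Qed.

Lemma Cc_sumE f (s : seq G) : uniq s -> (forall h, f h != 0 -> h \in s) ->
  f = \sum_(g <- s) single (f g) g.
Proof.
move=> us fs; apply: Cc_ext => h.
have -> : (\sum_(g <- s) single (f g) g) h = \sum_(g <- s) single (f g) g h.
  by elim: (s) => [|g r IH]; rewrite ?big_nil// !big_cons CcDE IH.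
have [hs|hs] := boolP (h \in s).
  rewrite (bigD1_seq h)//= eqxx big1 ?addr0// => g gh.
  by rewrite eq_sym (negbTE gh).
rewrite big_seq big1; first by apply/eqP; apply: contraNT hs => /fs.
by move=> g gs; rewrite singleE; case: eqP => // hg; rewrite hg gs in hs.
Qed.

Lemma Cc_ind (P : Cc al -> Prop) : P 0 -> (forall f k, P f -> P k -> P (f + k)) ->
  (forall a g, P (single a g)) -> forall f, P f.
Proof.
move=> P0 PD Ps f; have [s us fs] := Cc_supp f; rewrite (Cc_sumE us fs).
by elim: (s) => [|g r IH]; rewrite ?big_nil// big_cons; apply: PD.
Qed.

Section Integrated.
Variables (D : starAlgType C) (phi : A -> G -> D).
Hypothesis phiD : forall a b g, phi (a + b) g = phi a g + phi b g.
Hypothesis phiZ : forall (c : C) a g, phi (c *: a) g = c *: phi a g.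
Hypothesis phiM : forall a b g h,
  phi a g ** phi b h = phi (a ** al g b) (g * h)%g.
Hypothesis phiS : forall a g, (phi a g)^^* = phi (al g^-1%g a^^*) g^-1%g.

Let phi0 g : phi 0 g = 0.
Proof. by rewrite -(scale0r 0) phiZ scale0r. Qed.

(** The element [phi a g] plays the role of [pi(a) V_g] for a covariant pair
    [(pi, V)]; when [D] has no unit, [V_g] itself need not lie in [D]. *)
Definition integrated (f : Cc al) : D := \sum_(g \in [set: G]) phi (f g) g.

Let integratedE f (s : seq G) : uniq s -> (forall h, f h != 0 -> h \in s) ->
  integrated f = \sum_(g <- s) phi (f g) g.
Proof.
move=> us fs; rewrite /integrated [RHS]fsbig_seq//.
apply/esym/fsbig_widen => // h [_ /= hs]; apply/eqP.
rewrite (_ : f h = 0) ?phi0 ?eqxx//.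
by apply/eqP; apply: contra_notT hs => /fs.
Qed.

Lemma integrated_single a g : integrated (single a g) = phi a g.
Proof.
rewrite (@integratedE _ [:: g])//.
  by rewrite big_seq1 singleE eqxx.
by move=> h; rewrite singleE inE; case: (eqVneq h g) => // _; rewrite eqxx.
Qed.

Let integratedD f k : integrated (f + k) = integrated f + integrated k.
Proof.
have [s us fs] := Cc_supp f; have [t ut kt] := Cc_supp k.
pose u := undup (s ++ t); have uu : uniq u := undup_uniq _.
rewrite (@integratedE f u)//; last by move=> h /fs; rewrite mem_undup mem_cat => ->.
rewrite (@integratedE k u)//; last by move=> h /kt; rewrite mem_undup mem_cat orbC => ->.
rewrite (@integratedE (f + k) u)//.
  by rewrite -big_split; apply: eq_bigr => g _; exact: phiD.
move=> h; rewrite CcDE mem_undup mem_cat; apply: contraNT.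
rewrite negb_or => /andP[hs ht].
have /eqP -> : f h == 0 by apply: contraNT hs => /fs.
have /eqP -> : k h == 0 by apply: contraNT ht => /kt.
by rewrite addr0.
Qed.

Let integrated0 : integrated 0 = 0.
Proof. by rewrite (@integratedE _ [::]) ?big_nil// => h; rewrite eqxx. Qed.

Lemma integrated_hom : star_hom integrated.
Proof.
split.
- exact: integratedD.
- move=> c; elim/Cc_ind => [|f k Hf Hk|a g].
  + by rewrite scaler0 integrated0 scaler0.
  + by rewrite scalerDr !integratedD Hf Hk scalerDr.
  + by rewrite -singleZ !integrated_single phiZ.
- move=> f k; elim/Cc_ind: f => [|f1 f2 H1 H2|a g].
  + by rewrite smul0r integrated0 smul0r.
  + by rewrite smulDl !integratedD H1 H2 smulDl.
  elim/Cc_ind: k => [|k1 k2 H1 H2|b h].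
  + by rewrite smulr0 integrated0 smulr0.
  + by rewrite smulDr !integratedD H1 H2 smulDr.
  + by rewrite single_mul !integrated_single phiM.
- elim/Cc_ind => [|f k Hf Hk|a g].
  + by rewrite star0 integrated0 star0.
  + by rewrite starD !integratedD Hf Hk starD.
  + by rewrite single_star !integrated_single phiS.
Qed.

End Integrated.

Lemma Cc_hom_ext (D : starAlgType C) (f1 f2 : Cc al -> D) :
  star_hom f1 -> star_hom f2 ->
  (forall a g, f1 (single a g) = f2 (single a g)) -> f1 = f2.
Proof.
move=> h1 h2 E; apply/funext; elim/Cc_ind => [|f k Hf Hk|a g //].
  by rewrite !star_hom0.
by case: h1 h2 => [D1 _ _ _] [D2 _ _ _]; rewrite D1 D2 Hf Hk.
Qed.

End CcSingle.

(** * The ring algebra inside non-unital algebras *)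

Section RingAlgebraHoms.
Variables (K : realType) (R : idomainType).
Local Notation C := (K[i]).

(** The relations of the ring algebra with a projection [p] in place of the unit:
    they define a homomorphism into [B] although [p] is only the unit of its
    corner. *)
Record corner_relations (B : cstarAlgType C) (p : B) (sB : nonzero R -> B)
    (uB : R -> B) : Prop := CornerRelations {
  cr_pp : p ** p = p;
  cr_ps : p^^* = p;
  cr_sp : forall m, p ** sB m = sB m /\ sB m ** p = sB m;
  cr_up : forall n, p ** uB n = uB n /\ uB n ** p = uB n;
  cr_isometry : forall m, (sB m)^^* ** sB m = p;
  cr_unitaryl : forall n, (uB n)^^* ** uB n = p;
  cr_unitaryr : forall n, uB n ** (uB n)^^* = p;
  cr_s : forall k m, sB k ** sB m = sB (nzM k m);
  cr_u : forall l n, uB l ** uB n = uB (l + n);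
  cr_su : forall m n, sB m ** uB n = uB ((m : R) * n) ** sB m;
  cr_sum : forall m : nonzero R,
    \sum_(c \in [set: Rmod (m : R)])
      uB (rep c) ** range_proj sB m ** (uB (rep c))^^* = p
}.

Section FromA.
Variables (A : cstarAlgType C) (oneA : A) (s : nonzero R -> A) (u : R -> A).
Hypothesis A_universal : is_ring_algebra oneA s u.
Hypothesis R_finite : forall m : nonzero R, finite_set [set: Rmod (m : R)].

Lemma fsbig_morph (B D : zmodType) (f : B -> D) (T : choiceType) (X : set T)
    (F : T -> B) : finite_set X -> f 0 = 0 -> {morph f : x y / x + y} ->
  f (\sum_(i \in X) F i) = \sum_(i \in X) f (F i).
Proof.
by move=> fX f0 fD; rewrite !fsbig_finite//= (big_morph f fD f0).
Qed.

Lemma corner_hom (B : cstarAlgType C) (p : B) sB uB :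
  corner_relations p sB uB ->
  exists f : A -> B, [/\ star_hom f, f oneA = p, (forall m, f (s m) = sB m)
    & forall n, f (u n) = uB n].
Proof.
case=> pp ps sp up si ul ur ss uu su sm.
pose Q := corner ps.
pose p' : subCstar Q := in_sub (S := Q) (conj pp pp).
pose s' m : subCstar Q := in_sub (S := Q) (sp m).
pose u' n : subCstar Q := in_sub (S := Q) (up n).
have rel : ring_relations p' s' u'.
  split.
  - by move=> x; have [px xp] := subvalP x; split; apply: sub_ext.
  - by move=> m; apply: sub_ext; exact: si.
  - by move=> n; apply: sub_ext; exact: ul.
  - by move=> n; apply: sub_ext; exact: ur.
  - by move=> k m; apply: sub_ext; exact: ss.
  - by move=> k m; apply: sub_ext; exact: uu.
  - by move=> m n; apply: sub_ext; exact: su.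
  - move=> m; apply: sub_ext.
    rewrite (fsbig_morph (f := @subval K B Q) _ (R_finite m) erefl (fun _ _ => erefl)).
    exact: sm.
have [f [[fh f1 fs fu] _]] := A_universal.2 _ _ _ _ rel.
exists (@subval K B Q \o f); split.
- exact: star_hom_comp (star_hom_subval _) fh.
- by rewrite /= f1.
- by move=> m; rewrite /= fs.
- by move=> n; rewrite /= fu.
Qed.

(** Both maps take their values in the corner of the common image of the unit, to
    which the universal property for unital algebras applies. *)
Lemma ring_algebra_ext (B : cstarAlgType C) (f1 f2 : A -> B) :
  star_hom f1 -> star_hom f2 -> f1 oneA = f2 oneA ->
  (forall m, f1 (s m) = f2 (s m)) -> (forall n, f1 (u n) = f2 (u n)) ->
  forall x, f1 x = f2 x.
Proof.
move=> h1 h2 e1 es eu.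
have [[un iso ul ur ss uu su sm] univ] := A_universal.
have one_star : oneA^^* = oneA.
  apply: star_faithful => z; have [_ ->] := un z.
  by rewrite -{1}[z]starK -starM; have [-> _] := un z^^*; rewrite starK.
have pp : f1 oneA ** f1 oneA = f1 oneA.
  by case: h1 => _ _ <- _; have [->] := un oneA.
have ps : (f1 oneA)^^* = f1 oneA.
  by case: h1 => _ _ _ <-; rewrite one_star.
pose Q := corner ps.
have Q1 x : corner_set (f1 oneA) (f1 x).
  by split; case: h1 => _ _ <- _; rewrite ?(un x).1 ?(un x).2.
have Q2 x : corner_set (f1 oneA) (f2 x).
  by rewrite e1; split; case: h2 => _ _ <- _; rewrite ?(un x).1 ?(un x).2.
pose g1 x : subCstar Q := in_sub (S := Q) (Q1 x).
pose g2 x : subCstar Q := in_sub (S := Q) (Q2 x).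
have gh1 : star_hom g1 by exact: (star_hom_sub (S := Q) Q1 h1).
have gh2 : star_hom g2 by exact: (star_hom_sub (S := Q) Q2 h2).
have rel : ring_relations (g1 oneA) (fun m => g1 (s m)) (fun n => g1 (u n)).
  have [gD gZ gM gS] := gh1; split.
  - by move=> x; have [px xp] := subvalP x; split; apply: sub_ext.
  - by move=> m; rewrite -gS -gM iso.
  - by move=> n; rewrite -gS -gM ul.
  - by move=> n; rewrite -gS -gM ur.
  - by move=> k m; rewrite -gM ss.
  - by move=> k m; rewrite -gM uu.
  - by move=> m n; rewrite -!gM su.
  - move=> m; rewrite -(sm m) (fsbig_morph (f := g1) _ (R_finite m) (star_hom0 gh1) gD).
    by apply: eq_fsbigr => c _; rewrite /range_proj !gM !gS.
have [g [_ gU]] := univ _ _ _ _ rel.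
have E1 : g = g1 by apply: gU.
have E2 : g = g2.
  apply: gU; split; first exact: gh2.
  - by apply: sub_ext; rewrite /= e1.
  - by move=> m; apply: sub_ext; rewrite /= es.
  - by move=> n; apply: sub_ext; rewrite /= eu.
move=> x; have := congr1 (fun g : A -> subCstar Q => subval (g x)) (etrans (esym E1) E2).
by [].
Qed.

End FromA.
End RingAlgebraHoms.

(** * Compact open sets and step functions *)

Section Divisibility.
Variable R : idomainType.
Local Notation Rx := (nonzero R).
Implicit Types (k l m n t : Rx) (x y z : Rhat R).

Lemma nz_inj m n : m = n :> R -> m = n.
Proof. exact: val_inj. Qed.

(** Limits over the index set of the inductive systems, directed by divisibility. *)
Definition div_filter : set_system Rx :=
  [set P | exists n0, forall t, P (nzM t n0)].

Global Instance div_filter_proper : ProperFilter div_filter.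
Proof.
split; first by case=> n0 /(_ (nz1 R)).
split.
- by exists (nz1 R).
- move=> P Q [p Pp] [q Qq]; exists (nzM p q) => t; split.
    have -> : nzM t (nzM p q) = nzM (nzM t q) p by apply: nz_inj => /=; ring.
    exact: Pp.
  have -> : nzM t (nzM p q) = nzM (nzM t p) q by apply: nz_inj => /=; ring.
  exact: Qq.
- by move=> P Q PQ [p Pp]; exists p => t; exact/PQ.
Qed.

Lemma div_filter_self n : div_filter [set t | exists l, t = nzM l n].
Proof. by exists n => t; exists t. Qed.

(** Compatibility of coordinates, for an index [n] that is only equal to a
    multiple of [m]; this avoids transporting along equations of indices. *)
Lemma Rhat_cls x m n (l : R) : (n : R) = l * (m : R) -> cls m (rep (x n)) = x m.
Proof.
move=> E; have l0 : l != 0.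
  by apply: contraTneq (nzP n) => l0; rewrite E l0 mul0r eqxx.
have -> : n = nzM (MkNonzero l0) m by apply: nz_inj.
exact: Rhat_compat.
Qed.

Lemma Rhat_coord_dvd x y m n (l : R) : (n : R) = l * (m : R) -> x n = y n -> x m = y m.
Proof. by move=> E xy; rewrite -(Rhat_cls x E) -(Rhat_cls y E) xy. Qed.

Lemma diag_coord0 m x : (diag m * x) m = 0.
Proof.
rewrite RhatME /= -(repK (x m)) -clsM -(cls0 (m : R)).
by apply: (@cls_eq _ _ _ _ (rep (x m))); rewrite subr0.
Qed.

(** A representative of [x] modulo [n m] is divisible by [m], and its quotient by
    [m] is determined modulo [n] because [R] is a domain; these quotients are the
    coordinates of [z]. *)
Lemma Rhat_coord0_dvd x m : x m = 0 -> exists z, x = diag m * z.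
Proof.
move=> x0.
have /boolp.choice[y yE] : forall n : Rx, exists y : R, rep (x (nzM n m)) = (m : R) * y.
  move=> n; have : cls m (rep (x (nzM n m))) = cls m 0.
    by rewrite (@Rhat_cls x m (nzM n m) n erefl) x0 cls0.
  by move=> /eqP/clsP[z]; rewrite subr0 => ->; exists z.
have zc : `[< compatible (fun n : Rx => cls n (y n)) >].
  apply/asboolP => n l; rewrite proj_cls.
  have : cls (nzM n m) (rep (x (nzM (nzM l n) m))) = cls (nzM n m) (rep (x (nzM n m))).
    by rewrite repK; apply: (@Rhat_cls _ _ _ l) => /=; ring.
  move=> /eqP/clsP[w]; rewrite !yE /= => E.
  by apply: (@cls_eq _ _ _ _ w); apply: (mulfI (nzP m)); rewrite mulrBr E; ring.
exists (MkRhat zc); apply: Rhat_ext => n.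
rewrite RhatME /= -clsM -yE.
by apply/esym/(@Rhat_cls _ _ _ m) => /=; ring.
Qed.

(** Any finite number of coordinates is determined by the single coordinate at
    the product of the indices. *)
Lemma Rhat_nbhsP x (U : set (Rhat R)) : nbhs x U ->
  exists m, forall y, y m = x m -> U y.
Proof.
pose F : set_system (Rhat R) := [set V | exists m, forall y, y m = x m -> V y].
have FF : Filter F.
  split.
  - by exists (nz1 R).
  - move=> P Q [p Pp] [q Qq]; exists (nzM p q) => y yx; split.
      by apply: Pp; apply: (Rhat_coord_dvd _ yx (l := q)) => /=; ring.
    by apply: Qq; apply: (Rhat_coord_dvd _ yx (l := p)).
  - by move=> P Q PQ [p Pp]; exists p => y /Pp /PQ.
have Fx : [eta @Rhat_coord R] @ F -->
    ([eta @Rhat_coord R] x : prod_topology (fun m : Rx => discrete_topology (Rmod m))).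
  apply/cvg_sup => m U' [?/= [[W oW <-]]] /= Wx WU.
  by exists m => y yx; apply: WU; rewrite /= yx.
rewrite nbhsE; case=> O [[V oV <-] Vx] OU.
have : nbhs ([eta @Rhat_coord R] x :
    prod_topology (fun m : Rx => discrete_topology (Rmod m))) V.
  by apply: open_nbhs_nbhs; split.
by move=> /Fx [m mV]; exists m => y /mV ?; apply: OU.
Qed.

Hypothesis R_finite : forall m : Rx, finite_set [set: Rmod (m : R)].

Definition residues m : seq (Rmod (m : R)) :=
  finmap.enum_fset (fset_set [set: Rmod (m : R)]).

Lemma residues_uniq m : uniq (residues m).
Proof. exact: finmap.fset_uniq. Qed.

Lemma mem_residues m (c : Rmod (m : R)) : c \in residues m.
Proof. by rewrite /residues in_fset_set ?inE//; exact: R_finite. Qed.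

(** By finiteness of [R/(m)], an ultrafilter selects one class for each [m]; the
    selected classes are compatible because members of the ultrafilter meet. *)
Lemma Rhat_compact : compact [set: Rhat R].
Proof.
rewrite compact_ultra => F UF _.
have FF : ProperFilter F by exact: ultra_proper.
have H (m : Rx) : exists c : Rmod (m : R), F [set y : Rhat R | y m = c].
  apply: contrapT => /forallNP nF.
  have Fn (c : Rmod (m : R)) : F [set y : Rhat R | y m <> c].
    by have [/nF//|] := in_ultra_setVsetC [set y : Rhat R | y m = c] UF.
  have [y yn] := filter_ex (@filter_bigI _ _ (fset_set [set: Rmod (m : R)])
    (fun c => [set y : Rhat R | y m <> c]) F _ (fun c _ => Fn c)).
  by apply: (yn (y m)) => //=; rewrite in_fset_set ?inE//; exact: R_finite.
pose c m := sval (cid (H m)).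
have Fc m : F [set y : Rhat R | y m = c m] := svalP (cid (H m)).
have cc : `[< compatible c >].
  apply/asboolP => m l.
  have [y [/= <- <-]] := filter_ex (filterI (Fc m) (Fc (nzM l m))).
  exact: Rhat_compat.
exists (MkRhat cc); split=> // U /Rhat_nbhsP[m mU].
by apply: filterS (Fc m) => y /mU.
Qed.

Variable K : realType.
Local Notation C := (K[i]).

Lemma Rhat_unif_continuous (f : Rhat R -> C^o) (e : K) : continuous f -> 0 < e ->
  exists m, forall x y, x m = y m -> nm (f x - f y) < e.
Proof.
move=> fc e0.
have [] := iffLR (compact_near_coveringP _) Rhat_compact Rx div_filter
  (fun m x => forall y, y m = x m -> nm (f x - f y) < e) _ _; last first.
  by move=> m /(_ (nz1 R)) H; exists (nzM (nz1 R) m) => x y xy; apply: H.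
move=> x _.
have e2 : 0 < (e / 2)%:C%C :> C by rewrite ltcR divr_gt0.
have /cvgrPdist_lt/(_ _ e2)/Rhat_nbhsP[m fm] := fc x.
exists ([set y : Rhat R | y m = x m], [set t | exists l, t = nzM l m]).
  by split; [exact: Rhat_nbhs|exact: div_filter_self].
move=> [x' i] [/= x'm [l ->]] y yx'.
have ym : y m = x m by rewrite -x'm; apply: (Rhat_coord_dvd _ yx' (l := l)).
have := fm _ x'm; have := fm _ ym; rewrite !nmE !ltcR => h1 h2.
have := nm_tri (f x) (f x') (f y); rewrite (nmC (f x') (f x)); lra.
Qed.

Lemma scr_in_lift l k x : scr_in (nzM l k) (diag l * x) = scr_in k x.
Proof. by apply: scr_in_eq; rewrite /= diagM; ring. Qed.

(** The compact open set [(c + m Rhat) / k]. *)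
Definition ball_set k (c : R) m : set (scrR R) :=
  range (fun z => scr_in k (diag c + diag m * z)).

(** Membership depends on a single coordinate, so these sets are both open and
    closed. *)
Lemma ball_setP k c m l x :
  ball_set k c m (scr_in l x) <-> (diag k * x - diag ((l : R) * c)) (nzM l m) = 0.
Proof.
split.
  move=> [z _ /eqP/scr_inP E]; rewrite -E mulrDr -diagM addrC addKr mulrA -diagM.
  exact: diag_coord0.
move=> /Rhat_coord0_dvd[z E]; exists z => //; apply: scr_in_eq.
by rewrite mulrDr -diagM mulrA -diagM -[_ * z]/(diag (nzM l m) * z) -E addrC subrK.
Qed.

Lemma ball_set_in k c m x : ball_set k c m (scr_in k x) <-> x m = cls m c.
Proof.
rewrite ball_setP diagM -mulrBr; split.
  move=> /Rhat_coord0_dvd[z]; rewrite /= diagM -mulrA => /(@diag_inj _ k)/eqP.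
  by rewrite subr_eq => /eqP ->; rewrite RhatDE diag_coord0 add0r.
move=> xm; have /Rhat_coord0_dvd[z ->] : (x - diag c) m = 0.
  by rewrite RhatDE /= xm addrN.
by rewrite mulrA -diagM; exact: (diag_coord0 (nzM k m)).
Qed.

Lemma ball_set_sub k c m : ball_set k c m `<=` range (scr_in k).
Proof. by move=> _ [z _ <-]; exists (diag c + diag m * z). Qed.

Lemma ball_set_full k c : ball_set k c (nz1 R) = range (scr_in k).
Proof.
apply/seteqP; split; first exact: ball_set_sub.
move=> _ [x _ <-]; exists (x - diag c) => //.
by rewrite diag1 mul1r addrC subrK.
Qed.

Lemma ball_set_lift l k c m :
  ball_set (nzM l k) ((l : R) * c) (nzM l m) = ball_set k c m.
Proof.
apply/seteqP; split=> _ [z _ <-]; exists z => //.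
  by rewrite /= !diagM -mulrA -mulrDr scr_in_lift.
by rewrite /= !diagM -mulrA -mulrDr scr_in_lift.
Qed.

Fact ind_subproof k c m :
  (fun w => if `[< ball_set k c m w >] then 1 else 0 : C^o) \in @C0_pred K (scrR R).
Proof.
apply/C0P; split.
  apply: scr_continuous => l x.
  apply: (@cvg_near_cst _ _ _ _ _ (nbhs_filter x)).
  have := Rhat_nbhs x (nzM l m); apply: filterS => y yx /=.
  have -> : `[< ball_set k c m (scr_in l y) >] = `[< ball_set k c m (scr_in l x) >].
    by apply: asbool_equiv_eq; rewrite !ball_setP !RhatDE !RhatME yx.
  by [].
move=> e e0; exists (ball_set k c m).
  apply: continuous_compact Rhat_compact; apply: continuous_subspaceT => x.
  apply: (@continuous_comp _ _ _ (fun z => diag c + diag m * z) (scr_in k)).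
    apply: (@continuous_comp _ _ _ (fun z => diag m * z) (fun z => diag c + z)).
      exact: Rhat_mul_continuous.
    exact: Rhat_add_continuous.
  exact: scr_in_continuous.
by move=> w Ww; rewrite asboolF// normr0.
Qed.

Definition coset_ind k c m : C0 K (scrR R) := MkC0 (ind_subproof k c m).

Lemma indT k c m w : ball_set k c m w -> coset_ind k c m w = 1.
Proof. by move=> W; rewrite /= asboolT. Qed.
Lemma indF k c m w : ~ ball_set k c m w -> coset_ind k c m w = 0.
Proof. by move=> W; rewrite /= asboolF. Qed.

Lemma ind_eq k c m k' c' m' : ball_set k c m = ball_set k' c' m' ->
  coset_ind k c m = coset_ind k' c' m'.
Proof. by move=> E; apply: C0_ext => w /=; rewrite E. Qed.

Lemma ind_lift l k c m : coset_ind (nzM l k) ((l : R) * c) (nzM l m) = coset_ind k c m.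
Proof. exact/ind_eq/ball_set_lift. Qed.

Lemma ind_in k c m x : coset_ind k c m (scr_in k x) = if x m == cls m c then 1 else 0.
Proof.
case: eqP => H; first by rewrite indT// ball_set_in.
by rewrite indF// ball_set_in.
Qed.

Lemma ind_mul_sub k c m k' c' m' : ball_set k c m `<=` ball_set k' c' m' ->
  coset_ind k c m ** coset_ind k' c' m' = coset_ind k c m /\
  coset_ind k' c' m' ** coset_ind k c m = coset_ind k c m.
Proof.
move=> s; suff H : coset_ind k c m ** coset_ind k' c' m' = coset_ind k c m.
  by split=> //; rewrite -[RHS]H; apply: C0_ext => w; exact: mulrC.
apply: C0_ext => w; rewrite -[LHS]/(coset_ind k c m w * coset_ind k' c' m' w).
have [W|W] := pselect (ball_set k c m w); last by rewrite indF// mul0r.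
by rewrite (indT (s _ W)) mulr1.
Qed.

Lemma ind_star k c m : (coset_ind k c m)^^* = coset_ind k c m.
Proof.
apply: C0_ext => w; rewrite -[LHS]/(Num.conj (coset_ind k c m w)).
have [W|W] := pselect (ball_set k c m w); first by rewrite indT// rmorph1.
by rewrite indF// rmorph0.
Qed.

(** The sets [Rhat / k] are open, increase with [k] for divisibility, and cover
    the space; so one of them contains a given compact set. *)
Lemma C0_vanish_far (f : C0 K (scrR R)) (e : K) : 0 < e ->
  exists k, forall w, ~ range (scr_in k) w -> nm (f w : C^o) < e.
Proof.
move=> e0; have eC : 0 < e%:C%C :> C by rewrite ltcR.
have [Q Qc Qf] := C0_vanishes f eC.
have [] := iffLR (compact_near_coveringP _) Qc Rx div_filter
  (fun k w => range (scr_in k) w) _ _; last first.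
  move=> k /(_ (nz1 R)) H; exists (nzM (nz1 R) k) => w Hw.
  by rewrite -ltcR -nmE; apply: Qf => /H.
move=> w _; rewrite -(scr_inK w); set l := scr_idx w; set z := scr_val w.
exists (range (scr_in l), [set t | exists t', t = nzM t' l]).
  split; last exact: div_filter_self.
  have /cvgrPdist_lt/(_ _ (@ltr01 C)) :=
    @C0_continuous K _ (coset_ind l 0 (nz1 R)) (scr_in l z).
  apply: filterS => w' /=; have [|nW] := pselect (ball_set l 0 (nz1 R) w').
    by rewrite ball_set_full.
  rewrite (asboolF nW) asboolT ?subr0 ?normr1 ?ltxx//.
  by rewrite ball_set_full; exists z.
move=> [_ i] [/= [z' _ <-] [l' ->]].
by exists (diag l' * z') => //; rewrite scr_in_lift.
Qed.

Definition step k m (lam : Rmod (m : R) -> C) : C0 K (scrR R) :=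
  \sum_(c <- residues m) lam c *: coset_ind k (rep c) m.

Lemma C0_sumE (I : Type) (r : seq I) (F : I -> C0 K (scrR R)) w :
  (\sum_(i <- r) F i) w = \sum_(i <- r) F i w.
Proof. by elim: r => [|i r IH]; rewrite ?big_nil// !big_cons C0D IH. Qed.

Lemma step_in k m lam x : @step k m lam (scr_in k x) = lam (x m).
Proof.
rewrite /step C0_sumE (bigD1_seq (x m)) ?mem_residues ?residues_uniq//.
rewrite big1 => [|c cx].
  by rewrite C0Z ind_in repK eqxx mulr1; exact: addr0.
by rewrite C0Z ind_in repK eq_sym (negbTE cx) mulr0.
Qed.

Lemma step_out k m lam w : ~ range (scr_in k) w -> @step k m lam w = 0.
Proof.
move=> nw; rewrite /step C0_sumE big1// => c _.
by rewrite C0Z indF ?mulr0// => /ball_set_sub.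
Qed.

(** Outside some [Rhat / k] the function is small, and on [Rhat / k] it is
    uniformly continuous. *)
Lemma step_dense : dense_in [set f : C0 K (scrR R) | exists k m lam, f = @step k m lam].
Proof.
move=> f e e0; have e2 : 0 < e / 2 by rewrite divr_gt0.
have [k fk] := C0_vanish_far f e2.
have fkc : continuous (f \o scr_in k : Rhat R -> C^o).
  move=> x; apply: continuous_comp; first exact: scr_in_continuous.
  exact: C0_continuous.
have [m fm] := Rhat_unif_continuous fkc e2.
pose lam (c : Rmod (m : R)) := f (scr_in k (diag (rep c))).
exists (step k lam); first by exists k, m, lam.
apply: le_lt_trans (_ : e / 2 < e); last by lra.
rewrite {1}/nm C0_normE /=.
apply: C0_norm_le => [|w]; first exact: ltW.
rewrite -[X in `|X|]/(f w - step k lam w).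
have [[x _ <-]|nw] := pselect (range (scr_in k) w).
  rewrite step_in /lam (nmE (f _ - _ : C^o)) lecR ltW//; apply: fm => /=.
  by rewrite repK.
by rewrite step_out// subr0 (nmE (f w : C^o)) lecR ltW// fk.
Qed.

Lemma C0_ind_ext (V : normedModType C) (F G : C0 K (scrR R) -> V) :
  lip F -> lip G -> {morph F : x y / x + y} -> {morph G : x y / x + y} ->
  (forall (c : C) f, F (c *: f) = c *: F f) ->
  (forall (c : C) f, G (c *: f) = c *: G f) ->
  (forall k c m, F (coset_ind k c m) = G (coset_ind k c m)) -> forall f, F f = G f.
Proof.
move=> Fl Gl FD GD FZ GZ FG; apply: (lip_eq Fl Gl step_dense).
have F0 : F 0 = 0 by rewrite -(scale0r 0) FZ scale0r.
have G0 : G 0 = 0 by rewrite -(scale0r 0) GZ scale0r.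
move=> _ [k [m [lam ->]]]; rewrite /step (big_morph F FD F0) (big_morph G GD G0).
by apply: eq_bigr => c _; rewrite FZ GZ FG.
Qed.

Lemma ind_sum k m : \sum_(c <- residues m) coset_ind k (rep c) m = coset_ind k 0 (nz1 R).
Proof.
apply: C0_ext => w.
have -> : \sum_(c <- residues m) coset_ind k (rep c) m = @step k m (fun=> 1).
  by apply: eq_bigr => c _; rewrite scale1r.
have [W|W] := pselect (ball_set k 0 (nz1 R) w).
  by rewrite (indT W); move: W; rewrite ball_set_full => -[x _ <-]; rewrite step_in.
by rewrite (indF W) step_out// -(ball_set_full k 0).
Qed.

End Divisibility.

(** * Affine maps with a common denominator *)

Section Fractions.
Variable R : idomainType.
Local Notation Rx := (nonzero R).
Local Notation G := (affine_group {fraction R}).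
Local Notation "x %:F" := (@FracField.tofrac _ x).
Implicit Types (k l m n r t : Rx) (g h : G) (b c : R).

(** [g] is the affine map [x |-> (r x + b) / m]. *)
Definition frac_of g r m b :=
  g 0 0 * (m : R)%:F = (r : R)%:F /\ g 0 1 * (m : R)%:F = b%:F.

Lemma nzF m : (m : R)%:F != 0.
Proof. by rewrite tofrac_eq0 nzP. Qed.

Lemma frac_ofP g : exists r m b, frac_of g r m b.
Proof.
have [g00 _ _] := affineP g.
have E0 := fnum_den (g 0 0); have E1 := fnum_den (g 0 1).
have n0 : fnum (g 0 0) != 0.
  by rewrite -tofrac_eq0 -E0 mulf_neq0// nzF.
exists (nzM (MkNonzero n0) (fden (g 0 1))), (nzM (fden (g 0 0)) (fden (g 0 1))),
  (fnum (g 0 1) * (fden (g 0 0) : R)); split; rewrite /= !tofracM.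
  by rewrite -E0 mulrA.
by rewrite -E1 /=; ring.
Qed.

Lemma affine_ext g h : g 0 0 = h 0 0 -> g 0 1 = h 0 1 -> g = h.
Proof.
move=> E0 E1; apply: val_inj; apply/matrixP => i j.
have [_ g10 g11] := affineP g; have [_ h10 h11] := affineP h.
case: i => -[|[|//]] i; case: j => -[|[|//]] j.
- by rewrite (_ : Ordinal i = 0) 1?(_ : Ordinal j = 0) ?E0//; exact: val_inj.
- by rewrite (_ : Ordinal i = 0) 1?(_ : Ordinal j = 1) ?E1//; exact: val_inj.
- by rewrite (_ : Ordinal i = 1) 1?(_ : Ordinal j = 0) ?g10 ?h10//; exact: val_inj.
- by rewrite (_ : Ordinal i = 1) 1?(_ : Ordinal j = 1) ?g11 ?h11//; exact: val_inj.
Qed.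

Lemma frac_inj g h r m b : frac_of g r m b -> frac_of h r m b -> g = h.
Proof.
move=> [g0 g1] [h0 h1]; apply: affine_ext; apply: (mulIf (nzF m)).
  by rewrite g0 h0.
by rewrite g1 h1.
Qed.

Lemma frac_cross g r m b r' m' b' : frac_of g r m b -> frac_of g r' m' b' ->
  (r : R) * (m' : R) = (r' : R) * (m : R) /\ b * (m' : R) = b' * (m : R).
Proof.
move=> [g0 g1] [h0 h1]; split; apply/eqP; rewrite -tofrac_eq !tofracM.
  by rewrite -g0 -h0 mulrAC.
by rewrite -g1 -h1 mulrAC.
Qed.

Lemma affine_mulE g h :
  (g * h)%g 0 0 = g 0 0 * h 0 0 /\ (g * h)%g 0 1 = g 0 0 * h 0 1 + g 0 1.
Proof.
have [_ h10 h11] := affineP h.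
by rewrite !mx2_mulE h10 h11 mulr0 addr0 mulr1.
Qed.

Lemma frac_mul g h r m b r' m' b' : frac_of g r m b -> frac_of h r' m' b' ->
  frac_of (g * h)%g (nzM r r') (nzM m m') ((r : R) * b' + b * (m' : R)).
Proof.
move=> [g0 g1] [h0 h1]; have [E0 E1] := affine_mulE g h.
split; rewrite ?E0 ?E1 /= ?tofracD !tofracM -?g0 -?g1 -?h0 -?h1; ring.
Qed.

Lemma frac_one : frac_of 1%g (nz1 R) (nz1 R) 0.
Proof. by split; rewrite !mxE /= ?mul1r// mul0r tofrac0. Qed.

Lemma frac_inv g r m b : frac_of g r m b -> frac_of g^-1%g m r (- b).
Proof.
move=> [g0 g1]; have [E0 E1] := affine_mulE g^-1%g g.
move: E0 E1; rewrite mulVg !mxE /= => E0 /esym/eqP.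
rewrite addrC addr_eq0 => /eqP E1.
split; first by rewrite -g0 mulrA -E0 mul1r.
rewrite E1 tofracN mulNr -g1 -g0; congr (- _).
transitivity ((invmx g 0 0 * g 0 0) * (g 0 1 * (m : R)%:F)); first by ring.
by rewrite -E0 mul1r.
Qed.

Definition affine_of_fun r m b : 'M[{fraction R}]_2 :=
  \matrix_(i, j) if i == 0 then if j == 0 then (r : R)%:F / (m : R)%:F
                               else b%:F / (m : R)%:F
                 else (j == 1)%:R.

Fact affine_of_subproof r m b : affine_pred (affine_of_fun r m b).
Proof.
by rewrite /affine_pred !mxE /= mulf_neq0 ?invr_neq0 ?nzF//= !eqxx.
Qed.

Definition affine_of r m b : G := MkAffine (affine_of_subproof r m b).

Lemma frac_affine_of r m b : frac_of (affine_of r m b) r m b.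
Proof. by split; rewrite /= !mxE /= mulfVK ?nzF. Qed.

Lemma affine_act_in g r m b k x : frac_of g r m b ->
  affine_act g (scr_in k x) = scr_in (nzM m k) (diag r * x + diag ((k : R) * b)).
Proof.
move=> [g0 g1]; rewrite /affine_act (scr_embedE g0) (scr_embedE g1).
rewrite scr_inM scr_inD; apply: scr_in_eq => /=.
rewrite !diagM; ring.
Qed.

Lemma ball_set_act g r m b k c n : frac_of g r m b ->
  ball_set (nzM m k) ((r : R) * c + (k : R) * b) (nzM r n) =
  affine_act g @` ball_set k c n.
Proof.
move=> gf; have E z : affine_act g (scr_in k (diag c + diag n * z)) =
    scr_in (nzM m k) (diag ((r : R) * c + (k : R) * b) + diag (nzM r n) * z).
  rewrite (affine_act_in _ _ gf); congr (scr_in _ _).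
  by rewrite /= diagD !diagM; ring.
apply/seteqP; split.
  move=> _ [z _ <-]; exists (scr_in k (diag c + diag n * z)) => //.
  by exists z.
by move=> _ [_ [z _ <-] <-]; exists z.
Qed.

Lemma translate_ind (K : realType) (R_finite : forall m : Rx, finite_set [set: Rmod (m : R)])
    g r m b k c n : frac_of g r m b ->
  C0_action K (affine_action R) g (coset_ind R_finite K k c n) =
  coset_ind R_finite K (nzM m k) ((r : R) * c + (k : R) * b) (nzM r n).
Proof.
move=> gf; apply: C0_ext => w.
rewrite -[LHS]/(coset_ind R_finite K k c n (affine_action R g^-1%g w)).
have [W|W] := pselect (ball_set k c n (affine_action R g^-1%g w)).
  rewrite (indT _ _ W) indT// (ball_set_act _ _ _ gf).
  by exists (affine_action R g^-1%g w) => //; rewrite -affine_actM mulgV affine_act1.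
rewrite (indF _ _ W) indF// (ball_set_act _ _ _ gf) => -[w' W' E].
by apply: W; rewrite -E -[affine_act g w']/(affine_action R g w') -tactM mulVg tact1.
Qed.

End Fractions.

(** * Words in the generators of the ring algebra *)

Section Words.
Variables (K : realType) (R : idomainType).
Local Notation C := (K[i]).
Local Notation Rx := (nonzero R).
Hypothesis R_finite : forall m : Rx, finite_set [set: Rmod (m : R)].
Variables (A : cstarAlgType C) (oneA : A) (s : Rx -> A) (u : R -> A).
Hypothesis rel : ring_relations oneA s u.
Implicit Types (k l m n q r t : Rx) (b c d e f : R) (x y : A).

Lemma mul1A x : oneA ** x = x. Proof. by have [] := rr_unit rel x. Qed.
Lemma mulA1 x : x ** oneA = x. Proof. by have [] := rr_unit rel x. Qed.
Lemma star1A : oneA^^* = oneA.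
Proof. by apply: star_faithful => z; rewrite mulA1 -{1}[z]starK -starM mul1A starK. Qed.

Lemma gen_sK m x : (s m)^^* ** (s m ** x) = x.
Proof. by rewrite smulA (rr_isometry rel) mul1A. Qed.

Lemma nzM1 m : nzM m (nz1 R) = m.
Proof. by apply: nz_inj; rewrite /= mulr1. Qed.

Lemma nzMC m l : nzM m l = nzM l m.
Proof. by apply: nz_inj; rewrite /= mulrC. Qed.

Lemma gen_sM m l x : s m ** (s l ** x) = s (nzM m l) ** x.
Proof. by rewrite smulA (rr_s rel). Qed.
Lemma gen_sKM m l x : (s m)^^* ** (s (nzM m l) ** x) = s l ** x.
Proof. by rewrite -gen_sM gen_sK. Qed.

Lemma gen_sstarM m l x : (s m)^^* ** ((s l)^^* ** x) = (s (nzM l m))^^* ** x.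
Proof. by rewrite smulA -starM (rr_s rel). Qed.

Lemma gen_u0 : u 0 = oneA.
Proof.
by rewrite -[LHS]mul1A -(rr_unitaryl rel 0) -smulA (rr_u rel) addr0.
Qed.

Lemma gen_uD b c x : u b ** (u c ** x) = u (b + c) ** x.
Proof. by rewrite smulA (rr_u rel). Qed.

Lemma gen_uN b : (u b)^^* = u (- b).
Proof.
rewrite -[LHS]mulA1 -gen_u0 -(subrr b) -(rr_u rel) smulA (rr_unitaryl rel).
exact: mul1A.
Qed.

Lemma gen_s1 : s (nz1 R) = oneA.
Proof.
rewrite -[LHS]mul1A -(rr_isometry rel (nz1 R)) -smulA (rr_s rel).
by congr (_ ** s _); apply: nz_inj; rewrite /= mulr1.
Qed.

Lemma gen_su m b x : s m ** (u b ** x) = u ((m : R) * b) ** (s m ** x).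
Proof. by rewrite !smulA (rr_su rel). Qed.

Lemma gen_us m b x : u b ** ((s m)^^* ** x) = (s m)^^* ** (u ((m : R) * b) ** x).
Proof.
rewrite !smulA; congr (_ ** x); apply: (can_inj starK).
by rewrite !starM starK !gen_uN (rr_su rel) mulrN.
Qed.

(** The partial affine bijection from the coset [d + m R] onto the coset
    [b + r R]. Computations in [A] are mostly compositions of these. *)
Definition coset_word b r m d : A := u b ** (s r ** ((s m)^^* ** u (- d))).

Lemma word_star b r m d : (coset_word b r m d)^^* = coset_word d m r b.
Proof. by rewrite /coset_word !starM !starK !gen_uN opprK -!smulA. Qed.

(** Composition, when the range of the second partial bijection is contained in the
    domain of the first. *)
Lemma word_mul b r m d e t q f :
  coset_word b r m d ** coset_word (d + (m : R) * e) (nzM m t) q f =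
  coset_word (b + (r : R) * e) (nzM r t) q f.
Proof.
rewrite /coset_word -!smulA gen_uD (addrA (- d)) addNr add0r -gen_us gen_sKM.
by rewrite gen_su gen_uD gen_sM.
Qed.

Lemma word_mul1 b r m d q f :
  coset_word b r m d ** coset_word d m q f = coset_word b r q f.
Proof.
have := word_mul b r m d 0 (nz1 R) q f; rewrite !mulr0 !addr0.
by rewrite !nzM1.
Qed.

Lemma word_conj t b r m d : s t ** coset_word b r m d ** (s t)^^* =
  coset_word ((t : R) * b) (nzM t r) (nzM t m) ((t : R) * d).
Proof.
apply: smul_faithful => z; rewrite /coset_word -!smulA gen_su gen_sM gen_us gen_sstarM.
by rewrite mulrN.
Qed.

Lemma word_s m : coset_word 0 m (nz1 R) 0 = s m.
Proof. by rewrite /coset_word oppr0 gen_u0 gen_s1 star1A !mul1A mulA1. Qed.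

Lemma word_u b : coset_word b (nz1 R) (nz1 R) 0 = u b.
Proof. by rewrite /coset_word oppr0 gen_u0 gen_s1 star1A !mul1A mulA1. Qed.

Lemma word_one b : coset_word b (nz1 R) (nz1 R) b = oneA.
Proof. by rewrite /coset_word gen_s1 star1A !mul1A (rr_u rel) subrr gen_u0. Qed.

(** The partial bijection depends on the coset [d + m R], not on [d]. *)
Lemma word_shift b r m d e :
  coset_word (b + (r : R) * e) r m (d + (m : R) * e) = coset_word b r m d.
Proof.
rewrite /coset_word -gen_uD -gen_su; congr (_ ** (_ ** _)).
by rewrite gen_us (rr_u rel) opprD addrCA subrr addr0.
Qed.

(** The affine map [x |-> r x + B] carries the coset [c + m R] onto the coset
    [r c + B + r m R]. *)
Lemma word_conj_fix B r c m :
  u B ** (s r ** coset_word c m m c) =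
  coset_word ((r : R) * c + B) (nzM r m) (nzM r m) ((r : R) * c + B) ** (u B ** s r).
Proof.
apply: smul_faithful => z; rewrite /coset_word -!smulA gen_su gen_uD gen_sM (addrC B).
congr (_ ** (_ ** _)).
rewrite gen_uD opprD -addrA addNr addr0 -gen_sstarM.
by rewrite -mulrN -gen_us gen_sK.
Qed.

(** The range projection of [u^c s_m], i.e. the indicator of [c + m Rhat]. *)
Definition coset_proj c m : A := coset_word c m m c.

Lemma cproj_projection c m : projection (coset_proj c m).
Proof. by split; [exact: word_mul1|exact: word_star]. Qed.

Lemma cproj_shift c c' m : cls m c = cls m c' -> coset_proj c m = coset_proj c' m.
Proof.
move=> /eqP/clsP[z E]; have -> : c = c' + (m : R) * z by rewrite -E addrC subrK.
exact: word_shift.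
Qed.

Lemma cproj_sum m : \sum_(c <- residues m) coset_proj (rep c) m = oneA.
Proof.
rewrite -(rr_sum rel m) fsbig_finite/=; last exact: R_finite.
apply: eq_bigr => c _; rewrite /coset_proj /coset_word /range_proj gen_uN -!smulA.
by [].
Qed.

(** The projections of all the cosets of [(m)] add up to [1]. *)
Lemma cproj_orthogonal c c' m : cls m c != cls m c' ->
  coset_proj c m ** coset_proj c' m = 0.
Proof.
move=> cc; rewrite -(cproj_shift (repK (cls m c))) -(cproj_shift (repK (cls m c'))).
pose P (i : Rmod (m : R)) := coset_proj (rep i) m.
rewrite -/(P (cls m c)) -/(P (cls m c')).
apply: (@projections_orthogonal K A _ (residues m) P oneA).
- exact: rr_unit rel.
- by move=> i; exact: cproj_projection.
- exact: residues_uniq.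
- exact: cproj_sum.
- exact: mem_residues.
- exact: mem_residues.
- exact: cc.
Qed.

(** Multiply the partition of unity modulo [M] by the projection: orthogonality
    modulo [m] leaves the classes contained in [c + m R]. *)
Lemma cproj_split c m M q : M = nzM m q ->
  coset_proj c m = \sum_(d <- residues M)
    (if cls m (rep d) == cls m c then 1 else 0 : C) *: coset_proj (rep d) M.
Proof.
move=> ->; rewrite -[LHS]mul1A -(cproj_sum (nzM m q)) smul_suml.
apply: eq_bigr => d _.
have sub : coset_proj (rep d) (nzM m q) ** coset_proj (rep d) m =
      coset_proj (rep d) (nzM m q).
  rewrite -[LHS]starK starM !(cproj_projection _ _).2.
  have := word_mul (rep d) m m (rep d) 0 q (nzM m q) (rep d).
  by rewrite mulr0 addr0 -/(coset_proj _ _) => ->; rewrite (cproj_projection _ _).2.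
case: eqP => [E|/eqP E].
  by rewrite scale1r -(cproj_shift E) sub.
by rewrite scale0r -sub -smulA cproj_orthogonal// smulr0.
Qed.

Lemma nm_one : nm oneA <= 1.
Proof. by apply: projection_le1; split; [exact: mul1A|exact: star1A]. Qed.

Lemma nm_s m : nm (s m) <= 1.
Proof.
rewrite -(@ler_pXn2r _ 2) ?nnegrE ?nm_ge0// expr1n -nm_cstar (rr_isometry rel).
exact: nm_one.
Qed.

Lemma nm_u b : nm (u b) <= 1.
Proof.
rewrite -(@ler_pXn2r _ 2) ?nnegrE ?nm_ge0// expr1n -nm_cstar (rr_unitaryl rel).
exact: nm_one.
Qed.

Lemma nm_mul_le1 x y : nm x <= 1 -> nm y <= 1 -> nm (x ** y) <= 1.
Proof.
move=> x1 y1; apply: (le_trans (nmM _ _)).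
by rewrite -[leRHS]mulr1; apply: ler_pM; rewrite ?nm_ge0.
Qed.

Lemma nm_word b r m d : nm (coset_word b r m d) <= 1.
Proof.
by do 3 (apply: nm_mul_le1; rewrite ?nm_star ?nm_s ?nm_u//).
Qed.

End Words.

(** * The covariant representation in the stabilization *)

Section Stabilization.
Variables (K : realType) (R : idomainType).
Local Notation C := (K[i]).
Local Notation Rx := (nonzero R).
Local Notation G := (affine_group {fraction R}).
Hypothesis R_finite : forall m : Rx, finite_set [set: Rmod (m : R)].
Variables (A : cstarAlgType C) (oneA : A) (s : Rx -> A) (u : R -> A).
Hypothesis rel : ring_relations oneA s u.
Variables (L : cstarAlgType C) (psi : Rx -> A -> L).
Hypothesis L_stab : is_stabilization s psi.
Implicit Types (k l m n q r t : Rx) (b c d e : R) (g h : G) (x y z : A) (w : L).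
Local Notation C0R := (C0 K (scrR R)).
Local Notation ind := (coset_ind R_finite K).
Local Notation word := (coset_word s u).
Local Notation cproj := (coset_proj s u).

Lemma psi_hom k : star_hom (psi k).
Proof. by have [] := L_stab. Qed.
Lemma psiD k x y : psi k (x + y) = psi k x + psi k y.
Proof. have [D _ _ _] := psi_hom k; exact: D. Qed.
Lemma psiZ k (a : C) x : psi k (a *: x) = a *: psi k x.
Proof. have [_ D _ _] := psi_hom k; exact: D. Qed.
Lemma psiM k x y : psi k (x ** y) = psi k x ** psi k y.
Proof. have [_ _ D _] := psi_hom k; exact: D. Qed.
Lemma psiS k x : psi k x^^* = (psi k x)^^*.
Proof. have [_ _ _ D] := psi_hom k; exact: D. Qed.

Lemma psi_lift l k x : psi (nzM l k) (s l ** (x ** (s l)^^*)) = psi k x.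
Proof.
have [_ H _] := L_stab; have := H k (nzM l k) (exist _ l erefl).
by move=> /(congr1 (fun F => F x)) <-; rewrite /= /stab_map /= smulA.
Qed.

Lemma psi_common k l x y : exists n x' y', psi k x = psi n x' /\ psi l y = psi n y'.
Proof.
exists (nzM l k), (s l ** (x ** (s l)^^*)), (s k ** (y ** (s k)^^*)).
by rewrite psi_lift nzMC psi_lift.
Qed.

Definition psi_range : set L := [set w | exists k x, w = psi k x].

(** The closure of the union of the images is a C*-algebra [Q] that receives the
    inductive system. The resulting map from [L] to [Q], followed by the inclusion,
    is the identity of [L] by uniqueness. *)
Lemma psi_dense : dense_in psi_range.
Proof.
have [Q QE] : exists Q : cstar_subalg L, csub_set Q = norm_closure psi_range.
  apply: norm_closure_csub.
  - by exists (nz1 R), 0; rewrite (star_hom0 (psi_hom _)).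
  - move=> _ _ [k [x ->]] [l [y ->]]; have [n [x' [y' [-> ->]]]] := psi_common k l x y.
    by exists n, (x' + y'); rewrite psiD.
  - by move=> a _ [k [x ->]]; exists k, (a *: x); rewrite psiZ.
  - move=> _ _ [k [x ->]] [l [y ->]]; have [n [x' [y' [-> ->]]]] := psi_common k l x y.
    by exists n, (x' ** y'); rewrite psiM.
  - by move=> _ [k [x ->]]; exists k, x^^*; rewrite psiS.
have Qpsi k x : csub_set Q (psi k x).
  by rewrite QE; apply: sub_norm_closure; exists k, x.
pose th k x : subCstar Q := in_sub (S := Q) (Qpsi k x).
have [_ cmp univ] := L_stab.
have thh k : star_hom (th k) by exact: (star_hom_sub (S := Q) (Qpsi k) (psi_hom k)).
have thc k n (a : divides_arrow k n) : th n \o stab_map s a = th k.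
  apply/funext => x; apply: sub_ext.
  exact: (congr1 (fun F => F x) (cmp k n a)).
have [f [[fh fE] _]] := univ _ th thh thc.
have [i [_ iU]] := univ _ psi psi_hom cmp.
have E : @subval K L Q \o f = idfun.
  rewrite -(iU idfun) //; apply/esym/iU; split.
    exact: star_hom_comp (star_hom_subval _) fh.
  by move=> k; apply/funext => x; rewrite /= -[f (psi k x)]/((f \o psi k) x) fE.
move=> w; suff : norm_closure psi_range w by [].
by rewrite -QE -[w]/(idfun w) -E; exact: subvalP.
Qed.

Lemma psi_word_lift l k b r m d :
  psi (nzM l k) (word ((l : R) * b) (nzM l r) (nzM l m) ((l : R) * d)) =
  psi k (word b r m d).
Proof. by rewrite -(word_conj rel) -smulA psi_lift. Qed.

(** With [V_n] the multiplication by [n], the map [psi n] is formally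
    [x |-> V_n^-1 x V_n]. This element is then [U_g (psi n 1)] for
    [g : x |-> (r x + b) / m]: conjugation by [V_(m n)] turns it into the map
    [x |-> r x / m + n b] on the multiples of [m]. *)
Definition ucutL_of r m b n : L := psi (nzM m n) (word ((n : R) * b) r m 0).

Lemma ucutL_of_lift t r m b n :
  ucutL_of (nzM t r) (nzM t m) ((t : R) * b) n = ucutL_of r m b n.
Proof.
rewrite /ucutL_of -[RHS](psi_word_lift t) mulr0; congr (psi _ (word _ _ _ _)).
  by apply: nz_inj => /=; ring.
by ring.
Qed.

Definition frac_r g : Rx := sval (cid (frac_ofP g)).
Definition frac_m g : Rx := sval (cid (svalP (cid (frac_ofP g)))).
Definition frac_b g : R := sval (cid (svalP (cid (svalP (cid (frac_ofP g)))))).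
Lemma frac_rep g : frac_of g (frac_r g) (frac_m g) (frac_b g).
Proof. exact: (svalP (cid (svalP (cid (svalP (cid (frac_ofP g))))))). Qed.

Definition ucutL g n : L := ucutL_of (frac_r g) (frac_m g) (frac_b g) n.

Lemma ucutL_frac g r m b n : frac_of g r m b -> ucutL g n = ucutL_of r m b n.
Proof.
move=> gf; have [E1 E2] := frac_cross (frac_rep g) gf.
rewrite /ucutL -(ucutL_of_lift m) -(ucutL_of_lift (frac_m g) r).
congr ucutL_of; [|exact: nzMC|by rewrite mulrC E2 mulrC].
by apply: nz_inj; rewrite /= mulrC E1 mulrC.
Qed.

Lemma ucutL_of_psi r m b n x :
  ucutL_of r m b n ** psi n x =
  psi (nzM m n) (u ((n : R) * b) ** (s r ** (x ** (s m)^^*))).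
Proof.
rewrite /ucutL_of -(psi_lift m n x) -psiM; congr (psi _ _).
by rewrite /coset_word oppr0 (gen_u0 rel) (mulA1 rel) -!smulA (gen_sK rel).
Qed.

(** The cut-off at a larger level has the same effect on the image of [psi n]. *)
Lemma ucutL_of_mono l r m b n x :
  ucutL_of r m b (nzM l n) ** psi n x = ucutL_of r m b n ** psi n x.
Proof.
rewrite -{1}(psi_lift l n x) !ucutL_of_psi -(psi_lift l (nzM m n)).
congr (psi _ _); first by apply: nz_inj => /=; ring.
rewrite -!smulA -!starM !(rr_s rel) (gen_su rel) !(gen_sM rel) (nzMC r l) (nzMC m l).
by congr (u _ ** _); rewrite /=; ring.
Qed.

Lemma nm_ucutL g n : nm (ucutL g n) <= 1.
Proof. exact: le_trans (star_hom_le _ (psi_hom _)) (nm_word rel _ _ _ _). Qed.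

Lemma ucutL_tends g w : exists w', tends (@div_filter R) (fun n => ucutL g n ** w) w'.
Proof.
move: w; apply: dense_tends psi_dense _ => [n w w'|_ [k [x ->]]].
  rewrite -smulBr (le_trans (nmM _ _))// -[leRHS]mul1r ler_wpM2r ?nm_ge0//.
  exact: nm_ucutL.
by exists (ucutL g k ** psi k x); exists k => t; exact: ucutL_of_mono.
Qed.

(** Left multiplication by the unitary of [g], a multiplier of [L]. *)
Definition umult g w : L := sval (cid (ucutL_tends g w)).

Lemma umult_tends g w : tends (@div_filter R) (fun n => ucutL g n ** w) (umult g w).
Proof. exact: svalP (cid (ucutL_tends g w)). Qed.

Let DF : ProperFilter (@div_filter R) := @div_filter_proper R.

Lemma umult_mul g w w' : umult g (w ** w') = umult g w ** w'.
Proof.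
apply: (tends_uniq DF (umult_tends _ _)).
under eq_fun do rewrite smulA.
exact: (lip_tends DF (lip_smulr w') (umult_tends g w)).
Qed.

Lemma umult_D g w w' : umult g (w + w') = umult g w + umult g w'.
Proof.
apply: (tends_uniq DF (umult_tends _ _)).
under eq_fun do rewrite smulDr.
exact: tendsD (umult_tends g w) (umult_tends g w').
Qed.

Lemma umult_Z g (a : C) w : umult g (a *: w) = a *: umult g w.
Proof.
apply: (tends_uniq DF (umult_tends _ _)).
under eq_fun do rewrite smulZr.
exact: (lip_tends DF (lipZ a (@lip_id K L)) (umult_tends g w)).
Qed.

Lemma umult_lip g : lip (umult g).
Proof.
exists 1 => w w'; rewrite mul1r -scaleN1r -umult_Z -umult_D scaleN1r.
apply: (tends_le DF (umult_tends _ _)); apply: filterE => n /=.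
rewrite (le_trans (nmM _ _))// -[leRHS]mul1r ler_wpM2r ?nm_ge0//.
exact: nm_ucutL.
Qed.

Lemma umult_ucutL g n x : umult g (psi n x) = ucutL g n ** psi n x.
Proof.
apply: (tends_uniq DF (umult_tends _ _)); apply: tends_near.
by exists n => t; exact: ucutL_of_mono.
Qed.

Lemma umult_psi g r m b n x : frac_of g r m b ->
  umult g (psi n x) = psi (nzM m n) (u ((n : R) * b) ** (s r ** (x ** (s m)^^*))).
Proof. by move=> gf; rewrite umult_ucutL (ucutL_frac _ gf) ucutL_of_psi. Qed.

(** It suffices to take both elements in the image of one [psi n], where the two sides
    are words; lifted to the common level [r m n] they coincide. *)
Lemma umult_adj g w w' : w^^* ** umult g w' = (umult g^-1%g w)^^* ** w'.
Proof.
move: w'; apply: (lip_eq _ _ psi_dense).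
- exact: lip_comp (lip_smull _) (umult_lip g).
- exact: lip_smull.
move=> _ [l [y ->]]; move: w; apply: (lip_eq _ _ psi_dense).
- exact: lip_comp (lip_smulr _) (@lip_star _ _).
- by apply: lip_comp (lip_smulr _) (lip_comp (@lip_star _ _) _); exact: umult_lip.
move=> _ [k [x ->]]; have [n [{}x [{}y [-> ->]]]] := psi_common k l x y.
have gf := frac_rep g; move: (frac_r g) (frac_m g) (frac_b g) gf => r m b gf.
rewrite (umult_psi _ _ gf) (umult_psi _ _ (frac_inv gf)).
rewrite -{1}(psi_lift m n) -[in RHS](psi_lift r n y) -!psiS -!psiM.
rewrite -(psi_lift r (nzM m n)) -(psi_lift m (nzM r n)).
congr (psi _ _); first by apply: nz_inj => /=; ring.
rewrite !starM !starK mulrN (gen_uN rel) opprK -!smulA.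
by rewrite -!starM !(rr_s rel) !(gen_sM rel) (nzMC r m).
Qed.

Lemma umult_comp g h w : umult g (umult h w) = umult (g * h)%g w.
Proof.
move: w; apply: (lip_eq _ _ psi_dense).
- exact: lip_comp (umult_lip g) (umult_lip h).
- exact: umult_lip.
move=> _ [n [x ->]].
have gf := frac_rep g; move: (frac_r g) (frac_m g) (frac_b g) gf => r m b gf.
have hf := frac_rep h; move: (frac_r h) (frac_m h) (frac_b h) hf => r' m' b' hf.
rewrite (umult_psi _ _ hf) (umult_psi _ _ gf) (umult_psi _ _ (frac_mul gf hf)).
congr (psi _ _); first by apply: nz_inj => /=; ring.
rewrite -!smulA (gen_su rel) (gen_uD rel) (gen_sM rel) -starM (rr_s rel).
by congr (u _ ** _); rewrite /=; ring.
Qed.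

(** The function [f] sampled at the classes modulo [n^2] in [Rhat / n]. One index
    serves for support and fineness: if [k m] divides [n], then [(c + m Rhat) / k] is a
    union of sets [(a + n^2 Rhat) / n]. *)
Definition sampled n (f : C0R) : A :=
  \sum_(a <- residues (nzM n n)) f (scr_in n (diag (rep a))) *: cproj (rep a) (nzM n n).

Lemma sampled_hom n : star_hom (sampled n).
Proof.
pose P (a : Rmod (nzM n n : R)) := cproj (rep a) (nzM n n).
have PP a : P a ** P a = P a /\ (P a)^^* = P a by exact: (cproj_projection rel).
have P0 a a' : a' != a -> P a ** P a' = 0.
  by move=> aa; apply: (cproj_orthogonal R_finite rel); rewrite !repK eq_sym.
rewrite /sampled; split.
- by move=> f f'; rewrite -big_split; apply: eq_bigr => a _; rewrite C0D scalerDl.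
- by move=> a f; rewrite scaler_sumr; apply: eq_bigr => a' _; rewrite C0Z scalerA.
- move=> f f'; rewrite smul_suml [LHS]big_seq [RHS]big_seq; apply: eq_bigr => a ar.
  rewrite smul_sumr (bigD1_seq a)//=; last exact: residues_uniq.
  rewrite [X in _ = _ + X]big1 ?addr0 => [|a' aa].
    by rewrite smulZl smulZr -!/(P _) (PP a).1 scalerA.
  by rewrite smulZl smulZr -!/(P _) P0// !scaler0.
- move=> f; rewrite star_sum; apply: eq_bigr => a _.
  by rewrite starZ -!/(P _) (PP a).2.
Qed.

(** Write [n = l k] with [l = t m]; then [n^2] is a multiple of [l m], and the
    indicator is that of the coset of [l c] modulo [l m] at level [n]. *)
Lemma sampled_ind t k c m :
  psi (nzM t (nzM k m)) (sampled (nzM t (nzM k m)) (ind k c m)) = psi k (cproj c m).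
Proof.
set n := nzM t (nzM k m); pose l := nzM t m.
have nE : n = nzM l k by apply: nz_inj => /=; ring.
rewrite /coset_proj -(psi_word_lift l) -nE; congr (psi _ _).
rewrite -/(cproj ((l : R) * c) (nzM l m)).
rewrite (@cproj_split _ _ R_finite _ _ _ _ rel _ _ (nzM n n) (nzM k (nzM t k))).
  apply: eq_bigr => a _; congr (_ *: _).
  by move: (rep a) => a'; rewrite nE -(ind_lift _ _ l) ind_in.
by apply: nz_inj => /=; ring.
Qed.

Lemma C0_rep_ex (f : C0R) : exists w, tends (@div_filter R) (fun n => psi n (sampled n f)) w.
Proof.
have sh n : star_hom (psi n \o sampled n).
  exact: star_hom_comp (psi_hom n) (sampled_hom n).
move: f; apply: dense_tends (@step_dense R R_finite K) _ => [n f f'|].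
  rewrite -[psi n (sampled n f)]/((psi n \o sampled n) f).
  rewrite -[psi n (sampled n f')]/((psi n \o sampled n) f').
  by rewrite -(star_homB _ _ (sh n)); exact: (star_hom_le _ (sh n)).
move=> _ [k [m [lam ->]]].
exists (\sum_(a <- residues m) lam a *: psi k (cproj (rep a) m)).
exists (nzM k m) => t /=; set n := nzM t _.
rewrite -[LHS]/((psi n \o sampled n) _) /step star_hom_sum//.
by apply: eq_bigr => a _; have [_ -> _ _] := sh n; rewrite /= sampled_ind.
Qed.

(** The representation of functions on the locally compact ring in [L]. *)
Definition C0_rep (f : C0R) : L := sval (cid (C0_rep_ex f)).

Lemma C0_rep_tends f : tends (@div_filter R) (fun n => psi n (sampled n f)) (C0_rep f).
Proof. exact: svalP (cid (C0_rep_ex f)). Qed.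

Lemma C0_rep_ind k c m : C0_rep (ind k c m) = psi k (cproj c m).
Proof.
apply: (tends_uniq DF (C0_rep_tends _)); apply: tends_near.
by exists (nzM k m) => t /=; rewrite sampled_ind.
Qed.

Lemma C0_rep_hom : star_hom C0_rep.
Proof.
have sh n : star_hom (psi n \o sampled n).
  exact: star_hom_comp (psi_hom n) (sampled_hom n).
split.
- move=> f f'; apply: (tends_uniq DF (C0_rep_tends _)).
  have E n : psi n (sampled n (f + f')) = psi n (sampled n f) + psi n (sampled n f').
    by case: (sh n) => D _ _ _; exact: D.
  by under eq_fun do rewrite E; exact: tendsD (C0_rep_tends f) (C0_rep_tends f').
- move=> a f; apply: (tends_uniq DF (C0_rep_tends _)).
  have E n : psi n (sampled n (a *: f)) = a *: psi n (sampled n f).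
    by case: (sh n) => _ D _ _; exact: D.
  under eq_fun do rewrite E.
  exact: (lip_tends DF (lipZ a (@lip_id K L)) (C0_rep_tends f)).
- move=> f f'; apply: (tends_uniq DF (C0_rep_tends _)).
  have E n : psi n (sampled n (f ** f')) = psi n (sampled n f) ** psi n (sampled n f').
    by case: (sh n) => _ _ D _; exact: D.
  by under eq_fun do rewrite E; exact: tendsM (C0_rep_tends f) (C0_rep_tends f').
- move=> f; apply: (tends_uniq DF (C0_rep_tends _)).
  have E n : psi n (sampled n (f^^*)) = (psi n (sampled n f))^^*.
    by case: (sh n) => _ _ _ D; exact: D.
  by under eq_fun do rewrite E; exact: (lip_tends DF (@lip_star _ _) (C0_rep_tends f)).
Qed.

Local Notation al := (C0_action K (affine_action R)).

(** Both sides are continuous and linear in [f], and continuous in [w]; for an indicator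
    function and [w] in the image of some [psi n] it is [word_conj_fix]. *)
Lemma covariance g (f : C0R) w : umult g (C0_rep f ** w) = C0_rep (al g f) ** umult g w.
Proof.
have rl := lip_star_hom C0_rep_hom; have [rD rZ _ _] := C0_rep_hom.
have [aD aZ _ _] := cact_hom al g.
move: w; apply: (lip_eq _ _ psi_dense).
- exact: lip_comp (umult_lip g) (lip_smull _).
- exact: lip_comp (lip_smull _) (umult_lip g).
move=> _ [n [x ->]]; move: f; apply: (C0_ind_ext (R_finite := R_finite)).
- by apply: lip_comp (umult_lip g) (lip_comp (lip_smulr _) _).
- apply: lip_comp (lip_smulr _) (lip_comp rl _).
  exact: lip_star_hom (cact_hom al g).
- by move=> f f'; rewrite rD smulDl umult_D.
- by move=> f f'; rewrite aD rD smulDl.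
- by move=> a f; rewrite rZ smulZl umult_Z.
- by move=> a f; rewrite aZ rZ smulZl.
move=> k c m.
have gf := frac_rep g; move: (frac_r g) (frac_m g) (frac_b g) gf => r q b gf.
rewrite (translate_ind _ _ _ _ _ gf) !C0_rep_ind.
rewrite -(psi_lift k n) /coset_proj -(psi_word_lift n k).
rewrite -(psi_word_lift n (nzM q k)) (nzMC k n) -psiM !(umult_psi _ _ gf).
have -> : nzM n (nzM q k) = nzM q (nzM n k) by apply: nz_inj => /=; ring.
rewrite -psiM; congr (psi _ _).
move: (s k ** (x ** (s k)^^*)) => z.
rewrite -!smulA; move: (z ** (s q)^^*) => {}z.
have := word_conj_fix rel ((nzM n k : R) * b) r ((n : R) * c) (nzM n m).
move=> /(congr1 (fun y => y ** z)); rewrite -!smulA => ->.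
have -> : nzM r (nzM n m) = nzM n (nzM r m) by apply: nz_inj => /=; ring.
by have -> : (r : R) * ((n : R) * c) + (nzM n k : R) * b =
   (n : R) * ((r : R) * c + (k : R) * b) by rewrite /=; ring.
Qed.

(** The product of [C0_rep f] and the unitary of [g], obtained as an element of [L]
    by applying the adjoint of the multiplier to [(C0_rep f)^*]. *)
Definition cov_elt (f : C0R) g : L := (umult g^-1%g (C0_rep f^^*))^^*.

Lemma cov_elt_mul f g w : cov_elt f g ** w = C0_rep f ** umult g w.
Proof. by rewrite /cov_elt -umult_adj; case: C0_rep_hom => _ _ _ ->; rewrite starK. Qed.

Lemma cov_elt_D (f f' : C0R) g : cov_elt (f + f') g = cov_elt f g + cov_elt f' g.
Proof.
have [rD _ _ _] := C0_rep_hom.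
by apply: smul_faithful => w; rewrite smulDl !cov_elt_mul rD smulDl.
Qed.

Lemma cov_elt_Z (a : C) (f : C0R) g : cov_elt (a *: f) g = a *: cov_elt f g.
Proof.
have [_ rZ _ _] := C0_rep_hom.
by apply: smul_faithful => w; rewrite smulZl !cov_elt_mul rZ smulZl.
Qed.

Lemma integrated_cov_elt_hom : star_hom (integrated (al := al) cov_elt).
Proof.
have [_ _ rM rS] := C0_rep_hom.
apply: integrated_hom.
- exact: cov_elt_D.
- exact: cov_elt_Z.
- move=> a b g h; apply: smul_faithful => w.
  by rewrite -smulA !cov_elt_mul covariance umult_comp smulA rM.
- move=> a g; apply: smul_faithful => w; rewrite cov_elt_mul {1}/cov_elt starK rS.
  by rewrite -umult_mul -rS covariance.
Qed.

(** By covariance, the left-hand side acts as the multiplier of [g] on the image of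
    [psi n 1]. *)
Lemma cov_elt_ind g n : cov_elt (al g (ind n 0 (nz1 R))) g = ucutL g n.
Proof.
apply: smul_faithful; apply: (lip_eq _ _ psi_dense); try exact: lip_smull.
move=> w _; rewrite cov_elt_mul -covariance C0_rep_ind.
rewrite /coset_proj (word_one rel) umult_mul umult_ucutL.
congr (_ ** _); rewrite /ucutL /ucutL_of -[in LHS](psi_lift (frac_m g) n) -psiM.
congr (psi _ _).
by rewrite /coset_word oppr0 (gen_u0 rel) (mulA1 rel) (mul1A rel) -!smulA (gen_sK rel).
Qed.

End Stabilization.

(** * The copies of the ring algebra in the crossed product *)

Section CrossedProductSide.
Variables (K : realType) (R : idomainType).
Local Notation C := (K[i]).
Local Notation Rx := (nonzero R).
Local Notation G := (affine_group {fraction R}).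
Hypothesis R_finite : forall m : Rx, finite_set [set: Rmod (m : R)].
Local Notation al := (C0_action K (affine_action R)).
Variables (X : cstarAlgType C) (j : Cc al -> X).
Hypothesis j_hom : star_hom j.
Implicit Types (k l m n q r t : Rx) (b c d e : R) (g h : G).
Local Notation C0R := (C0 K (scrR R)).
Local Notation ind := (coset_ind R_finite K).

(** The product of the function [a] and the unitary of [g]. *)
Definition cross (a : C0R) g : X := j (single al a g).

Lemma cross_D a a' g : cross (a + a') g = cross a g + cross a' g.
Proof. by rewrite /cross singleD; have [jD _ _ _] := j_hom; exact: jD. Qed.

Lemma cross_Z (c : C) a g : cross (c *: a) g = c *: cross a g.
Proof. by rewrite /cross singleZ; have [_ jZ _ _] := j_hom; exact: jZ. Qed.

Lemma cross_mul a a' g h : cross a g ** cross a' h = cross (a ** al g a') (g * h)%g.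
Proof. by have [_ _ jM _] := j_hom; rewrite /cross -jM single_mul. Qed.

Lemma cross_star a g : (cross a g)^^* = cross (al g^-1%g a^^*) g^-1%g.
Proof. by have [_ _ _ jS] := j_hom; rewrite /cross -jS single_star. Qed.

Lemma cross1_hom : star_hom (fun a => cross a 1%g).
Proof.
split.
- by move=> a a'; exact: cross_D.
- by move=> c a; exact: cross_Z.
- by move=> a a'; rewrite cross_mul cact1 mulg1.
- by move=> a; rewrite cross_star invg1 cact1.
Qed.

(** The element [x = cross c g] satisfies [x x^* = cross d 1] with [d = c c^*], and
    the homomorphism [d |-> cross d 1] is contractive. *)
Lemma cross_lip g : lip (fun a => cross a g).
Proof.
exists 1 => a a'; rewrite mul1r -scaleN1r -cross_Z -cross_D scaleN1r.
rewrite -(@ler_pXn2r _ 2) ?nnegrE ?nm_ge0// -(nm_star (cross _ _)) -(nm_star (a - a')).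
rewrite -!nm_cstar !starK cross_star cross_mul -cactM mulgV cact1.
exact: (star_hom_le _ cross1_hom).
Qed.

(** The indicator function of the compact open subgroup [Rhat / n]. *)
Definition ind1 n : C0R := ind n 0 (nz1 R).

(** The product of the unitary of [g] and [ind1 n], with the function moved to the
    left. *)
Definition ucut g n : X := cross (al g (ind1 n)) g.

Lemma ind1_idem n : ind1 n ** ind1 n = ind1 n.
Proof.
by have [] := @ind_mul_sub R R_finite K n 0 (nz1 R) n 0 (nz1 R) (@subset_refl _ _).
Qed.

Lemma al_ind1_idem g n : al g (ind1 n) ** al g (ind1 n) = al g (ind1 n).
Proof. by rewrite -cact_mul ind1_idem. Qed.

Lemma ucut_star g n : (ucut g n)^^* = cross (ind1 n) g^-1%g.
Proof. by rewrite cross_star cact_star -cactM mulVg cact1 ind_star. Qed.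

Lemma ucut_mul g h n n' : ind1 n ** al h (ind1 n') = al h (ind1 n') ->
  ucut g n ** ucut h n' = ucut (g * h)%g n'.
Proof. by move=> hn; rewrite cross_mul -cact_mul hn -cactM. Qed.

Lemma ucut_star_mul g n : (ucut g n)^^* ** ucut g n = ucut 1%g n.
Proof. by rewrite ucut_star cross_mul -cactM mulVg cact1 ind1_idem /ucut cact1. Qed.

Lemma ucut_div g h n n' : al h (ind1 n) = ind1 n' ->
  ucut g n ** (ucut h n)^^* = ucut (g * h^-1)%g n'.
Proof.
move=> hn; rewrite ucut_star cross_mul al_ind1_idem /ucut; congr (cross _ _).
by rewrite -hn -cactM mulgVK.
Qed.

Lemma ucut_mul_star g n : ucut g n ** (ucut g n)^^* = cross (al g (ind1 n)) 1%g.
Proof. by rewrite ucut_star cross_mul al_ind1_idem mulgV. Qed.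

Definition dilation l : G := affine_of l (nz1 R) 0.
Definition translation k b : G := affine_of k k b.

Lemma frac_eq g r m b r' m' b' : frac_of g r m b ->
  (r : R) * (m' : R) = (r' : R) * (m : R) -> b * (m' : R) = b' * (m : R) ->
  frac_of g r' m' b'.
Proof.
move=> [g0 g1] E0 E1; split; apply: (mulIf (nzF m)).
  by rewrite mulrAC g0 -!tofracM E0.
by rewrite mulrAC g1 -!tofracM E1.
Qed.

Lemma frac_group_eq g h r m b r' m' b' : frac_of g r m b -> frac_of h r' m' b' ->
  (r : R) * (m' : R) = (r' : R) * (m : R) -> b * (m' : R) = b' * (m : R) -> g = h.
Proof. by move=> gf hf E0 E1; apply: (frac_inj (frac_eq gf E0 E1) hf). Qed.

Lemma ind_same k c m k' c' m' : k = k' -> c = c' -> m = m' ->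
  ind k c m = ind k' c' m'.
Proof. by move=> -> -> ->. Qed.

Lemma al_dil l k : al (dilation l) (ind1 k) = ind k 0 l.
Proof.
rewrite /ind1 (translate_ind _ _ _ _ _ (frac_affine_of _ _ _)).
by apply: ind_same; rewrite ?nzM1 ?(nzMC _ k) ?nzM1// !mulr0 addr0.
Qed.

Lemma al_dil_lift l k : al (dilation l) (ind1 (nzM l k)) = ind1 k.
Proof. by rewrite al_dil /ind1 -[RHS](ind_lift _ _ l k) mulr0 nzM1. Qed.

Lemma al_tra k b : al (translation k b) (ind1 k) = ind1 k.
Proof.
rewrite /ind1 (translate_ind _ _ _ _ _ (frac_affine_of _ _ _)).
rewrite mulr0 add0r ind_lift; apply: ind_eq.
by rewrite !ball_set_full.
Qed.

Lemma al_tra_dil k b m : al (translation k b * dilation m)%g (ind1 k) = ind k b m.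
Proof.
rewrite cactM al_dil (translate_ind _ _ _ _ _ (frac_affine_of _ _ _)).
by rewrite mulr0 add0r ind_lift.
Qed.

Lemma ind1_ind k c m : ind1 k ** ind k c m = ind k c m.
Proof.
have [] := @ind_mul_sub R R_finite K k c m k 0 (nz1 R) _ => //.
by rewrite ball_set_full; exact: ball_set_sub.
Qed.

Lemma ucut_dil g k m : ucut g k ** ucut (dilation m) k = ucut (g * dilation m)%g k.
Proof. by apply: ucut_mul; rewrite al_dil ind1_ind. Qed.

Lemma ucut_tra g k b :
  ucut g k ** ucut (translation k b) k = ucut (g * translation k b)%g k.
Proof. by apply: ucut_mul; rewrite al_tra ind1_idem. Qed.

Lemma ucut_one g k : ucut g k ** ucut 1%g k = ucut g k.
Proof. by rewrite (@ucut_mul g 1%g k k) ?mulg1// cact1 ind1_idem. Qed.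

Lemma ucut_tra_dil_proj k b m :
  ucut (translation k b * dilation m)%g k **
    (ucut (translation k b * dilation m)%g k)^^* = cross (ind k b m) 1%g.
Proof. by rewrite ucut_mul_star al_tra_dil. Qed.

(** Multiplication by [l] and translation by [b / k] both map [Rhat / k] into
    itself. *)
Lemma copy_hom_relations k :
  corner_relations (ucut 1%g k) (fun l => ucut (dilation l) k)
    (fun b => ucut (translation k b) k).
Proof.
split.
- exact: ucut_one.
- by rewrite ucut_star invg1 /ucut cact1.
- by move=> m; rewrite ucut_dil mul1g ucut_one.
- by move=> b; rewrite ucut_tra mul1g ucut_one.
- by move=> m; exact: ucut_star_mul.
- by move=> b; exact: ucut_star_mul.
- by move=> b; rewrite ucut_mul_star al_tra /ucut cact1.
- move=> l m; rewrite ucut_dil; congr (ucut _ k).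
  apply: (frac_group_eq (frac_mul (frac_affine_of _ _ _) (frac_affine_of _ _ _))
    (frac_affine_of _ _ _)) => /=; ring.
- move=> b c; rewrite ucut_tra; congr (ucut _ k).
  apply: (frac_group_eq (frac_mul (frac_affine_of _ _ _) (frac_affine_of _ _ _))
    (frac_affine_of _ _ _)) => /=; ring.
- move=> m b; rewrite ucut_tra ucut_dil; congr (ucut _ k).
  apply: (frac_group_eq (frac_mul (frac_affine_of _ _ _) (frac_affine_of _ _ _))
    (frac_mul (frac_affine_of _ _ _) (frac_affine_of _ _ _))) => /=; ring.
- move=> m; rewrite fsbig_finite/=; last exact: R_finite.
  rewrite (eq_bigr (fun c : Rmod (m : R) => cross (ind k (rep c) m) 1%g)).
    rewrite -(big_morph (fun a => cross a 1%g) (fun a a' => cross_D a a' 1%g)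
      (star_hom0 cross1_hom)).
    by rewrite -/(residues m) ind_sum /ucut cact1.
  move=> c _; rewrite -ucut_tra_dil_proj /range_proj -ucut_dil starM.
  by rewrite -!smulA.
Qed.

Section WithA.
Variables (A : cstarAlgType C) (oneA : A) (s : Rx -> A) (u : R -> A).
Hypothesis A_universal : is_ring_algebra oneA s u.
Local Notation word := (coset_word s u).
Local Notation cproj := (coset_proj s u).

Lemma copy_hom_ex k : exists f : A -> X, [/\ star_hom f, f oneA = ucut 1%g k,
  (forall m, f (s m) = ucut (dilation m) k) & forall b, f (u b) = ucut (translation k b) k].
Proof. exact: (corner_hom A_universal R_finite (copy_hom_relations k)). Qed.

Definition copy_hom k : A -> X := sval (cid (copy_hom_ex k)).

Lemma copy_homP k : [/\ star_hom (copy_hom k), copy_hom k oneA = ucut 1%g k,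
  (forall m, copy_hom k (s m) = ucut (dilation m) k)
  & forall b, copy_hom k (u b) = ucut (translation k b) k].
Proof. exact: svalP (cid (copy_hom_ex k)). Qed.

(** The multiplication by [l] maps [Rhat / (l k)] onto [Rhat / k]; conjugation by it
    fixes the multiplications and turns the translation by [b / (l k)] into the
    translation by [b / k]. *)
Lemma copy_hom_compat k n (a : divides_arrow k n) :
  copy_hom n \o stab_map s a = copy_hom k.
Proof.
case: a => l nE; subst n.
have rel := A_universal.1.
have [[tD tZ tM tS] t1 ts tu] := copy_homP (nzM l k).
have [th' t1' ts' tu'] := copy_homP k.
pose c (x : A) := s l ** x ** (s l)^^*.
have ch : star_hom c.
  split; rewrite /c.
  - by move=> x y; rewrite smulDr smulDl.
  - by move=> a x; rewrite smulZr smulZl.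
  - by move=> x y; rewrite -!smulA (gen_sK rel).
  - by move=> x; rewrite !starM starK smulA.
have Yc g : ucut (dilation l * g)%g (nzM l k) ** (ucut (dilation l) (nzM l k))^^* =
    ucut (dilation l * g * (dilation l)^-1)%g k by apply: ucut_div; exact: al_dil_lift.
apply/funext => x; rewrite -[LHS]/((copy_hom (nzM l k) \o c) x).
apply: (ring_algebra_ext A_universal R_finite) => //.
- by apply: star_hom_comp => //; split.
- rewrite /= /c t1' !tM tS ts t1 ucut_one.
  by have := Yc 1%g; rewrite !mulg1 mulgV.
- move=> m; rewrite /= /c ts' !tM tS !ts ucut_dil Yc; congr (ucut _ k).
  apply: (canLR (mulgK _)).
  apply: (frac_group_eq (frac_mul (frac_affine_of _ _ _) (frac_affine_of _ _ _))
    (frac_mul (frac_affine_of _ _ _) (frac_affine_of _ _ _))) => /=; ring.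
- move=> b; rewrite /= /c tu' !tM tS ts tu ucut_tra Yc; congr (ucut _ k).
  apply: (canLR (mulgK _)).
  apply: (frac_group_eq (frac_mul (frac_affine_of _ _ _) (frac_affine_of _ _ _))
    (frac_mul (frac_affine_of _ _ _) (frac_affine_of _ _ _))) => /=; ring.
Qed.

Lemma copy_hom_cproj k c m : copy_hom k (cproj c m) = cross (ind k c m) 1%g.
Proof.
have rel := A_universal.1.
have [[tD tZ tM tS] t1 ts tu] := copy_homP k.
rewrite /coset_proj /coset_word -(gen_uN rel) smulA -starM !tM.
by rewrite tS tM ts tu ucut_dil ucut_tra_dil_proj.
Qed.

(** At level [m n] the word is the translation by [b / m], after the multiplication by
    [r], after the inverse of the multiplication by [m]. *)
Lemma copy_hom_word g r m b n : frac_of g r m b ->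
  copy_hom (nzM m n) (word ((n : R) * b) r m 0) = ucut g n.
Proof.
move=> gf; have rel := A_universal.1.
have [[tD tZ tM tS] t1 ts tu] := copy_homP (nzM m n).
rewrite /coset_word oppr0 (gen_u0 rel) (mulA1 rel) smulA !tM tS !ts tu ucut_dil.
rewrite (ucut_div _ (al_dil_lift m n)); congr (ucut _ n).
apply: (canLR (mulgK _)).
apply: (frac_group_eq (frac_mul (frac_affine_of _ _ _) (frac_affine_of _ _ _))
    (frac_mul gf (frac_affine_of _ _ _))) => /=; ring.
Qed.

(** The map [g^-1 : x |-> (m x - b) / r] sends [Rhat / k] into [Rhat / (r k)], so the
    support of the indicator lies in the image of [Rhat / (r k)] under [g]. *)
Lemma cross_ind_factor g r m b k c q : frac_of g r m b ->
  cross (ind k c q) g = cross (ind k c q) 1%g ** ucut g (nzM r k).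
Proof.
move=> gf; rewrite cross_mul cact1 mul1g; congr (cross _ _).
rewrite /ind1 (translate_ind _ _ _ _ _ gf).
have sub : ball_set k c q `<=` ball_set (nzM m (nzM r k))
    ((r : R) * 0 + (nzM r k : R) * b) (nzM r (nz1 R)).
  move=> w /ball_set_sub[x _ <-]; rewrite (ball_set_act _ _ _ gf) ball_set_full.
  exists (affine_act g^-1%g (scr_in k x)).
    by rewrite (affine_act_in _ _ (frac_inv gf)); eexists.
  by rewrite -affine_actM mulgV affine_act1.
by rewrite (@ind_mul_sub R R_finite K _ _ _ _ _ _ sub).1.
Qed.

End WithA.
End CrossedProductSide.

(** * The isomorphism *)

Theorem theorem2 (K : realType) (R : idomainType)
    (R_not_field : ~ (forall x : R, x != 0 -> x \is a GRing.unit))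
    (R_finite : forall m : nonzero R, finite_set [set: Rmod (m : R)])
    (A : cstarAlgType K[i]) (oneA : A) (s : nonzero R -> A) (u : R -> A)
    (A_universal : is_ring_algebra oneA s u)
    (L : cstarAlgType K[i]) (psi : nonzero R -> A -> L)
    (L_stabilization : is_stabilization s psi)
    (X : cstarAlgType K[i])
    (j : Cc (C0_action K (affine_action R)) -> X)
    (X_crossed_product : is_crossed_product j) :
  cstar_isomorphic L X.
Proof.
have rel := A_universal.1.
have [j_hom X_univ] := X_crossed_product.
have [psi_h psi_c L_univ] := L_stabilization.
pose th := copy_hom R_finite j_hom A_universal.
have thP k : [/\ star_hom (th k), th k oneA = ucut R_finite j 1%g k,
    (forall m, th k (s m) = ucut R_finite j (dilation m) k)
    & forall b, th k (u b) = ucut R_finite j (translation k b) k].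
  exact: copy_homP.
have [F [[F_hom Fpsi] _]] : exists! f : L -> X,
    star_hom f /\ forall k, f \o psi k = th k.
  apply: L_univ; first by move=> k; case: (thP k).
  by move=> k n a; exact: copy_hom_compat.
have [H [[H_hom Hj] _]] := X_univ _ _
  (integrated_cov_elt_hom R_finite rel L_stabilization).
have HE a g : H (cross j a g) = cov_elt R_finite rel L_stabilization a g.
  rewrite -[LHS]/((H \o j) (single _ a g)) Hj; apply: integrated_single.
  exact: cov_elt_Z.
have HY g n : H (ucut R_finite j g n) = ucutL s u psi g n by rewrite HE cov_elt_ind.
have HFpsi k x : H (F (psi k x)) = psi k x.
  rewrite -[F (psi k x)]/((F \o psi k) x) Fpsi.
  have [tH t1 ts tu] := thP k.
  rewrite -[LHS]/((H \o th k) x).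
  apply: (ring_algebra_ext A_universal R_finite) => //.
  - exact: star_hom_comp.
  - rewrite /= t1 HY (ucutL_frac rel L_stabilization _ (frac_one R)) /ucutL_of mulr0.
    by rewrite (word_one rel) nzMC nzM1.
  - move=> m; rewrite /= ts HY (ucutL_frac rel L_stabilization _ (frac_affine_of _ _ _)).
    by rewrite /ucutL_of mulr0 (word_s rel) nzMC nzM1.
  - move=> b; rewrite /= tu HY (ucutL_frac rel L_stabilization _ (frac_affine_of _ _ _)).
    have := psi_word_lift rel L_stabilization k k b (nz1 R) (nz1 R) 0.
    by rewrite /ucutL_of !nzM1 mulr0 (word_u rel).
have HF : H \o F = idfun.
  have [i [_ iU]] := L_univ _ psi psi_h psi_c.
  rewrite -(iU idfun)//; apply/esym/iU; split; first exact: star_hom_comp.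
  by move=> k; apply/funext => x; exact: HFpsi.
have HFw w : H (F w) = w := congr1 (fun f => f w) HF.
(* [F \o H] fixes the range of [F], which contains both factors of
   [cross_ind_factor]. *)
have FHE a g : F (H (cross j a g)) = cross j a g.
  have lFH : star_hom (F \o H) by exact: star_hom_comp.
  have [FHD FHZ FHM _] := lFH.
  rewrite -[LHS]/((F \o H) (cross j a g)); move: a.
  apply: (C0_ind_ext (R_finite := R_finite)).
  - apply: lip_comp (lip_star_hom lFH) _; exact: cross_lip.
  - exact: cross_lip.
  - by move=> a b; rewrite (cross_D j_hom) FHD.
  - by move=> a b; rewrite (cross_D j_hom).
  - by move=> c a; rewrite (cross_Z j_hom) FHZ.
  - by move=> c a; rewrite (cross_Z j_hom).
  move=> k c m; have [r [d [b gf]]] := frac_ofP g.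
  have FP : F (psi k (coset_proj s u c m)) = cross j (coset_ind R_finite K k c m) 1%g.
    rewrite -[LHS]/((F \o psi k) _) Fpsi; exact: copy_hom_cproj.
  have FW : F (psi (nzM d (nzM r k)) (coset_word s u ((nzM r k : R) * b) r d 0)) =
      ucut R_finite j g (nzM r k).
    rewrite -[LHS]/((F \o psi _) _) Fpsi; exact: copy_hom_word.
  by rewrite (cross_ind_factor R_finite j_hom _ _ _ gf) FHM -FP -FW /= !HFw.
have FH : F \o H = idfun.
  have [i [_ iU]] := X_univ _ j j_hom.
  rewrite -(iU idfun)//; apply/esym/iU; split; first exact: star_hom_comp.
  apply: Cc_hom_ext => [||a g].
  - exact: star_hom_comp (star_hom_comp F_hom H_hom) j_hom.
  - exact: j_hom.
  - exact: FHE.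
exists F => //; exists H => x; first exact: HFw.
exact: (congr1 (fun f => f x) FH).
Qed.
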